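(* For each of the 12 configurations $V\in\{D_5,L_5,Q_5,R_5,\;E_6,C6\text{-}72b,C6\text{-}72c,C6\text{-}72d,\;E_7,C7\text{-}126b,C7\text{-}126c,C7\text{-}126d\}$ there exists a unit-edge polytope $P^{*}$ whose vertex set is exactly $V$. Let $P=\operatorname{conv}V$ be the contact polytope. For $V\in\{D_5,L_5,E_6,E_7\}$ the contact polytope $P$ is itself unit-edge, so that $P^{*}=P$ and $P^{*}$ is convex. For each of the other eight configurations $P$ is not unit-edge, $P^{*}\neq P$, and $P^{*}$ is not convex.
   Context: **Kissing configurations.** A kissing configuration is a finite set $V\subset\mathbb{S}^{n-1}$ with $\langle u,v\rangle\le\frac12$ for all distinct $u,v\in V$. Its contact polytope is $P=\operatorname{conv}V$. The center is the origin $o$. **The 12 configurations.** Each is a finite set of vectors of squared norm $2$ listed below, scaled by $1/\sqrt2$ (and considered up to isometry). Let $e_i$ be the standard basis. For a finite set $X$ and $a\neq0$, let $R_a$ be the orthogonal reflection in $a^\perp$ and put $X^{a}=\{x\in X:\langle x,a\rangle\ge0\}\cup R_a(\{x\in X:\langle x,a\rangle>0\})$. Write $\Phi(D_m)=\{\pm e_i\pm e_j: 1\le i<j\le m\}$. In $\mathbb{R}^4$ let $A=\{\pm e_1,\dots,\pm e_4\}$, and let $B$ (resp. $C$) be the set of vectors $(\pm\frac12,\pm\frac12,\pm\frac12,\pm\frac12)$ with an even (resp. odd) number of minus signs. - Dimension 5 (40 points each). $D_5$: $\Phi(D_5)$. $L_5$: $\{(x,0):x\in\Phi(D_4)\}\cup\{(x,1):x\in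 A\}\cup\{(x,-1):x\in C\}$. With $a=(1,1,1,1,1)$: $Q_5=(D_5)^a$ and $R_5=(L_5)^a$. - Dimension 6 (72 points each). For colors $c_0,\dots,c_5\in\{A,B,C\}$ let $X(c_0\dots c_5)=\{(x,0,0):x\in\Phi(D_4)\}\cup\bigcup_{k=0}^{5}\{(x,\cos\frac{k\pi}3,\sin\frac{k\pi}3):x\in c_k\}$. $E_6=X(ABCABC)$, $C6\text{-}72b=X(ABCACB)$, $C6\text{-}72c=X(ABABAB)$, $C6\text{-}72d=X(ABABAC)$. - Dimension 7 (126 points each). Let $S_+$ (resp. $S_-$) be the vectors $(\pm\frac12)^6\in\mathbb{R}^6$ with an even (resp. odd) number of minus signs. $E_7=\{(x,0):x\in\Phi(D_6)\}\cup\{\pm\sqrt2\,e_7\}\cup\{(s,\pm\frac1{\sqrt2}):s\in S_+\}$. $C7\text{-}126b=\{(x,0):x\in\Phi(D_6)\}\cup\{\pm\sqrt2\,e_7\}\cup\{(s,\frac1{\sqrt2}):s\in S_+\}\cup\{(s,-\frac1{\sqrt2}):s\in S_-\}$. With $a=(1,0,0,0,0,0,\frac1{\sqrt2})$: $C7\text{-}126c=(E_7)^a$ and $C7\text{-}126d=(C7\text{-}126b)^a$. **Polytope.** A polytope in $\mathbb{R}^n$ (not necessarily convex) is a finite set of $(n-1)$-dimensional convex polytopes, its facets. Its faces are the faces of its facets; its $(n-2)$-faces are ridges, $(n-3)$-faces are peaks, $1$-faces are edges, $0$-faces are vertices. It is required that: (a) every ridge belongs to exactly two facets; (b) the facets containing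 any given peak form a single cycle (consecutive ones sharing a ridge through the peak) whose spherical angles sum to $2\pi$; (c) the set of facets is connected through ridges; (d) the affine hull of every facet is a hyperplane not containing the center $o$; (e) the cycle at a peak goes round exactly once: projected to the $2$-plane orthogonal to the linear span of the peak, the facets of the cycle become wedges which tile the circle with winding number one; (f) two facets sharing a ridge do not lie in the same hyperplane. A polytope is unit-edge when every edge has length $1$. It is convex when its facets are exactly the facets of the convex hull of its vertices; $\operatorname{conv}V$ is identified with its set of facets, so $P^*=P$ means that the facets of $P^*$ are the facets of $\operatorname{conv}V$. *)

(* Defs.v *)
From HB Require Import structures.
From mathcomp Require Import all_boot all_order all_algebra.
From mathcomp Require Import all_classical all_reals all_analysis.

Set Implicit Arguments.
Unset Strict Implicit.
Unset Printing Implicit Defensive.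

Import Order.TTheory GRing.Theory Num.Theory.

Local Open Scope classical_set_scope.
Local Open Scope ring_scope.

(* R^n is 'rV[R]_n. The norm that MathComp-Analysis puts on 'rV[R]_n is the
   sup norm, hence the separate Euclidean norm [enorm]. *)

Definition dot (R : realType) (n : nat) (u v : 'rV[R]_n) : R :=
  \sum_i u 0 i * v 0 i.

Definition enorm (R : realType) (n : nat) (u : 'rV[R]_n) : R :=
  Num.sqrt (dot u u).

Definition angle (R : realType) (n : nat) (u v : 'rV[R]_n) : R :=
  acos (dot u v / (enorm u * enorm v)).

Definition lin_span (R : realType) (n : nat) (S : set 'rV[R]_n)
    : set 'rV[R]_n :=
  [set x | exists (m : nat) (p : 'I_m -> 'rV[R]_n) (c : 'I_m -> R),
     (forall i, S (p i)) /\ x = \sum_i c i *: p i].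

Definition aff_hull (R : realType) (n : nat) (S : set 'rV[R]_n)
    : set 'rV[R]_n :=
  [set x | exists (m : nat) (p : 'I_m -> 'rV[R]_n) (c : 'I_m -> R),
     [/\ forall i, S (p i), \sum_i c i = 1 & x = \sum_i c i *: p i]].

Definition conv_hull (R : realType) (n : nat) (S : set 'rV[R]_n)
    : set 'rV[R]_n :=
  [set x | exists (m : nat) (p : 'I_m -> 'rV[R]_n) (c : 'I_m -> R),
     [/\ forall i, S (p i), forall i, 0 <= c i, \sum_i c i = 1
       & x = \sum_i c i *: p i]].

(* The affine hull is a translate of a linear subspace of dimension d;
   the empty set has no dimension. *)
Definition has_dim (R : realType) (n : nat) (S : set 'rV[R]_n) (d : nat)
    : Prop :=
  exists (x : 'rV[R]_n) (U : {vspace 'rV[R]_n}),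
    \dim U = d /\ aff_hull S = [set y | y - x \in U].

Definition convex_polytope (R : realType) (n : nat) (K : set 'rV[R]_n)
    : Prop :=
  exists X : set 'rV[R]_n, finite_set X /\ K = conv_hull X.

(* E is a face of the convex polytope K. With a = 0 this includes K itself
   and the empty face. *)
Definition is_face (R : realType) (n : nat) (K E : set 'rV[R]_n) : Prop :=
  exists (a : 'rV[R]_n) (b : R),
    (forall x, K x -> dot a x <= b) /\ E = [set x | K x /\ dot a x = b].

(* From here on, P : set (set 'rV[R]_n) is a polytope given by its facets.
   [n - 2] and [n - 3] are truncated, so the notions below are meant for
   3 <= n. *)

Definition poly_face (R : realType) (n : nat) (P : set (set 'rV[R]_n))
    (d : nat) (E : set 'rV[R]_n) : Prop :=
  has_dim E d /\ exists2 F, P F & is_face F E.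

Definition is_ridge (R : realType) (n : nat) (P : set (set 'rV[R]_n))
    (G : set 'rV[R]_n) : Prop := poly_face P (n - 2) G.

Definition is_peak (R : realType) (n : nat) (P : set (set 'rV[R]_n))
    (K : set 'rV[R]_n) : Prop := poly_face P (n - 3) K.

Definition is_edge (R : realType) (n : nat) (P : set (set 'rV[R]_n))
    (E : set 'rV[R]_n) : Prop := poly_face P 1 E.

Definition vertex_set (R : realType) (n : nat) (P : set (set 'rV[R]_n))
    : set 'rV[R]_n :=
  [set x | poly_face P 0 [set x]].

Definition facets_containing (R : realType) (n : nat)
    (P : set (set 'rV[R]_n)) (E : set 'rV[R]_n) : set (set 'rV[R]_n) :=
  [set F | P F /\ is_face F E].

Definition share_ridge (R : realType) (n : nat) (P : set (set 'rV[R]_n))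
    (F F' : set 'rV[R]_n) : Prop :=
  exists G, [/\ is_ridge P G, is_face F G & is_face F' G].

(* y is the orthogonal projection of x to the orthogonal complement of the
   linear span of K. *)
Definition orth_proj (R : realType) (n : nat) (K : set 'rV[R]_n)
    (x y : 'rV[R]_n) : Prop :=
  lin_span K (x - y) /\ forall z, K z -> dot y z = 0.

Definition ridge_through (R : realType) (n : nat) (F K G : set 'rV[R]_n)
    : Prop := [/\ is_face F G, has_dim G (n - 2) & is_face G K].

(* The radial projection of the facet F to the sphere is a spherical polytope;
   t is its dihedral angle at the (n-3)-face K. It is measured in the 2-plane
   orthogonal to the linear span of K, to which the two (n-2)-faces of F
   through K project as segments issuing from the origin. *)
Definition spherical_angle (R : realType) (n : nat) (F K : set 'rV[R]_n)
    (t : R) : Prop :=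
  exists (G1 G2 : set 'rV[R]_n) (x1 x2 y1 y2 : 'rV[R]_n),
    [/\ G1 <> G2,
        [/\ ridge_through F K G1, G1 x1, ~ K x1 & orth_proj K x1 y1],
        [/\ ridge_through F K G2, G2 x2, ~ K x2 & orth_proj K x2 y2]
      & t = angle y1 y2].

(* The cone generated by the projection of F to the 2-plane orthogonal to the
   linear span of the peak K. *)
Definition wedge (R : realType) (n : nat) (F K : set 'rV[R]_n)
    : set 'rV[R]_n :=
  [set z | exists (r : R) (x y : 'rV[R]_n),
     [/\ 0 <= r, F x, orth_proj K x y & z = r *: y]].

(* The facets containing K are listed without repetition in the cyclic order
   F 0, ..., F (k-1); G i is the ridge through K between F i and its cyclic
   successor. The ridges are distinct, so that two facets sharing two ridges
   through K form a cycle of length 2 but one shared ridge is not enough. *)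
Definition peak_cycle (R : realType) (n : nat) (P : set (set 'rV[R]_n))
    (K : set 'rV[R]_n) (k : nat) (F : 'I_k -> set 'rV[R]_n) : Prop :=
  [/\ injective F, range F = facets_containing P K &
      exists G : 'I_k -> set 'rV[R]_n, injective G /\
        forall i, [/\ is_ridge P (G i), is_face (G i) K,
                      is_face (F i) (G i) & is_face (F (ordS i)) (G i)]].

Definition angles_sum_to_2pi (R : realType) (n : nat) (K : set 'rV[R]_n)
    (k : nat) (F : 'I_k -> set 'rV[R]_n) : Prop :=
  exists t : 'I_k -> R,
    (forall i, spherical_angle (F i) K (t i)) /\ \sum_i t i = 2 * pi.

(* In polar coordinates with respect to an orthonormal basis (p, q) of the
   orthogonal complement of the linear span of K, the wedge of F i is the
   sector between the angles th i and th (i+1), and going through the whole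
   cycle increases the angle by 2 pi: this is winding number one, and the
   choice of (p, q) accounts for both orientations of the cycle. *)
Definition winds_once (R : realType) (n : nat) (K : set 'rV[R]_n)
    (k : nat) (F : 'I_k -> set 'rV[R]_n) : Prop :=
  exists (p q : 'rV[R]_n) (th : nat -> R),
    [/\ [/\ dot p p = 1, dot q q = 1 & dot p q = 0],
        forall z, K z -> dot p z = 0 /\ dot q z = 0,
        th k = th 0%N + 2 * pi
      & forall i : 'I_k, th i < th i.+1 /\
          wedge (F i) K =
          [set z | exists r t : R, [/\ 0 <= r, th i <= t <= th i.+1
             & z = r *: (cos t *: p + sin t *: q)]]].

Record is_polytope (R : realType) (n : nat) (P : set (set 'rV[R]_n)) : Prop :=
  IsPolytope {
    polytope_finite : finite_set P;
    polytope_facet : forall F, P F -> convex_polytope F /\ has_dim F (n - 1);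
    polytope_ridge : forall G, is_ridge P G ->
      exists F1 F2, F1 <> F2 /\ facets_containing P G = [set F1; F2];
    polytope_peak : forall K, is_peak P K ->
      exists (k : nat) (F : 'I_k -> set 'rV[R]_n),
        [/\ peak_cycle P K F, angles_sum_to_2pi K F & winds_once K F];
    polytope_connected : forall F F', P F -> P F' ->
      exists (m : nat) (C : nat -> set 'rV[R]_n),
        [/\ C 0%N = F, C m = F', forall i, (i <= m)%N -> P (C i)
          & forall i, (i < m)%N -> share_ridge P (C i) (C i.+1)];
    polytope_center : forall F, P F -> ~ aff_hull F 0;
    polytope_noncoplanar : forall F F', P F -> P F' -> F <> F' ->
      share_ridge P F F' -> aff_hull F <> aff_hull F'
  }.

Definition unit_edge (R : realType) (n : nat) (P : set (set 'rV[R]_n))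
    : Prop :=
  forall E, is_edge P E ->
    exists x y : 'rV[R]_n, E = conv_hull [set x; y] /\ enorm (x - y) = 1.

(* The convex hull of V, identified with its set of facets. *)
Definition conv_facets (R : realType) (n : nat) (V : set 'rV[R]_n)
    : set (set 'rV[R]_n) :=
  [set F | is_face (conv_hull V) F /\ has_dim F (n - 1)].

Definition is_convex (R : realType) (n : nat) (P : set (set 'rV[R]_n))
    : Prop :=
  P = conv_facets (vertex_set P).

(* The configurations. Up to [kissing_points] all vectors have squared
   norm 2, and (x, t) is [ext x t]. *)

Definition ext (R : realType) (m : nat) (x : 'rV[R]_m) (t : R)
    : 'rV[R]_(m + 1) :=
  row_mx x t%:M.

Definition layer (R : realType) (m : nat) (X : set 'rV[R]_m) (t : R)
    : set 'rV[R]_(m + 1) :=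
  [set ext x t | x in X].

Definition reflection (R : realType) (n : nat) (a x : 'rV[R]_n) : 'rV[R]_n :=
  x - (2 * dot x a / dot a a) *: a.

(* X^a: the part of X in the half-space x.a >= 0 together with the mirror
   image of its part in the open half-space. *)
Definition fold_set (R : realType) (n : nat) (X : set 'rV[R]_n)
    (a : 'rV[R]_n) : set 'rV[R]_n :=
  [set x | X x /\ 0 <= dot x a] `|`
  [set reflection a x | x in [set x | X x /\ 0 < dot x a]].

Definition basis_vec (R : realType) (n : nat) (i : 'I_n) : 'rV[R]_n :=
  delta_mx 0 i.

Definition PhiD (R : realType) (m : nat) : set 'rV[R]_m :=
  [set x | exists (i j : 'I_m) (s t : bool), (i < j)%N /\
     x = (-1) ^+ s *: basis_vec R i + (-1) ^+ t *: basis_vec R j].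
Arguments PhiD R m : clear implicits.

(* Vectors (+-1/2, ..., +-1/2); [odd_minus] is the parity of the number of
   minus signs. *)
Definition half_cube (R : realType) (m : nat) (odd_minus : bool)
    : set 'rV[R]_m :=
  [set x | exists s : {ffun 'I_m -> bool}, odd #|[set i | s i]%SET| = odd_minus
     /\ x = \row_i ((-1) ^+ s i / 2)].
Arguments half_cube R m odd_minus : clear implicits.

Definition colorA (R : realType) : set 'rV[R]_4 :=
  [set x | exists (i : 'I_4) (s : bool), x = (-1) ^+ s *: basis_vec R i].
Arguments colorA R : clear implicits.
Definition colorB (R : realType) : set 'rV[R]_4 := half_cube R 4 false.
Arguments colorB R : clear implicits.
Definition colorC (R : realType) : set 'rV[R]_4 := half_cube R 4 true.
Arguments colorC R : clear implicits.

Definition vecL5 (R : realType) : set 'rV[R]_5 :=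
  layer (PhiD R 4) 0 `|` layer (colorA R) 1 `|` layer (colorC R) (-1).
Arguments vecL5 R : clear implicits.

Definition ones5 (R : realType) : 'rV[R]_5 := const_mx 1.

Definition vecX6 (R : realType) (c : 6.-tuple (set 'rV[R]_4))
    : set 'rV[R]_6 :=
  layer (layer (PhiD R 4) 0) 0 `|`
  \bigcup_(k : 'I_6)
     layer (layer (tnth c k) (cos (k%:R * pi / 3))) (sin (k%:R * pi / 3)).

Definition vecD6A1 (R : realType) : set 'rV[R]_7 :=
  layer (PhiD R 6) 0 `|` [set ext 0 (Num.sqrt 2); ext 0 (- Num.sqrt 2)].
Arguments vecD6A1 R : clear implicits.

Definition vecE7 (R : realType) : set 'rV[R]_7 :=
  vecD6A1 R `|` layer (half_cube R 6 false) (Num.sqrt 2)^-1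
            `|` layer (half_cube R 6 false) (- (Num.sqrt 2)^-1).
Arguments vecE7 R : clear implicits.

Definition vecC7b (R : realType) : set 'rV[R]_7 :=
  vecD6A1 R `|` layer (half_cube R 6 false) (Num.sqrt 2)^-1
            `|` layer (half_cube R 6 true) (- (Num.sqrt 2)^-1).
Arguments vecC7b R : clear implicits.

Definition mirror7 (R : realType) : 'rV[R]_7 :=
  ext (basis_vec R (ord0 : 'I_6)) (Num.sqrt 2)^-1.

Inductive configuration : Set :=
  | D5 | L5 | Q5 | R5
  | E6 | C6_72b | C6_72c | C6_72d
  | E7 | C7_126b | C7_126c | C7_126d.

Definition conf_dim (c : configuration) : nat :=
  match c with
  | D5 | L5 | Q5 | R5 => 5
  | E6 | C6_72b | C6_72c | C6_72d => 6
  | E7 | C7_126b | C7_126c | C7_126d => 7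
  end.

Definition conf_vectors (R : realType) (c : configuration)
    : set 'rV[R]_(conf_dim c) :=
  let A := colorA R in let B := colorB R in let C := colorC R in
  match c return set 'rV[R]_(conf_dim c) with
  | D5 => PhiD R 5
  | L5 => vecL5 R
  | Q5 => fold_set (PhiD R 5) (ones5 R)
  | R5 => fold_set (vecL5 R) (ones5 R)
  | E6 => vecX6 [tuple A; B; C; A; B; C]
  | C6_72b => vecX6 [tuple A; B; C; A; C; B]
  | C6_72c => vecX6 [tuple A; B; A; B; A; B]
  | C6_72d => vecX6 [tuple A; B; A; B; A; C]
  | E7 => vecE7 R
  | C7_126b => vecC7b R
  | C7_126c => fold_set (vecE7 R) (mirror7 R)
  | C7_126d => fold_set (vecC7b R) (mirror7 R)
  end.
Arguments conf_vectors R c : clear implicits.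

Definition kissing_points (R : realType) (c : configuration)
    : set 'rV[R]_(conf_dim c) :=
  [set (Num.sqrt 2)^-1 *: x | x in conf_vectors R c].
Arguments kissing_points R c : clear implicits.

(* Main.v *)
(* A region is a cone cut out by a few hyperplanes and generated by the part X
   of V that it contains. P* consists of the outer facets of all regions: the
   sets conv T where T = {v in X : m.v = 1} spans and m <= 1 on X. Since the
   region cones tile space face to face, the cones over the sets T form a
   complete fan, which gives the ridge condition (a), the winding conditions
   (b) and (e) (near a peak the cones project to sectors tiling the plane) and
   connectedness (c) (a generic segment avoids all cones of codimension 2).
   Edges are unit because of a local criterion: if x, y in X are distinct and
   x.y is not 1/2, then x + y = 0, or x + y is in X, or x + y is a sum of two
   other vectors of X, or 2 (x + y) is a sum of three vectors of X; no
   supporting hyperplane can then expose [x, y].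
   For (f), a functional m equal to 1 on coplanar facets of two regions can be
   moved by reflections preserving both regions until it is dominant for a set
   of simple roots; its supporting data then lie in a finite list.
   A region that is all of V yields the convex cases; in the other cases conv V
   has an explicit edge longer than 1. All conditions on V are finite and
   rational after scaling the coordinates by square roots, and are decided by
   integer arithmetic. *)

Require Import Defs.
From Stdlib Require Import ZArith.
From mathcomp Require Import all_boot all_order all_algebra.
From mathcomp Require Import all_classical all_reals all_analysis.
From mathcomp Require Import zify ssrZ ring lra.

Set Implicit Arguments.
Unset Strict Implicit.
Unset Printing Implicit Defensive.

Import Order.TTheory GRing.Theory Num.Theory.

Local Open Scope classical_set_scope.
Local Open Scope ring_scope.

(** * Spans and cones *)

(** Each non-convex configuration is a convex one changed on one side of some hyperplanes, and these
    hyperplanes are the walls of the regions: up to isometry every region is a part of [D5], [L5],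
    [E6] or [E7]. In [vecX6] the regions are the maximal runs of layers in which any three
    consecutive colors differ. The facets are never listed. [outer_facet] quantifies over
    functionals, while covering, separation and edges are checked on whole regions. Only
    noncoplanarity concerns individual functionals, which a priori vary in a continuum; tight
    vectors and symmetry reduce them to a finite list. Two conventions carry the argument. Sets of
    vectors are sublists of one list [V], in the order of [V], so that equal sets are equal lists.
    And since each facet lies in a plane [m = 1] missing the origin, its faces are cut out by
    homogeneous conditions [a = 0], and affine statements about polytopes become linear statements
    about cones. *)

Section Dot.
Context {R : realType} {n : nat}.
Implicit Types (x y u v w : 'rV[R]_n) (a : R) (X Y : seq 'rV[R]_n).

Lemma dotC u v : dot u v = dot v u.
Proof. by apply: eq_bigr => i _; rewrite mulrC. Qed.

Lemma dotDl u v w : dot (u + v) w = dot u w + dot v w.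
Proof. by rewrite -big_split; apply: eq_bigr => i _ /=; rewrite !mxE mulrDl. Qed.

Lemma dotZl a u v : dot (a *: u) v = a * dot u v.
Proof. by rewrite mulr_sumr; apply: eq_bigr => i _; rewrite !mxE mulrA. Qed.

Lemma dotDr u v w : dot u (v + w) = dot u v + dot u w.
Proof. by rewrite !(dotC u) dotDl. Qed.

Lemma dotZr a u v : dot u (a *: v) = a * dot u v.
Proof. by rewrite !(dotC u) dotZl. Qed.

Lemma dot0l u : dot 0 u = 0.
Proof. by rewrite -(scale0r 0) dotZl mul0r. Qed.

Lemma dot0r u : dot u 0 = 0.
Proof. by rewrite dotC dot0l. Qed.

Lemma dotNl u v : dot (- u) v = - dot u v.
Proof. by rewrite -scaleN1r dotZl mulN1r. Qed.

Lemma dotNr u v : dot u (- v) = - dot u v.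
Proof. by rewrite !(dotC u) dotNl. Qed.

Lemma dotBl u v w : dot (u - v) w = dot u w - dot v w.
Proof. by rewrite dotDl dotNl. Qed.

Lemma dotBr u v w : dot u (v - w) = dot u v - dot u w.
Proof. by rewrite dotDr dotNr. Qed.

Lemma dot_sumr (I : Type) (r : seq I) (P : pred I) (F : I -> 'rV[R]_n) u :
  dot u (\sum_(i <- r | P i) F i) = \sum_(i <- r | P i) dot u (F i).
Proof.
by elim/big_rec2: _ => [|i y x _ <-]; rewrite ?dot0r ?dotDr.
Qed.

Lemma dot_suml (I : Type) (r : seq I) (P : pred I) (F : I -> 'rV[R]_n) u :
  dot (\sum_(i <- r | P i) F i) u = \sum_(i <- r | P i) dot (F i) u.
Proof. by rewrite dotC dot_sumr; apply: eq_bigr => i _; rewrite dotC. Qed.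

Lemma dot_ge0 u : 0 <= dot u u.
Proof. by apply: sumr_ge0 => i _; rewrite -expr2 sqr_ge0. Qed.

Lemma dot_eq0 u : (dot u u == 0) = (u == 0).
Proof.
apply/idP/eqP => [|->]; last by rewrite dot0l.
rewrite psumr_eq0 => [/allP h|i _]; last by rewrite -expr2 sqr_ge0.
apply/rowP => i; rewrite mxE; apply/eqP.
by have := h i (mem_index_enum i); rewrite mulf_eq0 orbb.
Qed.

Lemma dot_gt0 u : (0 < dot u u) = (u != 0).
Proof. by rewrite lt_def dot_eq0 dot_ge0 andbT. Qed.

(* Orthogonality to a family replaces ranks and dimensions throughout: a
   family spans iff its only normal is 0. *)
Definition orth Y y := forall v, v \in Y -> dot y v = 0.
Definition spans Y := forall y, orth Y y -> y = 0.

(** Coefficients belong to vectors rather than to positions, so passing to sublists needs no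
    reindexing; the price is [uniq] wherever one vector must receive a prescribed coefficient. *)
Definition inspan X x := exists c : 'rV[R]_n -> R, x = \sum_(v <- X) c v *: v.

Definition incone X x := exists c : 'rV[R]_n -> R,
  (forall v, 0 <= c v) /\ x = \sum_(v <- X) c v *: v.

Definition indep X := forall c : 'rV[R]_n -> R,
  \sum_(v <- X) c v *: v = 0 -> forall v, v \in X -> c v = 0.

Lemma orth_inspan Y y x : orth Y y -> inspan Y x -> dot y x = 0.
Proof.
move=> h [c ->]; rewrite dot_sumr big_seq big1 // => v vY.
by rewrite dotZr h ?mulr0.
Qed.

Lemma sum_indicator X x (f : 'rV[R]_n -> R) : uniq X -> x \in X ->
  \sum_(v <- X) (if v == x then f v else 0) *: v = f x *: x.
Proof.
move=> uX xX; rewrite (bigD1_seq x) //= eqxx big1 ?addr0 // => v /negPf ->.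
by rewrite scale0r.
Qed.

Lemma inspan_mem X x : uniq X -> x \in X -> inspan X x.
Proof.
move=> uX xX; exists (fun v => if v == x then 1 else 0).
by rewrite (sum_indicator (fun _ => 1)) // scale1r.
Qed.

Lemma incone_mem X x : uniq X -> x \in X -> incone X x.
Proof.
move=> uX xX; exists (fun v => if v == x then 1 else 0).
split; first by move=> v; case: ifP.
by rewrite (sum_indicator (fun _ => 1)) // scale1r.
Qed.

Lemma inspan0 X : inspan X 0.
Proof. by exists (fun _ => 0); rewrite big1 // => v _; rewrite scale0r. Qed.

Lemma inspanD X x y : inspan X x -> inspan X y -> inspan X (x + y).
Proof.
move=> [c ->] [d ->]; exists (fun v => c v + d v).
by rewrite -big_split; apply: eq_bigr => v _; rewrite scalerDl.
Qed.

Lemma inspanZ X a x : inspan X x -> inspan X (a *: x).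
Proof.
move=> [c ->]; exists (fun v => a * c v).
by rewrite scaler_sumr; apply: eq_bigr => v _; rewrite scalerA.
Qed.

Lemma inspan_cons X x y : uniq (y :: X) -> inspan X x -> inspan (y :: X) x.
Proof.
move=> /= /andP[yX uX] [c ->].
exists (fun v => if v == y then 0 else c v); rewrite big_cons eqxx scale0r add0r.
by apply: eq_big_seq => v vX; case: eqP => // vy; rewrite -vy vX in yX.
Qed.

Lemma incone0 X : incone X 0.
Proof. by exists (fun _ => 0); split=> //; rewrite big1 // => v _; rewrite scale0r. Qed.

Lemma inconeD X x y : incone X x -> incone X y -> incone X (x + y).
Proof.
move=> [c [c0 ->]] [d [d0 ->]]; exists (fun v => c v + d v); split.
  by move=> v; rewrite addr_ge0.
by rewrite -big_split; apply: eq_bigr => v _; rewrite scalerDl.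
Qed.

Lemma inconeZ X a x : 0 <= a -> incone X x -> incone X (a *: x).
Proof.
move=> a0 [c [c0 ->]]; exists (fun v => a * c v); split.
  by move=> v; rewrite mulr_ge0.
by rewrite scaler_sumr; apply: eq_bigr => v _; rewrite scalerA.
Qed.

Lemma incone_sum_seq Y (F : 'rV[R]_n -> 'rV[R]_n) X :
  (forall v, v \in Y -> incone X (F v)) -> incone X (\sum_(v <- Y) F v).
Proof.
move=> h; rewrite big_seq; apply: (big_ind (incone X)) => //; first exact: incone0.
by move=> x y; exact: inconeD.
Qed.

Lemma incone_trans X Y x : (forall v, v \in Y -> incone X v) -> incone Y x -> incone X x.
Proof.
move=> h [c [c0 ->]]; apply: incone_sum_seq => v vY.
by apply: inconeZ => //; apply: h.
Qed.

Lemma incone_sub X Y x : uniq X -> {subset Y <= X} -> incone Y x -> incone X x.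
Proof. by move=> uX YX; apply: incone_trans => v /YX; exact: incone_mem. Qed.

Lemma incone_ge0 X x y : (forall v, v \in X -> 0 <= dot y v) -> incone X x ->
  0 <= dot y x.
Proof.
move=> h [c [c0 ->]]; rewrite dot_sumr big_seq sumr_ge0 // => v vX.
by rewrite dotZr mulr_ge0 ?h.
Qed.

Lemma incone_le0 X x y : (forall v, v \in X -> dot y v <= 0) -> incone X x ->
  dot y x <= 0.
Proof.
move=> h /(@incone_ge0 _ _ (- y)); rewrite dotNl oppr_ge0; apply => v vX.
by rewrite dotNl oppr_ge0 h.
Qed.

Lemma incone_eq0 X y (c : 'rV[R]_n -> R) :
  (forall v, v \in X -> 0 <= dot y v) -> (forall v, 0 <= c v) ->
  dot y (\sum_(v <- X) c v *: v) = 0 -> forall v, v \in X -> 0 < c v -> dot y v = 0.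
Proof.
move=> h c0; rewrite dot_sumr big_seq => /eqP; rewrite psumr_eq0; last first.
  by move=> v vX; rewrite dotZr mulr_ge0 ?h.
move=> /allP z v vX cv; have := z v vX; rewrite vX dotZr mulf_eq0 gt_eqF //=.
by move/eqP.
Qed.

Lemma sum_orth X y : (forall v, v \in X -> 0 <= dot y v) ->
  dot y (\sum_(v <- X) v) = 0 -> orth X y.
Proof.
move=> h s v vX; apply: (@incone_eq0 X y (fun _ => 1)) => //.
by rewrite -[RHS]s; congr dot; apply: eq_bigr => w _; rewrite scale1r.
Qed.

Lemma incone_sumX X : incone X (\sum_(v <- X) v).
Proof. by exists (fun _ => 1); split=> //; apply: eq_bigr => v _; rewrite scale1r. Qed.

(** Gram-Schmidt, one vector at a time: [w] is the part of the new vector [y] orthogonal to the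
    earlier ones, and if it vanishes [y] contributes nothing. *)
Lemma proj_exists X x : uniq X -> exists z, inspan X z /\ orth X (x - z).
Proof.
elim: X x => [|y X IH] x /=; first by move=> _; exists 0; split; [exact: inspan0|].
move=> /andP[yX uX]; have uyX : uniq (y :: X) by rewrite /= yX.
have [z [zX oz]] := IH x uX; have [t [tX ot]] := IH y uX.
case: (eqVneq (y - t) 0) => [/eqP|yt0].
  rewrite subr_eq0 => /eqP yt; exists z; split; first exact: inspan_cons.
  move=> v; rewrite inE => /orP[/eqP->|]; last exact: oz.
  by rewrite yt; apply: orth_inspan tX.
set w := y - t in ot yt0; set k := dot x w / dot w w.
have wspan : inspan (y :: X) w.
  apply: inspanD; first by apply: inspan_mem; rewrite ?mem_head.
  by rewrite -scaleN1r; apply: inspanZ; apply: inspan_cons.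
exists (z + k *: w); split.
  by apply: inspanD; [exact: inspan_cons|apply: inspanZ].
have oX : orth X (x - (z + k *: w)).
  move=> v vX; rewrite opprD addrA dotBl oz // dotZl ot //; ring.
move=> v; rewrite inE => /orP[/eqP->|]; last exact: oX.
have -> : y = w + t by rewrite subrK.
rewrite dotDr (orth_inspan oX tX) addr0 opprD addrA dotBl dotBl dotZl.
rewrite (dotC z) (orth_inspan ot zX) subr0 /k divfK ?subrr //.
by rewrite dot_eq0.
Qed.

(** The residual of the projection is itself a normal of [X], hence orthogonal to itself. *)
Lemma inspan_orthP X x : uniq X -> (forall y, orth X y -> dot y x = 0) -> inspan X x.
Proof.
move=> uX h; have [z [zX oz]] := proj_exists x uX.
have : dot (x - z) (x - z) = 0.
  by rewrite dotBr (h _ oz) (orth_inspan oz zX) subr0.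
by move/eqP; rewrite dot_eq0 subr_eq0 => /eqP ->.
Qed.

Lemma spans_inspan X x : uniq X -> spans X -> inspan X x.
Proof. by move=> uX sX; apply: inspan_orthP => // y /sX ->; rewrite dot0l. Qed.

Lemma not_spans X : ~ spans X -> exists w, w != 0 /\ orth X w.
Proof.
move=> /existsNP[w /not_implyP[ow /eqP w0]]; by exists w.
Qed.

Lemma spans_sub X Y : {subset X <= Y} -> spans X -> spans Y.
Proof. by move=> XY h y oy; apply: h => v /XY; exact: oy. Qed.

(** The residual of [b] after projection to the span of the others is nonzero by independence.
    Rescaled, the residuals form a dual basis, whose sum is [m]. *)
Lemma indep_dual X : uniq X -> indep X -> exists m, forall v, v \in X -> dot m v = 1.
Proof.
move=> uX iX.
have D b : b \in X -> exists w, dot w b = 1 /\ forall v, v \in X -> v != b -> dot w v = 0.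
  move=> bX; have uB : uniq (rem b X) by exact: rem_uniq.
  have [z [[c zc] oz]] := proj_exists b uB.
  have memB v : (v \in rem b X) = (v != b) && (v \in X) by rewrite mem_rem_uniq.
  have bz : b - z != 0.
    apply/negP; rewrite subr_eq0 => /eqP bz.
    have : \sum_(v <- X) (if v == b then 1 else - c v) *: v = 0.
      rewrite (perm_big _ (perm_to_rem bX)) /= big_cons eqxx scale1r.
      rewrite [X in X + _]bz zc -big_split big_seq big1 // => v; rewrite memB => /andP[/negPf -> _].
      by rewrite scaleNr /= subrr.
    by move=> /(iX (fun v => if v == b then 1 else - c v))/(_ b bX) /eqP;
      rewrite eqxx oner_eq0.
  have zz : dot (b - z) b = dot (b - z) (b - z).
    have zs : inspan (rem b X) z by exists c.
    by rewrite [RHS]dotBr (orth_inspan oz zs) subr0.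
  exists ((dot (b - z) (b - z))^-1 *: (b - z)); split.
    by rewrite dotZl zz mulVf // dot_eq0.
  by move=> v vX vb; rewrite dotZl (oz v) ?mulr0 // memB vb vX.
have [f hf] : exists f : 'rV[R]_n -> 'rV[R]_n, forall b, b \in X ->
    dot (f b) b = 1 /\ forall v, v \in X -> v != b -> dot (f b) v = 0.
  have /choice : forall b, exists w, b \in X ->
    dot w b = 1 /\ forall v, v \in X -> v != b -> dot w v = 0.
    by move=> b; case: (boolP (b \in X)) => [/D[w hw]|_]; [exists w|exists 0].
  by move=> [f hf]; exists f.
exists (\sum_(b <- X) f b) => v vX; rewrite dot_suml (bigD1_seq v) //=.
rewrite (hf v vX).1 big_seq_cond big1 ?addr0 // => b /andP[bX bv].
by rewrite (hf b bX).2 // eq_sym.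
Qed.

End Dot.

(** * Outer facets of finite cones *)

Section Finite.
Context {R : realType} {T : eqType}.

Lemma seq_argmin (f : T -> R) (s : seq T) (i0 : T) : i0 \in s ->
  exists2 i, i \in s & forall j, j \in s -> f i <= f j.
Proof.
elim: s i0 => // i s IH i0 _; case: s IH => [_|k s IH].
  by exists i; rewrite ?mem_head // => j; rewrite inE => /eqP ->.
have [|m ms hm] := IH k; first exact: mem_head.
case: (leP (f i) (f m)) => him.
  exists i; rewrite ?mem_head // => j; rewrite inE => /orP[/eqP -> //|/hm].
  exact: le_trans.
exists m; first by rewrite inE ms orbT.
by move=> j; rewrite inE => /orP[/eqP ->|/hm //]; exact: ltW.
Qed.

(** The cost is a partial function given by its graph: a sublist need not be a basis for the point
    at hand, or the tight set of an admissible functional. *)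
Lemma seq_argmin_rel (Q : T -> R -> Prop) (s : seq T) :
  (forall i a b, Q i a -> Q i b -> a = b) ->
  (exists i a, i \in s /\ Q i a) ->
  exists i a, [/\ i \in s, Q i a & forall j b, j \in s -> Q j b -> a <= b].
Proof.
move=> fQ; elim: s => [|k s IH] [i [a [ks Qia]]]; first by rewrite in_nil in ks.
have [hs|hs] := pselect (exists i a, i \in s /\ Q i a); last first.
  have ik : i = k.
    move: ks; rewrite inE => /orP[/eqP //|is_]; by case: hs; exists i, a.
  exists k, a; rewrite mem_head -ik; split=> // j b; rewrite inE => /orP[/eqP ->|js] Qb.
    by rewrite (fQ _ _ _ Qia Qb).
  by case: hs; exists j, b.
have [j [b [js Qb hb]]] := IH hs.
have [[c Qc]|hk] := pselect (exists c, Q k c); last first.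
  exists j, b; split=> //; first by rewrite inE js orbT.
  move=> l d; rewrite inE => /orP[/eqP ->|ls] Qd; last exact: hb Qd.
  by case: hk; exists d.
case: (leP b c) => bc.
  exists j, b; split=> //; first by rewrite inE js orbT.
  move=> l d; rewrite inE => /orP[/eqP ->|ls] Qd; last exact: hb Qd.
  by rewrite -(fQ _ _ _ Qc Qd).
exists k, c; split=> //; first by rewrite mem_head.
move=> l d; rewrite inE => /orP[/eqP ->|ls] Qd.
  by rewrite -(fQ _ _ _ Qc Qd).
by apply: le_trans (hb _ _ ls Qd); exact: ltW.
Qed.

(** Stands in for convergent subsequences: among finitely many alternatives one holds frequently
    ([freq_pigeonhole]), and weak linear inequalities that hold frequently hold at 0
    ([freq_lin_ge0]). *)
Definition freq (Q : R -> Prop) := forall d, 0 < d -> exists e, [/\ 0 < e, e < d & Q e].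

Lemma freq_pigeonhole (s : seq T) (Q : T -> R -> Prop) :
  freq (fun e => exists2 i, i \in s & Q i e) -> exists2 i, i \in s & freq (Q i).
Proof.
elim: s => [|k s IH] h; first by have [e [_ _ []]] := h 1 ltr01.
have [hk|/existsNP[d /not_implyP[d0 hd]]] := pselect (freq (Q k)).
  by exists k; rewrite ?mem_head.
have [|i is_ hi] := IH; last by exists i => //; rewrite inE is_ orbT.
move=> d' d'0; have [|e [e0 ed [i iks Qi]]] := h (Num.min d d').
  by rewrite lt_min d0.
move: ed; rewrite lt_min => /andP[ed ed']; exists e; split=> //.
move: iks; rewrite inE => /orP[/eqP ik|is_]; last by exists i.
by case: hd; exists e; rewrite -ik.
Qed.

Lemma small_pos (s : seq T) (f : T -> R) : (forall i, i \in s -> 0 < f i) ->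
  exists2 d, 0 < d & forall i, i \in s -> d <= f i.
Proof.
move=> h; case: s h => [|i0 s] h; first by exists 1.
have [i is_ hi] := @seq_argmin f (i0 :: s) i0 (mem_head _ _).
by exists (f i) => //; exact: h.
Qed.

End Finite.

Section Freq.
Context {R : realType}.
Implicit Types Q : R -> Prop.

Lemma freq_mono Q Q' : (forall e, 0 < e -> Q e -> Q' e) -> freq Q -> freq Q'.
Proof. by move=> h q d /q[e [e0 ed /h qe]]; exists e; split=> //; exact: qe. Qed.

Lemma freq_lin_ge0 (a b : R) : freq (fun e => 0 <= a + e * b) -> 0 <= a.
Proof.
move=> h; rewrite leNgt; apply/negP => a0.
have b1 : 0 < `|b| + 1 by rewrite ltr_wpDl.
have [|e [e0 ed]] := h (- a / (`|b| + 1)); first by rewrite divr_gt0 // oppr_gt0.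
rewrite leNgt => /negP; apply; move: ed; rewrite ltr_pdivlMr // => ed.
have : e * b <= e * `|b| by rewrite ler_pM2l // ler_norm.
nra.
Qed.

Lemma freq_all : freq (fun _ : R => True).
Proof. by move=> d d0; exists (d / 2); split=> //; lra. Qed.

(* Each nonzero affine function of e excludes a single value of e. *)
Lemma freq_avoid (T : eqType) (s : seq T) (f g : T -> R) Q :
  (forall i, i \in s -> f i != 0 \/ g i != 0) ->
  (exists2 d, 0 < d & forall e, 0 < e -> e < d -> Q e) ->
  freq (fun e => Q e /\ forall i, i \in s -> f i + e * g i != 0).
Proof.
move=> h [d0 d00 hQ].
have [d1 d10 hd1] : exists2 d, 0 < d & forall e, 0 < e -> e < d ->
    forall i, i \in s -> f i + e * g i != 0.
  have [|d1 d10 hd1] := @small_pos R T s (fun i =>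
      if (f i != 0) && (g i != 0) then `|f i / g i| else 1).
    by move=> i is_ /=; case: ifP => // /andP[fi gi]; rewrite normr_gt0 mulf_neq0 ?invr_eq0.
  exists d1 => // e e0 ed i is_; have := hd1 i is_ => /=.
  case: (eqVneq (g i) 0) => gi /=.
    by rewrite gi mulr0 addr0 => _; case: (h i is_) => //; rewrite gi eqxx.
  case: (eqVneq (f i) 0) => fi /=.
    by move=> _; rewrite fi add0r; apply: mulf_neq0 => //; rewrite gt_eqF.
  move=> hd; apply/negP => /eqP fe.
  have ee : e = - (f i / g i) by apply: (mulIf gi); rewrite mulNr divfK //; lra.
  have : `|f i / g i| = e by rewrite -normrN -ee gtr0_norm.
  by move=> h1; move: hd; rewrite h1 leNgt ed.
move=> d d'0; set m := Num.min d (Num.min d0 d1).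
have m0 : 0 < m by rewrite !lt_min d'0 d00 d10.
have [/= md [md0 md1]] : m / 2 < d /\ m / 2 < d0 /\ m / 2 < d1.
  have : m / 2 < m by lra.
  by rewrite /m !lt_min => /andP[-> /andP[-> ->]].
by exists (m / 2); split=> //; [lra|split; [apply: hQ; lra|apply: hd1; lra]].
Qed.

End Freq.

Lemma filter_nested (T : eqType) (P Q : pred T) (s : seq T) :
  [seq v <- [seq v <- s | P v] | Q v] = [seq v <- s | Q v && P v].
Proof. by rewrite -filter_predI. Qed.

Fixpoint subs (T : Type) (X : seq T) : seq (seq T) :=
  if X is x :: X' then subs X' ++ [seq x :: B | B <- subs X'] else [:: [::]].

Lemma filter_subs (T : eqType) (P : pred T) (X : seq T) : [seq v <- X | P v] \in subs X.
Proof.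
elim: X => //= x X IH; case: ifP => _; rewrite mem_cat ?IH //.
by rewrite (map_f (cons x) IH) orbT.
Qed.

Lemma subsP (T : eqType) (X B : seq T) : uniq X -> B \in subs X ->
  B = [seq v <- X | v \in B].
Proof.
elim: X B => [|x X IH] B /=; first by rewrite inE => _ /eqP.
move=> /andP[xX uX]; rewrite mem_cat => /orP[BX|/mapP[B' B'X ->]].
  have E := IH B uX BX; case: ifP => // xB.
  by move: xX xB; rewrite E mem_filter => /negPf ->; rewrite andbF.
rewrite mem_head; congr cons; rewrite {1}(IH B' uX B'X).
apply: eq_in_filter => v vX; rewrite inE.
by case: eqP => // vx; rewrite -vx vX in xX.
Qed.

(** * Reduction to bases, closedness of finitely generated cones, and the simplex method *)

Section Cone.
Context {R : realType} {n : nat}.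
Implicit Types (x y u v w m : 'rV[R]_n) (X Y B : seq 'rV[R]_n).

(** Beyond the usual statement, the total coefficient does not grow, which the simplex argument
    needs. A linear relation [d] with nonnegative sum is subtracted, with the largest multiple that
    keeps all coefficients nonnegative; this kills one of them. *)
Lemma caratheodory X (c : 'rV[R]_n -> R) : uniq X -> (forall v, 0 <= c v) ->
  exists (P : pred 'rV[R]_n) (d : 'rV[R]_n -> R), let B := [seq v <- X | P v] in
  [/\ indep B, forall v, 0 <= d v, forall v, v \in B -> 0 < d v,
      \sum_(v <- X) c v *: v = \sum_(v <- B) d v *: v
    & \sum_(v <- B) d v <= \sum_(v <- X) c v].
Proof.
have [k] := ubnP (size X); elim: k X c => // k IH X c sX uX c0.
have drop b (c' : 'rV[R]_n -> R) : b \in X -> c' b = 0 -> (forall v, 0 <= c' v) ->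
    \sum_(v <- X) c v *: v = \sum_(v <- X) c' v *: v ->
    \sum_(v <- X) c' v <= \sum_(v <- X) c v ->
    exists (P : pred 'rV[R]_n) (d : 'rV[R]_n -> R), let B := [seq v <- X | P v] in
    [/\ indep B, forall v, 0 <= d v, forall v, v \in B -> 0 < d v,
      \sum_(v <- X) c v *: v = \sum_(v <- B) d v *: v
    & \sum_(v <- B) d v <= \sum_(v <- X) c v].
  move=> bX cb c'0 e1 e2.
  have uX' : uniq [seq v <- X | v != b] by exact: filter_uniq.
  have sX' : (size [seq v <- X | v != b] < k)%N.
    rewrite -rem_filter // size_rem //; case: (X) bX sX => //= *; lia.
  have [P [d [i d0 d1 e3 e4]]] := IH _ c' sX' uX' c'0.
  have E (V : zmodType) (F : 'rV[R]_n -> V) : F b = 0 ->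
      \sum_(v <- X) F v = \sum_(v <- [seq v <- X | v != b]) F v.
    by move=> Fb; rewrite big_filter (bigD1_seq b) //= Fb add0r.
  exists (fun v => P v && (v != b)), d.
  rewrite /= -filter_nested; split=> //.
    by rewrite e1 -e3 (E _ (fun v => c' v *: v)) //= cb scale0r.
  by apply: le_trans e4 _; rewrite -(E _ c').
have [/allP cpos|/allPn[b bX]] := boolP (all (fun v => 0 < c v) X); last first.
  by rewrite lt_neqAle c0 andbT negbK => /eqP cb; apply: (drop b c).
have [iX|/existsNP[d /not_implyP[d0]]] := pselect (indep X).
  by exists predT, c; rewrite /= filter_predT; split.
move=> /existsNP[v0 /not_implyP[v0X /eqP dv0]].
wlog ds : d d0 dv0 / 0 <= \sum_(v <- X) d v.
  move=> H; case: (leP 0 (\sum_(v <- X) d v)) => ds; first exact: H ds.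
  apply: (H (fun v => - d v)); rewrite ?oppr_eq0 //.
    by under eq_bigr => v _ do rewrite scaleNr; rewrite sumrN d0 oppr0.
  by rewrite sumrN oppr_ge0 ltW.
have /hasP[v1 v1X dv1] : has (fun v => 0 < d v) X.
  apply/negP => /negP/hasPn dn.
  have z : \sum_(v <- X) - d v = 0.
    apply/eqP; rewrite eq_le; apply/andP; split; first by rewrite sumrN oppr_le0.
    by rewrite big_seq sumr_ge0 // => v /dn; rewrite oppr_ge0 -leNgt.
  move/eqP: z; rewrite big_seq psumr_eq0 => [/allP/(_ v0 v0X)|v /dn].
    by rewrite v0X /= oppr_eq0 (negPf dv0).
  by rewrite oppr_ge0 -leNgt.
have v1s : v1 \in [seq v <- X | 0 < d v] by rewrite mem_filter dv1.
have [b] := seq_argmin (fun v => c v / d v) v1s.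
rewrite mem_filter => /andP[db bX] hb.
set t := c b / d b in hb.
have t0 : 0 <= t by rewrite divr_ge0 // ltW.
have sumX (V : zmodType) (F G : 'rV[R]_n -> V) : (forall v, v \in X -> F v = G v) ->
  \sum_(v <- X) F v = \sum_(v <- X) G v by move=> h; exact: eq_big_seq.
(* Coefficients are reset to 0 outside [X] because nonnegativity is required at every vector. *)
apply: (drop b (fun v => if v \in X then c v - t * d v else 0)) => //.
- by rewrite bX /t divfK ?gt_eqF // subrr.
- move=> v; case: ifP => // vX; rewrite subr_ge0.
  case: (ltP 0 (d v)) => dv; first by rewrite -ler_pdivlMr // hb // mem_filter dv.
  by apply: le_trans (c0 v); apply: mulr_ge0_le0.
- rewrite [RHS](sumX _ _ (fun v => c v *: v - t *: (d v *: v))) => [|v ->]; last first.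
    by rewrite scalerBl scalerA.
  by rewrite sumrB -scaler_sumr d0 scaler0 subr0.
- rewrite (sumX _ _ (fun v => c v - t * d v)) => [|v -> //].
  by rewrite sumrB -mulr_sumr gerBl mulr_ge0.
Qed.

Lemma uniq_subs X B : uniq X -> B \in subs X -> uniq B.
Proof. by move=> uX /(subsP uX) ->; exact: filter_uniq. Qed.

(** One independent [B] serves for arbitrarily small [e]. Its coefficients are unique, hence affine
    in [e]; two parameters [e1] and [e2] determine the slope [U] and the value [P] at 0, and
    nonnegativity passes to the limit. *)
Lemma incone_lim X p u : uniq X -> freq (fun e => incone X (p + e *: u)) -> incone X p.
Proof.
move=> uX h.
have {h} : freq (fun e => exists2 B, B \in subs X &
    indep B /\ exists c : 'rV[R]_n -> R, (forall v, 0 <= c v) /\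
      p + e *: u = \sum_(v <- B) c v *: v).
  apply: freq_mono h => e _ [c [c0 ->]].
  have [P [d /= [iB d0 _ -> _]]] := caratheodory uX c0.
  by exists [seq v <- X | P v]; [exact: filter_subs|split=> //; exists d].
move=> /freq_pigeonhole[B BX hB].
have uB := uniq_subs uX BX.
have [e1 [e10 _ [iB [c1 [c10 E1]]]]] := hB 1 ltr01.
have [e2 [e20 e21 [_ [c2 [c20 E2]]]]] := hB e1 e10.
pose U v := (e1 - e2)^-1 * (c1 v - c2 v); pose P v := c2 v - e2 * U v.
have e12 : e1 - e2 != 0 by rewrite subr_eq0 gt_eqF.
have uE : u = \sum_(v <- B) U v *: v.
  under eq_bigr => v _ do rewrite -scalerA scalerBl.
  rewrite -scaler_sumr sumrB -E1 -E2 opprD addrACA subrr add0r -scalerBl scalerA.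
  by rewrite mulVf // scale1r.
have pE : p = \sum_(v <- B) P v *: v.
  under eq_bigr => v _ do rewrite scalerBl -scalerA.
  by rewrite sumrB -scaler_sumr -uE -E2 addrK.
have P0 v : v \in B -> 0 <= P v.
  move=> vB; apply: (@freq_lin_ge0 _ _ (U v)).
  apply: freq_mono hB => e e0 [_ [c [c0 E]]].
  have : \sum_(w <- B) (c w - (P w + e * U w)) *: w = 0.
    under eq_bigr => w _ do rewrite scalerBl scalerDl -scalerA.
    by rewrite sumrB big_split /= -scaler_sumr -uE -pE -E subrr.
  by move=> /(iB (fun w => c w - (P w + e * U w)))/(_ v vB)/eqP; rewrite subr_eq0 => /eqP <-.
apply: (@incone_sub _ _ _ B) => //.
  by move=> v; rewrite {1}(subsP uX BX) mem_filter => /andP[].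
exists (fun v => if v \in B then P v else 0); split.
  by move=> v; case: ifP => // /P0.
by rewrite pE; apply: eq_big_seq => v ->.
Qed.

(** As [X] spans, some [v] of it is not orthogonal to the new [w]; a small step along [v] leaves
    that hyperplane without entering the earlier ones. *)
Lemma generic_point X (ws : seq 'rV[R]_n) : uniq X -> spans X ->
  (forall w, w \in ws -> w != 0) ->
  exists c : 'rV[R]_n -> R, (forall v, 0 < c v) /\
    forall w, w \in ws -> dot w (\sum_(v <- X) c v *: v) != 0.
Proof.
move=> uX sX; elim: ws => [|w ws IH] h; first by exists (fun _ => 1).
have [|c [c0 hc]] := IH; first by move=> v vw; apply: h; rewrite inE vw orbT.
have [v vX wv] : exists2 v, v \in X & dot w v != 0.
  apply/hasP; apply/negP => /negP/hasPn ow.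
  have /eqP := h w (mem_head _ _); apply; apply: sX => v /ow.
  by rewrite negbK => /eqP.
have [||e [e0 _ [_ he]]] := @freq_avoid R _ (w :: ws)
  (fun i => dot i (\sum_(v <- X) c v *: v)) (fun i => dot i v) (fun _ => True) _ _ 1 ltr01.
- by move=> i; rewrite inE => /orP[/eqP ->|/hc]; [right|left].
- by exists 1.
exists (fun x => c x + (if x == v then e else 0)); split.
  by move=> x; case: ifP => _; rewrite ?addr0 // addr_gt0.
move=> i /he; under [in X in _ -> X]eq_bigr => x _ do rewrite scalerDl.
by rewrite big_split /= (sum_indicator (fun _ => e)) // dotDr dotZr.
Qed.

(** The right-hand side 1 selects the facets of the hull that do not pass through the origin and
    have it on the inner side; the walls of a region are thereby excluded. As [T] spans, it
    determines [m]. *)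
Definition outer_facet X m T := [/\ forall v, v \in X -> dot m v <= 1,
  T = [seq v <- X | dot m v == 1] & spans T].

(* One step of the simplex method: a basis of minimal cost among those whose
   cone contains x defines a supporting hyperplane. *)
Lemma outer_facet_generic X x : uniq X -> incone X x ->
  (forall B, B \in subs X -> spans B \/ exists w, orth B w /\ dot w x != 0) ->
  exists m T, outer_facet X m T /\ incone T x.
Proof.
move=> uX [c0 [c00 x0]] gen.
pose Q B (k : R) := indep B /\ exists c : 'rV[R]_n -> R, [/\ forall v, 0 <= c v,
  x = \sum_(v <- B) c v *: v & k = \sum_(v <- B) c v].
have Qf B a b : Q B a -> Q B b -> a = b.
  move=> [iB [c [_ E ->]]] [_ [d [_ F ->]]]; apply: eq_big_seq => v vB.
  apply/eqP; rewrite -subr_eq0; apply/eqP; apply: (iB (fun v => c v - d v)) => //.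
  by under eq_bigr => w _ do rewrite scalerBl; rewrite sumrB -E -F subrr.
have [|B0 [k0 [B0X [_ [c1 [c10 E1 k0E]]] min0]]] := seq_argmin_rel (s := subs X) Qf.
  have [P [d /= [iB d0 _ E _]]] := caratheodory uX c00.
  exists [seq v <- X | P v], (\sum_(v <- [seq v <- X | P v]) d v).
  by split; [exact: filter_subs|split=> //; exists d; rewrite x0 E].
have uB0 := uniq_subs uX B0X.
have [P [c /= [iB cge cpos E le1]]] := caratheodory uB0 c10.
set B := [seq v <- B0 | P v] in iB cpos E le1.
have BX : B \in subs X.
  by rewrite /B (subsP uX B0X) filter_nested; exact: filter_subs.
have uB := uniq_subs uX BX.
have sBX : {subset B <= X} by move=> v; rewrite {1}(subsP uX BX) mem_filter => /andP[].
have xE : x = \sum_(v <- B) c v *: v by rewrite E1 E.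
(* Genericity of [x]: it lies in the span of no sublist that fails to span. *)
have sB : spans B.
  case: (gen B BX) => // -[w [ow]]; rewrite xE (orth_inspan ow) ?eqxx //.
  by exists c.
have [m hm] := indep_dual uB iB.
have mx : dot m x = \sum_(v <- B) c v.
  by rewrite xE dot_sumr; apply: eq_big_seq => v vB; rewrite dotZr hm ?mulr1.
exists m, [seq v <- X | dot m v == 1].
have BT : {subset B <= [seq v <- X | dot m v == 1]}.
  by move=> v vB; rewrite mem_filter hm ?eqxx ?sBX.
split; last by apply: incone_sub (BT) _; [exact: filter_uniq|exists c].
split=> //; last exact: spans_sub BT sB.
(* If [dot m w] exceeded 1, trading a little of the basis for an amount [t] of [w] would change the
   cost by [t * (1 - dot m w) < 0]; [caratheodory] brings the result back to an independent sublist,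
   against minimality. *)
move=> w wX; rewrite leNgt; apply/negP => mw.
have [b wE] := spans_inspan w uB sB.
have [|t t0 ht] := @small_pos R _ B (fun v => c v / (`|b v| + 1)).
  by move=> v vB; rewrite divr_gt0 ?cpos // ltr_wpDl.
pose k v := (if v \in B then c v - t * b v else 0) + (if v == w then t else 0).
have sumB (V : zmodType) (F : 'rV[R]_n -> V) :
    \sum_(v <- X) (if v \in B then F v else 0) = \sum_(v <- B) F v.
  rewrite (subsP uX BX) big_filter [RHS]big_mkcond; apply: eq_big_seq => v vX.
  by rewrite mem_filter vX andbT; case: (v \in B).
have kge v : 0 <= k v.
  apply: addr_ge0; last by case: ifP => // _; exact: ltW.
  case: ifP => // vB; rewrite subr_ge0; apply: (@le_trans _ _ (t * (`|b v| + 1))).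
    by rewrite ler_pM2l // (le_trans (ler_norm _)) // lerDl.
  by rewrite -ler_pdivlMr ?ht // ltr_wpDl.
have kE : \sum_(v <- X) k v *: v = x.
  under eq_bigr => v _ do rewrite scalerDl.
  rewrite big_split /= (sum_indicator (fun _ => t)) //.
  have -> : \sum_(v <- X) (if v \in B then c v - t * b v else 0) *: v =
      \sum_(v <- B) (c v - t * b v) *: v.
    by rewrite -sumB; apply: eq_bigr => v _; case: ifP; rewrite ?scale0r.
  under eq_bigr => v _ do rewrite scalerBl -scalerA.
  by rewrite sumrB -scaler_sumr -wE -xE subrK.
have [P' [d /= [iB' dge _ E' le2]]] := caratheodory uX kge.
have : k0 <= \sum_(v <- [seq v <- X | P' v]) d v.
  apply: (min0 _ _ (filter_subs P' X)); split; first exact: iB'.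
  by exists d; split=> //; rewrite -E' kE.
apply/negP; rewrite -ltNge; apply: le_lt_trans le2 _.
rewrite big_split /= sumB -big_mkcond /= sumrB -mulr_sumr.
have -> : \sum_(v <- B) b v = dot m w.
  by rewrite wE dot_sumr; apply: eq_big_seq => v vB; rewrite dotZr hm ?mulr1.
have -> : \sum_(v <- X | v == w) t = t.
  rewrite (big_rem w wX) /= eqxx big_seq_cond big_pred0 ?addr0 // => v.
  by rewrite mem_rem_uniq // inE /=; case: (v == w); rewrite ?andbF.
apply: lt_le_trans (_ : \sum_(v <- B) c v <= k0); last by rewrite k0E.
by nra.
Qed.

(** Genericity is removed by perturbing [x] towards a point [y] off the chosen hyperplanes through
    the non-spanning sublists. One [T] occurs for arbitrarily small perturbations, and its cone is
    closed. *)
Lemma outer_facet_cover X x : uniq X -> spans X -> incone X x ->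
  exists m T, outer_facet X m T /\ incone T x.
Proof.
move=> uX sX cx.
have /choice[W hW] : forall B, exists w, ~ spans B -> w != 0 /\ orth B w.
  by move=> B; have [sB|/not_spans[w hw]] := pselect (spans B); [exists 0|exists w].
pose Bs := [seq B <- subs X | ~~ `[< spans B >]].
have nB B : B \in Bs -> W B != 0 /\ orth B (W B).
  by rewrite mem_filter => /andP[/asboolPn/hW].
have [|z [z0 hz]] := @generic_point X (map W Bs) uX sX.
  by move=> w /mapP[B BB ->]; exact: (nB B BB).1.
set y := \sum_(v <- X) z v *: v in hz.
have cy : incone X y by exists z; split=> // v; exact: ltW.
have : freq (fun e => True /\ forall B, B \in Bs -> dot (W B) x + e * dot (W B) y != 0).
  apply: freq_avoid; last by exists 1.
  by move=> B BBs; right; apply: hz; apply: map_f.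
move=> h; have {h} : freq (fun e => exists2 T, T \in subs X &
    (exists m, outer_facet X m T) /\ incone T (x + e *: y)).
  apply: freq_mono h => e e0 [_ he].
  have [||m [T [om im]]] := @outer_facet_generic X (x + e *: y) uX.
  - by apply: inconeD => //; apply: inconeZ => //; exact: ltW.
  - move=> B BX; have [sB|nsB] := pselect (spans B); [by left|right].
    have BBs : B \in Bs by rewrite mem_filter BX andbT; exact/asboolPn.
    by exists (W B); split; [exact: (nB B BBs).2|rewrite dotDr dotZr he].
  exists T; last by split=> //; exists m.
  by have [_ -> _] := om; exact: filter_subs.
move=> /freq_pigeonhole[T TX hT].
have [e [_ _ [[m om] _]]] := hT 1 ltr01.
exists m, T; split=> //; apply: (@incone_lim _ _ y); first exact: uniq_subs TX.
by apply: freq_mono hT => d _ [].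
Qed.

End Cone.

(** * Convex hulls and dimension *)

Section Hull.
Context {R : realType} {n : nat}.
Implicit Types (x y z u v w m a p q : 'rV[R]_n) (X Y : seq 'rV[R]_n).

Definition hull X : set 'rV[R]_n := conv_hull [set` X].

(** [conv_hull] admits families with repeated points; summing over the fibers of [f] attaches the
    coefficients to vectors. *)
Lemma sum_fibers (k : nat) (f : 'I_k -> 'rV[R]_n) (V : zmodType)
    (F : 'I_k -> 'rV[R]_n -> V) X : uniq X -> (forall i, f i \in X) ->
  \sum_(v <- X) \sum_(i | f i == v) F i v = \sum_i F i (f i).
Proof.
move=> uX fX; under eq_bigr => v _ do rewrite big_mkcond.
rewrite exchange_big; apply: eq_bigr => i _ /=.
by rewrite (bigD1_seq (f i)) //= eqxx big1 ?addr0 // => v /negPf; rewrite eq_sym => ->.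
Qed.

Lemma hullP X x : uniq X -> hull X x <-> exists c : 'rV[R]_n -> R,
  [/\ forall v, 0 <= c v, \sum_(v <- X) c v = 1 & x = \sum_(v <- X) c v *: v].
Proof.
move=> uX; split=> [[k [f [c [fX c0 c1 ->]]]]|[c [c0 c1 ->]]].
  exists (fun v => \sum_(i | f i == v) c i); split.
  - by move=> v; apply: sumr_ge0.
  - by rewrite (sum_fibers (fun i _ => c i)).
  - under [RHS]eq_bigr => v _ do rewrite scaler_suml.
    by rewrite (sum_fibers (fun i v => c i *: v)).
exists (size X), (tnth (in_tuple X)), (fun i => c (tnth (in_tuple X) i)); split=> //.
- by move=> i /=; rewrite mem_tnth.
- by rewrite -c1 [RHS]big_tnth.
- by rewrite [LHS]big_tnth.
Qed.

Lemma hull_mem X v : uniq X -> v \in X -> hull X v.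
Proof.
move=> uX vX; apply/hullP => //; exists (fun w => if w == v then 1 else 0); split.
- by move=> w; case: ifP.
- rewrite (bigD1_seq v) //= eqxx big1 ?addr0 // => w /negPf -> //.
- by rewrite (sum_indicator (fun _ => 1)) // scale1r.
Qed.

Lemma hull_inspan X x : uniq X -> hull X x -> inspan X x.
Proof. by move=> uX /(hullP _ uX)[c [_ _ ->]]; exists c. Qed.

Lemma hull_dot X a b x : uniq X -> (forall v, v \in X -> dot a v = b) -> hull X x ->
  dot a x = b.
Proof.
move=> uX h /(hullP _ uX)[c [_ c1 ->]]; rewrite dot_sumr.
rewrite (eq_big_seq (fun v => c v * b)) => [|v /h]; last by rewrite dotZr => ->.
by rewrite -mulr_suml c1 mul1r.
Qed.

Lemma hull_le X a b x : uniq X -> (forall v, v \in X -> dot a v <= b) -> hull X x ->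
  dot a x <= b.
Proof.
move=> uX h /(hullP _ uX)[c [c0 c1 ->]]; rewrite dot_sumr -[b]mul1r -c1 mulr_suml.
by rewrite big_seq [leRHS]big_seq ler_sum // => v vX; rewrite dotZr ler_wpM2l ?h.
Qed.

Lemma hull_sub X Y : uniq X -> uniq Y -> {subset X <= Y} -> hull X `<=` hull Y.
Proof. by move=> _ _ XY x [k [f [c [fX c0 c1 ->]]]]; exists k, f, c; split=> // i; exact/XY/fX. Qed.

Lemma hull_convex X x y k : uniq X -> hull X x -> hull X y -> 0 <= k <= 1 ->
  hull X (k *: x + (1 - k) *: y).
Proof.
move=> uX /(hullP _ uX)[c [c0 c1 ->]] /(hullP _ uX)[d [d0 d1 ->]] /andP[k0 k1].
apply/hullP => //; exists (fun v => k * c v + (1 - k) * d v); split.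
- by move=> v; rewrite addr_ge0 // mulr_ge0 // subr_ge0.
- by rewrite big_split /= -!mulr_sumr c1 d1 !mulr1 addrC subrK.
- rewrite !scaler_sumr -big_split; apply: eq_bigr => v _.
  by rewrite /= !scalerA scalerDl.
Qed.

(** Complementary slackness: a point attaining the bound gives no weight to a generator that stays
    below it. *)
Lemma hull_face X a b : uniq X -> (forall v, v \in X -> dot a v <= b) ->
  [set x | hull X x /\ dot a x = b] = hull [seq v <- X | dot a v == b].
Proof.
move=> uX h; have uY : uniq [seq v <- X | dot a v == b] by exact: filter_uniq.
apply/seteqP; split=> x /= => [[/(hullP _ uX)[c [c0 c1 ->]] ax]|hx]; last first.
  split; first by apply: hull_sub hx => // v; rewrite mem_filter => /andP[].
  by apply: (hull_dot uY) hx => v; rewrite mem_filter => /andP[/eqP].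
have z : forall v, v \in X -> c v * (b - dot a v) = 0.
  have : \sum_(v <- X) c v * (b - dot a v) = 0.
    under eq_bigr => v _ do rewrite mulrBr.
    rewrite sumrB -mulr_suml c1 mul1r -ax dot_sumr.
    by apply/eqP; rewrite subr_eq0; apply/eqP/eq_bigr => v _; rewrite dotZr.
  rewrite big_seq => /eqP; rewrite psumr_eq0 => [/allP z v vX|v vX].
    by have := z v vX; rewrite vX => /eqP.
  by rewrite mulr_ge0 // subr_ge0 h.
have E (V : zmodType) (F : 'rV[R]_n -> V) : (forall v, c v = 0 -> F v = 0) ->
    \sum_(v <- [seq v <- X | dot a v == b]) F v = \sum_(v <- X) F v.
  move=> F0; rewrite big_filter big_mkcond; apply: eq_big_seq => v vX.
  case: eqP => // /eqP av; rewrite F0 //; move/eqP: (z v vX).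
  by rewrite mulf_eq0 subr_eq0 (eq_sym b) (negPf av) orbF => /eqP.
apply/hullP => //; exists c; split=> //; first by rewrite E.
by rewrite E // => v ->; rewrite scale0r.
Qed.

(** Subtracting [b *: m] absorbs the offset of a supporting hyperplane, so only homogeneous
    functionals remain. *)
Lemma is_faceP X m E : uniq X -> (forall v, v \in X -> dot m v = 1) ->
  is_face (hull X) E <-> exists a, (forall v, v \in X -> dot a v <= 0) /\
    E = hull [seq v <- X | dot a v == 0].
Proof.
move=> uX m1; split=> [[a [b [h ->]]]|[a [h ->]]]; last first.
  by exists a, 0; split; [move=> x; exact: hull_le|rewrite hull_face].
have hX v : v \in X -> dot a v <= b by move=> vX; apply: h; exact: hull_mem.
exists (a - b *: m); split.
  by move=> v vX; rewrite dotBl dotZl m1 // mulr1 subr_le0 hX.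
rewrite (hull_face uX hX); congr hull; apply: eq_in_filter => v vX.
by rewrite dotBl dotZl m1 // mulr1 subr_eq0.
Qed.

Lemma lin_span_hull X x : uniq X -> lin_span (hull X) x <-> inspan X x.
Proof.
move=> uX; split=> [[k [f [c [fX ->]]]]|[c ->]].
  elim/big_rec: _ => [|i y _ IH]; first exact: inspan0.
  by apply: inspanD => //; apply: inspanZ; apply: hull_inspan.
exists (size X), (tnth (in_tuple X)), (fun i => c (tnth (in_tuple X) i)); split.
  by move=> i; apply: hull_mem => //; rewrite mem_tnth.
by rewrite [LHS]big_tnth.
Qed.

Lemma aff_hull_hull X m x : uniq X -> (forall v, v \in X -> dot m v = 1) ->
  aff_hull (hull X) x <-> inspan X x /\ dot m x = 1.
Proof.
move=> uX m1; split=> [[k [f [c [fX c1 ->]]]]|[[c ->] mc]].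
  split.
    elim/big_rec: _ => [|i y _ IH]; first exact: inspan0.
    by apply: inspanD => //; apply: inspanZ; apply: hull_inspan.
  rewrite dot_sumr -c1; apply: eq_bigr => i _.
  by rewrite dotZr (hull_dot uX m1) ?mulr1.
exists (size X), (tnth (in_tuple X)), (fun i => c (tnth (in_tuple X) i)); split.
- by move=> i; apply: hull_mem => //; rewrite mem_tnth.
- rewrite -mc dot_sumr [RHS]big_tnth; apply: eq_bigr => i _.
  by rewrite dotZr m1 ?mulr1 // mem_tnth.
- by rewrite [LHS]big_tnth.
Qed.

Lemma inspanE X x : inspan X x <-> x \in <<X>>%VS.
Proof.
split=> [[c ->]|xX].
  rewrite big_seq; apply: memv_suml => v vX; apply: memvZ; exact: memv_span.
have [c [_ ->]] : exists c : 'I_(size X) -> R, True /\ x = \sum_i c i *: X`_i.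
  by exists (fun i => coord (in_tuple X) i x); split=> //; exact: coord_span.
elim/big_rec: _ => [|i y _ IH]; first exact: inspan0.
apply: inspanD => //; apply: inspanZ.
(* [X] may contain repetitions here: the coefficient of the vector is divided by its
   multiplicity. *)
exists (fun v => (index v X == index X`_i X)%:R * (count_mem X`_i X)%:R^-1).
have iX : X`_i \in X by exact: mem_nth.
have cX : (count_mem X`_i X)%:R != 0 :> R by rewrite pnatr_eq0 -lt0n -has_count has_pred1.
rewrite (bigID (pred1 X`_i)) /= [X in _ + X]big_seq_cond [X in _ + X]big1 ?addr0.
  rewrite (eq_bigr (fun=> (count_mem X`_i X)%:R^-1 *: X`_i)) => [|v /eqP ->].
    rewrite -big_filter big_const_seq count_predT size_filter iter_addr_0.
    by rewrite -scaler_nat scalerA divff // scale1r.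
  by rewrite eqxx mul1r.
move=> v /andP[vX vi]; case: eqP => [e|]; last by rewrite mul0r scale0r.
by case/eqP: vi; rewrite -(nth_index 0 vX) e nth_index.
Qed.

Lemma dim_rV : \dim {:'rV[R]_n} = n.
Proof. by rewrite dimvf /dim /= mul1n. Qed.

Lemma spansE X : uniq X -> spans X <-> \dim <<X>> = n.
Proof.
move=> uX; split=> [sX|dX].
  have -> : <<X>>%VS = fullv; last exact: dim_rV.
  by apply/vspaceP => x; rewrite memvf; apply/inspanE/spans_inspan.
have XE : <<X>>%VS = fullv by apply/eqP; rewrite eqEdim subvf dim_rV dX /=.
move=> y oy; apply/eqP; rewrite -dot_eq0; apply/eqP.
by apply: orth_inspan oy _; apply/inspanE; rewrite XE memvf.
Qed.

Lemma dim_cons X v : v \notin <<X>>%VS -> \dim <<v :: X>> = (\dim <<X>>).+1.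
Proof.
move=> vX; rewrite span_cons dimv_disjoint_sum.
  by rewrite dim_vline; case: eqP vX => [->|//]; rewrite mem0v.
apply/eqP; rewrite -subv0; apply/subvP => w.
rewrite memv_cap => /andP[/vlineP[k ->]].
case: (eqVneq k 0) => [-> _|k0]; first by rewrite scale0r mem0v.
by move=> /(memvZ k^-1); rewrite scalerA mulVf // scale1r (negPf vX).
Qed.

Lemma orth_notin X v : v != 0 -> orth X v -> v \notin <<X>>%VS.
Proof.
move=> v0 ov; apply/negP => /inspanE/(orth_inspan ov)/eqP.
by rewrite dot_eq0 (negPf v0).
Qed.

(** The plane [m = 1] misses the origin, so the linear span is the direction space [U] of the affine
    hull plus one further line. *)
Lemma has_dim_hull X m d : uniq X -> (forall v, v \in X -> dot m v = 1) ->
  has_dim (hull X) d <-> \dim <<X>> = d.+1.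
Proof.
move=> uX m1.
have key x (U : {vspace 'rV[R]_n}) : inspan X x -> dot m x = 1 ->
    (forall u, u \in U <-> inspan X u /\ dot m u = 0) -> \dim <<X>> = (\dim U).+1.
  move=> xX mx hU.
  have -> : <<X>>%VS = (<[x]> + U)%VS.
    apply/vspaceP => y; apply/idP/memv_addP => [/inspanE yX|[_ /vlineP[k ->] [u /hU[uX' _] ->]]].
      exists (dot m y *: x); first by rewrite memvZ ?memv_line.
      exists (y - dot m y *: x); last by rewrite addrC subrK.
      apply/hU; split; last by rewrite dotBr dotZr mx mulr1 subrr.
      by apply: inspanD => //; rewrite -scaleNr; apply: inspanZ.
    by apply/inspanE/inspanD => //; apply: inspanZ.
  have x0 : x != 0 by apply: contra_eq_neq mx => ->; rewrite dot0r eq_sym oner_eq0.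
  rewrite dimv_disjoint_sum ?dim_vline ?x0 //.
  apply/eqP; rewrite -subv0; apply/subvP => w.
  rewrite memv_cap => /andP[/vlineP[k ->]] /hU[_].
  by rewrite dotZr mx mulr1 => ->; rewrite scale0r mem0v.
split=> [[x [U [<- hU]]]|dX].
  have hx y : inspan X y /\ dot m y = 1 <-> y - x \in U.
    by rewrite -(aff_hull_hull y uX m1) hU.
  have [xX mx] : inspan X x /\ dot m x = 1 by apply/hx; rewrite subrr mem0v.
  apply: (key x U xX mx) => u; split=> [uU|[uX' mu]].
    have [] : inspan X (x + u) /\ dot m (x + u) = 1 by apply/hx; rewrite addrC addKr.
    move=> h; rewrite dotDr mx => e; split; last by lra.
    have -> : u = (x + u) + (-1) *: x by rewrite scaleN1r addrC addKr.
    by apply: inspanD => //; apply: inspanZ.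
  have -> : u = x + u - x by rewrite addrC addKr.
  by apply/hx; split; [exact: inspanD|rewrite dotDr mx mu addr0].
have [v vX] : exists v, v \in X.
  case: (X) dX => [|v X' _]; first by rewrite span_nil dimv0.
  by exists v; rewrite mem_head.
have mE y : (y *m m^T == 0) = (dot m y == 0).
  have -> : y *m m^T = (dot m y)%:M.
    apply/matrixP => i j; rewrite !ord1 !mxE eqxx; apply: eq_bigr => k _.
    by rewrite mxE mulrC.
  apply/eqP/eqP => [/matrixP/(_ 0 0)|->]; first by rewrite !mxE eqxx.
  by apply/matrixP => i j; rewrite !mxE mul0rn.
pose U := (<<X>> :&: lker (linfun (mulmxr m^T)))%VS.
have hU u : u \in U <-> inspan X u /\ dot m u = 0.
  rewrite /U memv_cap memv_ker lfunE /= mE.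
  split=> [/andP[uX' /eqP mu]|[uX' mu]]; first by split=> //; exact/inspanE.
  by rewrite mu eqxx andbT; apply/inspanE.
exists v, U; split.
  by have := key v U (inspan_mem uX vX) (m1 v vX) hU; rewrite dX => -[].
apply/seteqP; split=> y /= => [/(aff_hull_hull _ uX m1)[yX my]|/hU[yX my]].
  apply/hU; split; last by rewrite dotBr my m1 // subrr.
  by apply: inspanD => //; rewrite -scaleN1r; apply: inspanZ; apply: inspan_mem.
apply/(aff_hull_hull _ uX m1); split.
  by rewrite -[y](subrK v); apply: inspanD => //; exact: inspan_mem.
by move: my; rewrite dotBr (m1 v) // => /eqP; rewrite subr_eq0 => /eqP.
Qed.

Definition codim1 X u := [/\ u != 0, orth X u & forall y, orth X y -> exists k, y = k *: u].

Lemma codim1P X : (0 < n)%N -> uniq X ->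
  \dim <<X>> = (n - 1)%N <-> exists u, codim1 X u.
Proof.
move=> n0 uX; split=> [dX|[u [u0 ou hu]]].
  have [|u [u0 ou]] := @not_spans _ _ X; first by move=> /(spansE uX); lia.
  exists u; split=> // y oy.
  have uX' : uniq (u :: X).
    by rewrite /= uX andbT; apply: contra (orth_notin u0 ou); exact: memv_span.
  have : spans (u :: X).
    by apply/(spansE uX'); rewrite dim_cons ?orth_notin // dX; lia.
  move=> /(_ (y - (dot y u / dot u u) *: u)); rewrite /orth => h.
  exists (dot y u / dot u u); apply/eqP; rewrite -subr_eq0; apply/eqP; apply: h.
  move=> v; rewrite inE => /orP[/eqP ->|vX].
    by rewrite dotBl dotZl divfK ?subrr // dot_eq0.
  by rewrite dotBl dotZl (oy v vX) (ou v vX) mulr0 subrr.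
have uX' : uniq (u :: X).
  by rewrite /= uX andbT; apply: contra (orth_notin u0 ou); exact: memv_span.
suff /(spansE uX') : spans (u :: X) by rewrite dim_cons ?orth_notin //; lia.
move=> y oy; have [|k yk] := hu y; first by move=> v vX; apply: oy; rewrite inE vX orbT.
have /eqP := oy u (mem_head _ _); rewrite yk dotZl mulf_eq0 dot_eq0 (negPf u0) orbF => /eqP ->.
by rewrite scale0r.
Qed.

Definition codim2 X p q := [/\ [/\ dot p p = 1, dot q q = 1 & dot p q = 0],
  orth X p, orth X q & forall y, orth X y -> y = dot p y *: p + dot q y *: q].

Lemma normalize w : w != 0 -> exists k, k != 0 /\ dot (k *: w) (k *: w) = 1.
Proof.
rewrite -dot_gt0 => w0; exists (Num.sqrt (dot w w))^-1; split.
  by rewrite invr_eq0 gt_eqF ?sqrtr_gt0.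
rewrite dotZl dotZr mulrA -expr2 exprVn sqr_sqrtr ?mulVf ?gt_eqF //; exact: ltW.
Qed.

Lemma codim2_exists X : uniq X -> (\dim <<X>>).+2 = n -> exists p q, codim2 X p q.
Proof.
move=> uX dX.
have [|u [u0 ou]] := @not_spans _ _ X; first by move=> /(spansE uX); lia.
have [k [k0 pp]] := normalize u0; set p := k *: u in pp.
have op : orth X p by move=> v vX; rewrite dotZl ou ?mulr0.
have p0 : p != 0 by rewrite scaler_eq0 negb_or k0.
have uX' : uniq (p :: X).
  by rewrite /= uX andbT; apply: contra (orth_notin p0 op); exact: memv_span.
have [w [w0 ow hw]] : exists w, codim1 (p :: X) w.
  by apply/codim1P => //; [lia|rewrite dim_cons ?orth_notin //; lia].
have [l [l0 qq]] := normalize w0; set q := l *: w in qq.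
have pq : dot p q = 0 by rewrite dotC dotZl ow ?mulr0 // mem_head.
have oq : orth X q by move=> v vX; rewrite dotZl ow ?mulr0 // inE vX orbT.
exists p, q; split=> // y oy.
have [|r hr] := hw (y - dot p y *: p).
  move=> v; rewrite inE => /orP[/eqP ->|vX]; rewrite dotBl dotZl.
    by rewrite pp mulr1 dotC subrr.
  by rewrite (oy v vX) (op v vX) mulr0 subrr.
have yE : y = dot p y *: p + (r / l) *: q.
  by rewrite /q scalerA divfK // -hr addrC subrK.
have -> : dot q y = r / l.
  by rewrite yE dotDr (dotZr (dot p y)) (dotZr (r / l)) qq (dotC q p) pq mulr0 add0r mulr1.
exact: yE.
Qed.

End Hull.

(** * Complete fans *)

Section FamDefs.
Context {R : realType} {n : nat}.
Implicit Types (x y u v w m a l : 'rV[R]_n) (X Y Z : seq 'rV[R]_n).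

(** The last two clauses make the contact face to face: both lists have the same vectors on the
    hyperplane of [l], namely their common ones. *)
Definition sep X Z := exists l, [/\ forall v, v \in X -> 0 <= dot l v,
  forall v, v \in Z -> dot l v <= 0, forall v, v \in X -> dot l v = 0 -> v \in Z
  & forall v, v \in Z -> dot l v = 0 -> v \in X].

Lemma sep_sym X Z : sep X Z -> sep Z X.
Proof.
move=> [l [lX lZ XZ ZX]]; exists (- l); split.
- by move=> v vZ; rewrite dotNl oppr_ge0 lZ.
- by move=> v vX; rewrite dotNl oppr_le0 lX.
- by move=> v vZ; rewrite dotNl => /eqP; rewrite oppr_eq0 => /eqP; exact: ZX.
- by move=> v vX; rewrite dotNl => /eqP; rewrite oppr_eq0 => /eqP; exact: XZ.
Qed.

Definition face X Y := exists a, (forall v, v \in X -> dot a v <= 0) /\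
  Y = [seq v <- X | dot a v == 0].

(** The span of [Y] has codimension at most 1; [u] may be 0. *)
Definition on_line Y := exists u, forall y, orth Y y -> exists k, y = k *: u.

(* The cones over the members of Fam form a complete fan. *)
Record fan (V : seq 'rV[R]_n) (Fam : seq (seq 'rV[R]_n)) : Prop := IsFan {
  fan_uniq : uniq V;
  fan_sub : forall X, X \in Fam -> X = [seq v <- V | v \in X];
  fan_plane : forall X, X \in Fam -> exists m, forall v, v \in X -> dot m v = 1;
  fan_spans : forall X, X \in Fam -> spans X;
  fan_cover : forall x, exists2 X, X \in Fam & incone X x;
  fan_sep : forall X Z, X \in Fam -> Z \in Fam -> X <> Z -> sep X Z;
  fan_noncoplanar : forall X Z m, X \in Fam -> Z \in Fam -> X <> Z ->
    (forall v, v \in X -> dot m v = 1) -> (forall v, v \in Z -> dot m v = 1) ->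
    ~ on_line [seq v <- X | v \in Z]
}.

Definition fan_facets (Fam : seq (seq 'rV[R]_n)) : set (set 'rV[R]_n) :=
  [set hull X | X in [set` Fam]].

End FamDefs.

Section Fan.
Context {R : realType} {n : nat} (V : seq 'rV[R]_n) (Fam : seq (seq 'rV[R]_n)).
Hypothesis fanF : fan V Fam.
Hypothesis n3 : (3 <= n)%N.
Implicit Types (x y u v w m a l p q : 'rV[R]_n) (X Y Z : seq 'rV[R]_n).
Let P := fan_facets Fam.

Lemma fan_uniqX X : X \in Fam -> uniq X.
Proof. by move=> /(fan_sub fanF) ->; rewrite filter_uniq // (fan_uniq fanF). Qed.

Lemma face_sub X Y : face X Y -> {subset Y <= X}.
Proof. by move=> [a [_ ->]] v; rewrite mem_filter => /andP[]. Qed.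

Lemma face_uniq X Y : X \in Fam -> face X Y -> uniq Y.
Proof. by move=> XF [a [_ ->]]; rewrite filter_uniq // fan_uniqX. Qed.

(** If the functional supplied by [fan_sep] is 0, its contact clauses put every vector of either
    list into the other. *)
Lemma fan_eq X Z : X \in Fam -> Z \in Fam ->
  (forall l, (forall v, v \in X -> 0 <= dot l v) -> (forall v, v \in Z -> dot l v <= 0) ->
    l = 0) -> X = Z.
Proof.
move=> XF ZF h; apply: contrapT => XZ.
have [l [lX lZ XlZ ZlX]] := fan_sep fanF XF ZF XZ.
apply: XZ; have l0 := h l lX lZ.
rewrite (fan_sub fanF XF) (fan_sub fanF ZF); apply: eq_filter => v.
by apply/idP/idP => [/XlZ|/ZlX]; apply; rewrite l0 dot0l.
Qed.

(** A vector of one face lies in the hull of the other, so the functional separating the two members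
    vanishes on it and the contact clause puts it into the other member; there the functional of the
    face recognizes it. *)
Lemma face_eq X X' Y Y' : X \in Fam -> X' \in Fam -> face X Y -> face X' Y' ->
  hull Y = hull Y' -> Y = Y'.
Proof.
move=> XF XF' fY fY' hY.
have key Z Z' W W' : Z \in Fam -> Z' \in Fam -> face Z W -> face Z' W' ->
    hull W = hull W' -> {subset W <= W'}.
  move=> ZF ZF' fW fW' hW v vW.
  have uW := face_uniq ZF fW; have uW' := face_uniq ZF' fW'.
  have vh : hull W' v by rewrite -hW; exact: hull_mem.
  have vZ' : v \in Z'.
    have vZ := face_sub fW vW.
    have [<- //|ZZ'] := pselect (Z = Z').
    have [l [lZ lZ' h _]] := fan_sep fanF ZF ZF' ZZ'.
    apply: h => //; apply/eqP; rewrite eq_le lZ // andbT.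
    by apply: hull_le vh => // w /(face_sub fW'); exact: lZ'.
  have [a [a0 E]] := fW'; rewrite E mem_filter vZ' andbT; apply/eqP.
  by apply: hull_dot vh => // w; rewrite E mem_filter => /andP[/eqP].
have e : Y =i Y' by move=> v; apply/idP/idP;
  [exact: key XF XF' fY fY' hY v|exact: key XF' XF fY' fY (esym hY) v].
have sV Z W : Z \in Fam -> face Z W -> W = [seq v <- V | v \in W].
  move=> ZF fW; have [a [_ E]] := fW; rewrite {1}E {1}(fan_sub fanF ZF) filter_nested.
  apply: eq_filter => v; apply/andP/idP => [[av vZ]|vW].
    by rewrite E mem_filter av.
  by move: (vW); rewrite E mem_filter => /andP[].
by rewrite (sV _ _ XF fY) (sV _ _ XF' fY'); exact: eq_filter.
Qed.

Lemma face_refl X : face X X.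
Proof.
exists 0; split=> [v _|]; rewrite ?dot0l //.
by apply/esym/all_filterP/allP => v _; rewrite dot0l.
Qed.

Lemma fan_hull_inj X Z : X \in Fam -> Z \in Fam -> hull X = hull Z -> X = Z.
Proof. by move=> XF ZF; exact: face_eq (face_refl X) (face_refl Z). Qed.

(** The separating [l] is nonnegative on [Y] and nonpositive at the sum of [Y], hence vanishes on
    [Y]. On the common vectors of [X] and [Z] the functional [a] of [Y] decides; elsewhere on [Z]
    the multiple [d] is too small for [a] to outweigh [l]. *)
Lemma face_containing X Y Z : X \in Fam -> Z \in Fam -> face X Y ->
  incone Z (\sum_(v <- Y) v) -> face Z Y.
Proof.
move=> XF ZF fY cZ.
have [<- //|XZ] := pselect (X = Z).
have [l [lX lZ XlZ ZlX]] := fan_sep fanF XF ZF XZ.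
have lY : orth Y l.
  apply: sum_orth; first by move=> v /(face_sub fY)/lX.
  apply/eqP; rewrite eq_le (incone_le0 lZ cZ) /= dot_sumr big_seq.
  by apply: sumr_ge0 => v /(face_sub fY)/lX.
have [a [a0 E]] := fY.
have [|d d0 hd] := @small_pos R _ Z
    (fun v => if dot l v == 0 then 1 else - dot l v / (`|dot a v| + 1)).
  move=> v vZ; case: ifP => // lv; apply: divr_gt0; last by rewrite ltr_wpDl.
  by rewrite oppr_gt0 lt_neqAle lv lZ.
have neg v : v \in Z -> dot l v != 0 -> dot (l + d *: a) v < 0.
  move=> vZ lv; have := hd v vZ; rewrite (negPf lv) ler_pdivlMr ?ltr_wpDl //.
  rewrite dotDl dotZl => h.
  have : d * dot a v <= d * `|dot a v| by rewrite ler_pM2l // ler_norm.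
  nra.
exists (l + d *: a); split.
  move=> v vZ; case: (eqVneq (dot l v) 0) => [lv|/(neg v vZ)/ltW //].
  by rewrite dotDl lv add0r dotZl pmulr_rle0 // a0 // ZlX.
rewrite E {1}(fan_sub fanF XF) {1}(fan_sub fanF ZF) !filter_nested.
apply: eq_filter => v; apply/andP/andP => -[av vX].
  have vY : v \in Y by rewrite E mem_filter av.
  have vZ : v \in Z by apply: XlZ => //; exact: lY.
  by split=> //; rewrite dotDl lY // add0r dotZl (eqP av) mulr0.
case: (eqVneq (dot l v) 0) => [lv|/(neg v vX)]; last by rewrite (eqP av) ltxx.
split; last exact: ZlX.
by move: av; rewrite dotDl lv add0r dotZl mulf_eq0 gt_eqF.
Qed.

Lemma face_containing_sub X Y Z : X \in Fam -> Z \in Fam -> face X Y ->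
  {subset Y <= Z} -> face Z Y.
Proof.
move=> XF ZF fY YZ; apply: (face_containing XF ZF fY).
by apply: (incone_sub (fan_uniqX ZF) YZ); exact: incone_sumX.
Qed.

Lemma is_face_fan X E : X \in Fam -> is_face (hull X) E <-> exists Y, face X Y /\ E = hull Y.
Proof.
move=> XF; have [m m1] := fan_plane fanF XF.
rewrite (is_faceP _ (fan_uniqX XF) m1); split=> [[a [a0 ->]]|[Y [[a [a0 ->]] ->]]].
  by exists [seq v <- X | dot a v == 0]; split=> //; exists a.
by exists a.
Qed.

Lemma is_face_face X Y Z : X \in Fam -> Z \in Fam -> face X Y ->
  is_face (hull Z) (hull Y) <-> face Z Y.
Proof.
move=> XF ZF fY; rewrite (is_face_fan _ ZF); split=> [[Y' [fY' e]]|]; last by exists Y.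
by rewrite (face_eq XF ZF fY fY' e).
Qed.

Lemma face_plane X Y : X \in Fam -> face X Y ->
  exists m, forall v, v \in Y -> dot m v = 1.
Proof.
by move=> XF fY; have [m m1] := fan_plane fanF XF; exists m => v /(face_sub fY)/m1.
Qed.

Lemma has_dim_face X Y d : X \in Fam -> face X Y ->
  has_dim (hull Y) d <-> \dim <<Y>> = d.+1.
Proof.
move=> XF fY; have [m m1] := face_plane XF fY.
exact: (has_dim_hull d (face_uniq XF fY) m1).
Qed.

Lemma poly_faceP d E : poly_face P d E <-> exists X Y,
  [/\ X \in Fam, face X Y, E = hull Y & \dim <<Y>> = d.+1].
Proof.
split=> [[hd [F [X XF <-]]] /(is_face_fan _ XF)[Y [fY EY]]|[X [Y [XF fY -> dY]]]].
  by exists X, Y; split=> //; apply/(has_dim_face d XF fY); rewrite -EY.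
split; first exact/(has_dim_face d XF fY).
by exists (hull X); [exists X|apply/(is_face_fan _ XF); exists Y].
Qed.

Lemma ridge_codim1 X Y : X \in Fam -> face X Y ->
  is_ridge P (hull Y) <-> exists u, codim1 Y u.
Proof.
move=> XF fY; rewrite -codim1P ?(face_uniq XF fY) //; last lia.
rewrite /is_ridge poly_faceP; split=> [[X' [Y' [XF' fY' e dY]]]|dY].
  by rewrite (face_eq XF XF' fY fY' e) dY; lia.
by exists X, Y; split=> //; rewrite dY; lia.
Qed.

(** The member entered when leaving [p] in direction [u]: one cone contains such points arbitrarily
    close to [p], hence also [p]. *)
Lemma local_cover p u : exists2 X, X \in Fam &
  freq (fun e => incone X (p + e *: u)) /\ incone X p.
Proof.
have : freq (fun e => exists2 X, X \in Fam & incone X (p + e *: u)).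
  by apply: freq_mono freq_all => e _ _; exact: fan_cover fanF _.
move=> /freq_pigeonhole[X XF hX]; exists X => //; split=> //.
exact: incone_lim (fan_uniqX XF) hX.
Qed.

Lemma codim1N Y u : codim1 Y u -> codim1 Y (- u).
Proof.
move=> [u0 ou hu]; split; rewrite ?oppr_eq0 //.
  by move=> v vY; rewrite dotNl ou // oppr0.
by move=> y /hu[k ->]; exists (- k); rewrite scaleNr scalerN opprK.
Qed.

(** The functional of the face [Y] is a multiple of the ridge normal [u]; the multiple is not 0,
    because [Z] spans and [Y] does not. *)
Lemma facet_side Z Y u : Z \in Fam -> face Z Y -> codim1 Y u ->
  (forall v, v \in Z -> 0 <= dot u v) \/ (forall v, v \in Z -> dot u v <= 0).
Proof.
move=> ZF [a [a0 E]] [u0 ou hu].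
have [|k ak] := hu a; first by move=> v; rewrite E mem_filter => /andP[/eqP].
case: (ltgtP k 0) => k0.
- by left=> v vZ; have := a0 v vZ; rewrite ak dotZl nmulr_rle0.
- by right=> v vZ; have := a0 v vZ; rewrite ak dotZl pmulr_rle0.
- have YZ : Y = Z.
    by rewrite E; apply/all_filterP/allP => v _; rewrite ak k0 scale0r dot0l.
  by case/eqP: u0; apply: (fan_spans fanF ZF); rewrite -YZ.
Qed.

Lemma facet_side_gt Z u : Z \in Fam -> u != 0 -> (forall v, v \in Z -> 0 <= dot u v) ->
  exists2 v, v \in Z & 0 < dot u v.
Proof.
move=> ZF u0 h; apply/hasP; apply/negP => /negP/hasPn h'.
case/eqP: u0; apply: (fan_spans fanF ZF) => v vZ.
by apply/eqP; rewrite eq_le h // andbT leNgt; exact: h'.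
Qed.

Lemma facet_side_uniq Z Z' Y u : Z \in Fam -> Z' \in Fam -> face Z Y -> face Z' Y ->
  codim1 Y u -> (forall v, v \in Z -> 0 <= dot u v) ->
  (forall v, v \in Z' -> 0 <= dot u v) -> Z = Z'.
Proof.
move=> ZF ZF' fY fY' [u0 ou hu] uZ uZ'; apply: fan_eq => // l lZ lZ'.
have [|k lk] := hu l.
  by move=> v vY; apply/eqP; rewrite eq_le lZ ?(face_sub fY) // lZ' ?(face_sub fY').
have [v vZ uv] := facet_side_gt ZF u0 uZ.
have [v' vZ' uv'] := facet_side_gt ZF' u0 uZ'.
have := lZ v vZ; have := lZ' v' vZ'.
rewrite lk !dotZl pmulr_lle0 // pmulr_lge0 // => k1 k2.
have -> : k = 0 by lra.
exact: scale0r.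
Qed.

(** Leaving the sum of [Y], an interior point of the ridge cone, in direction [u] enters a member
    that has [Y] as a face and cannot lie on the negative side. *)
Lemma facet_side_exists X Y u : X \in Fam -> face X Y -> codim1 Y u ->
  exists Z, [/\ Z \in Fam, face Z Y & forall v, v \in Z -> 0 <= dot u v].
Proof.
move=> XF fY cu; have [Z ZF [hZ cZ]] := local_cover (\sum_(v <- Y) v) u.
have fZ := face_containing XF ZF fY cZ.
exists Z; split=> //; case: (facet_side ZF fZ cu) => // uZ.
have [u0 ou _] := cu; have [e [e0 _ /(incone_le0 uZ)]] := hZ 1 ltr01.
rewrite dotDr dotZr dot_sumr big_seq big1 => [|v /ou //].
by rewrite add0r pmulr_rle0 // leNgt dot_gt0 u0.
Qed.

Lemma fan_facetE F : P F <-> exists2 X, X \in Fam & F = hull X.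
Proof. by split=> [[X XF <-]|[X XF ->]]; exists X. Qed.

Lemma fan_ridge G : is_ridge P G ->
  exists F1 F2, F1 <> F2 /\ facets_containing P G = [set F1; F2].
Proof.
move=> rG; have /poly_faceP[X [Y [XF fY EG _]]] := rG; rewrite EG in rG *.
have /(ridge_codim1 XF fY)[u cu] := rG.
have [Z1 [ZF1 f1 s1]] := facet_side_exists XF fY cu.
have [Z2 [ZF2 f2 s2]] := facet_side_exists XF fY (codim1N cu).
have Z12 : hull Z1 <> hull Z2.
  move=> e.
  have E := fan_hull_inj ZF1 ZF2 e.
  have [u0 _ _] := cu; case/eqP: u0; apply: (fan_spans fanF ZF1) => v vZ.
  apply/eqP; rewrite eq_le s1 // andbT -oppr_ge0 -dotNl s2 // -E //.
exists (hull Z1), (hull Z2); split=> //; apply/seteqP; split=> F /=.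
  move=> [[Z ZF <-]] /(is_face_face XF ZF fY) fZ.
  case: (facet_side ZF fZ cu) => sZ; [left|right].
    by rewrite (facet_side_uniq ZF ZF1 fZ f1 cu).
  rewrite (facet_side_uniq ZF ZF2 fZ f2 (codim1N cu)) // => v vZ.
  by rewrite dotNl oppr_ge0 sZ.
case=> ->.
  by split; [exists Z1|apply/(is_face_face XF ZF1 fY)].
by split; [exists Z2|apply/(is_face_face XF ZF2 fY)].
Qed.

Lemma share_ridgeI X Z Y u : X \in Fam -> Z \in Fam -> face X Y -> face Z Y ->
  codim1 Y u -> share_ridge P (hull X) (hull Z).
Proof.
move=> XF ZF fX fZ cu; exists (hull Y); split.
- by apply/(ridge_codim1 XF fX); exists u.
- exact/(is_face_face XF XF fX).
- exact/(is_face_face XF ZF fX).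
Qed.

(** The normals of [Y] form a space of dimension at least 2, which meets every hyperplane: some
    hyperplane contains both [Y] and [x]. The segments of [fan_connected] issue from such an [x]. *)
Lemma not_on_line Y x : ~ on_line Y -> exists w, [/\ w != 0, orth Y w & dot w x = 0].
Proof.
move=> h.
have [w1 [w10 ow1]] : exists w, w != 0 /\ orth Y w.
  by apply: not_spans => sY; apply: h; exists 0 => y /sY ->; exists 0; rewrite scaler0.
have [w2 [ow2 nw2]] : exists w, orth Y w /\ ~ exists k, w = k *: w1.
  apply: contrapT => /forallNP h'; apply: h; exists w1 => y oy.
  by apply: contrapT => h2; apply: (h' y).
case: (eqVneq (dot w1 x) 0) => [w1x|w1x]; first by exists w1.
exists (w2 - (dot w2 x / dot w1 x) *: w1); split.
- apply/eqP => /eqP; rewrite subr_eq0 => /eqP e; apply: nw2.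
  by exists (dot w2 x / dot w1 x).
- by move=> v vY; rewrite dotBl dotZl (ow2 v vY) (ow1 v vY) mulr0 subrr.
- by rewrite dotBl dotZl divfK // subrr.
Qed.

Lemma interior_fan X Z (c : 'rV[R]_n -> R) : X \in Fam -> Z \in Fam ->
  (forall v, 0 < c v) -> incone Z (\sum_(v <- X) c v *: v) -> X = Z.
Proof.
move=> XF ZF c0 cZ; apply: fan_eq => // l lX lZ; apply: (fan_spans fanF XF) => v vX.
apply: (incone_eq0 (c := c) lX) => //; first by move=> w; exact: ltW.
apply/eqP; rewrite eq_le (incone_le0 lZ cZ) /=.
by apply: (incone_ge0 lX); exists c; split=> // w; exact: ltW.
Qed.

(** The endpoint [y] avoids, for each sublist of codimension at least 2, a hyperplane through that
    sublist and [x]; so the segment avoids these spans at all positive times. A supremum argument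
    follows the connected members along it. *)
Lemma fan_connected F F' : P F -> P F' ->
  exists (m : nat) (C : nat -> set 'rV[R]_n),
    [/\ C 0%N = F, C m = F', forall i, (i <= m)%N -> P (C i)
      & forall i, (i < m)%N -> share_ridge P (C i) (C i.+1)].
Proof.
move=> [X0 XF0 <-] [X1 XF1 <-].
pose conn X := exists (m : nat) (C : nat -> set 'rV[R]_n),
    [/\ C 0%N = hull X0, C m = hull X, forall i, (i <= m)%N -> P (C i)
      & forall i, (i < m)%N -> share_ridge P (C i) (C i.+1)].
have conn0 : conn X0.
  by exists 0%N, (fun=> hull X0); split=> // i _; apply/fan_facetE; exists X0.
have connS X Z : conn X -> Z \in Fam -> share_ridge P (hull X) (hull Z) -> conn Z.
  move=> [m [C [C0 Cm CP CS]]] ZF s.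
  exists m.+1, (fun i => if (i <= m)%N then C i else hull Z); split=> //.
  - by rewrite ltnn.
  - by move=> i _; case: leqP => [/CP //|_]; apply/fan_facetE; exists Z.
  - move=> i; rewrite ltnS leq_eqVlt => /orP[/eqP ->|im].
      by rewrite eqxx ltnn Cm.
    by rewrite im orbT; exact: CS.
suff : conn X1 by [].
set x := \sum_(v <- X0) 1 *: v.
have /choice[W hW] : forall B, exists w, ~ on_line B -> [/\ w != 0, orth B w & dot w x = 0].
  move=> B; have [h|/(not_on_line x)[w hw]] := pselect (on_line B); first by exists 0.
  by exists w.
pose Bs := [seq B <- subs V | ~~ `[< on_line B >]].
have hB B : B \in Bs -> [/\ W B != 0, orth B (W B) & dot (W B) x = 0].
  by rewrite mem_filter => /andP[/asboolPn/hW].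
have [|c [c0 hc]] := @generic_point _ _ X1 (map W Bs) (fan_uniqX XF1) (fan_spans fanF XF1).
  by move=> w /mapP[B /hB[? _ _] ->].
set y := \sum_(v <- X1) c v *: v in hc.
pose z t := x + t *: (y - x).
have zW B t : B \in Bs -> 0 < t -> dot (W B) (z t) != 0.
  move=> BB t0; have [_ _ wx] := hB B BB.
  rewrite /z dotDr dotZr dotBr wx add0r subr0.
  by apply: mulf_neq0; [rewrite gt_eqF|apply: hc; exact: map_f].
pose A := [set t | 0 <= t <= 1 /\ exists2 X, X \in Fam & conn X /\ incone X (z t)].
have A0 : A 0.
  split; first by rewrite lexx ler01.
  exists X0 => //; split=> //; rewrite /z scale0r addr0; exists (fun=> 1); split=> //.
have supA : has_sup A by split; [exists 0|exists 1 => t [/andP[]]].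
set s := sup A.
have s01 : 0 <= s <= 1.
  apply/andP; split; first by apply: ub_le_sup => //; exact: supA.2.
  by apply: ge_sup; [exists 0|move=> t [/andP[]]].
(* The supremum is attained: one connected member serves for times arbitrarily close below [s], and
   its cone is closed. *)
have As : A s.
  have [//|nAs] := pselect (A s).
  have : freq (fun e => exists2 X, X \in Fam & conn X /\ incone X (z s + e *: - (y - x))).
    move=> d d0; have [t At st] := sup_adherent d0 supA.
    have ts : t <= s by apply: ub_le_sup => //; exact: supA.2.
    have ts' : t < s by rewrite lt_neqAle ts andbT; apply/eqP => e; apply: nAs; rewrite -e.
    exists (s - t); split; [lra|rewrite /s in st *; lra|].
    have [_ [X XF [cX iX]]] := At; exists X => //; split=> //.
    suff -> : z s + (s - t) *: - (y - x) = z t by [].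
    by rewrite scalerN -scaleNr opprB /z -addrA -scalerDl; congr (_ + _ *: _); ring.
  move=> /freq_pigeonhole[X XF hX]; split=> //; exists X => //; split.
    by have [e [_ _ []]] := hX 1 ltr01.
  apply: (@incone_lim _ _ X (z s) (- (y - x))); first exact: fan_uniqX.
  by apply: freq_mono hX => e _ [].
have [_ [X XF [cX iX]]] := As.
case/andP: s01 => s0; rewrite le_eqVlt => /orP[/eqP s1|s1].
  rewrite (interior_fan XF1 XF c0) //.
  by move: iX; rewrite /z s1 scale1r addrC subrK.
(* [Z] is entered just after time [s], so by the choice of [s] it cannot already be connected;
   crossing from [X] to [Z] will contradict this. *)
have [Z ZF [hZ iZ]] := local_cover (z s) (y - x).
have nZ : ~ conn Z.
  move=> cZ; have [|e [e0 e1 iZe]] := hZ (1 - s); first lra.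
  suff /(ub_le_sup supA.2) : A (s + e) by rewrite -/s; lra.
  split; first by apply/andP; split; lra.
  by exists Z => //; split=> //; rewrite /z scalerDl addrA.
have XZ : X <> Z by move=> e; apply: nZ; rewrite -e.
move: s0; rewrite le_eqVlt => /orP[/eqP s0|s0].
  case: nZ; rewrite -(interior_fan XF0 ZF (c := fun=> 1)) //.
  by move: iZ; rewrite /z -s0 scale0r addr0.
case: nZ; have [l [lX lZ XlZ ZlX]] := fan_sep fanF XF ZF XZ.
pose B := [seq v <- X | dot l v == 0].
have fX : face X B.
  exists (- l); split; first by move=> v vX; rewrite dotNl oppr_le0 lX.
  by apply: eq_filter => v; rewrite dotNl oppr_eq0.
have fZ : face Z B.
  apply: (face_containing_sub XF ZF fX) => v; rewrite mem_filter => /andP[/eqP lv vX].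
  exact: XlZ.
have lB : orth B l by move=> v; rewrite mem_filter => /andP[/eqP].
have sB : inspan B (z s).
  have [d [d0 e]] := iX; have lz : dot l (\sum_(v <- X) d v *: v) = 0.
    by apply/eqP; rewrite eq_le -e (incone_ge0 lX iX) (incone_le0 lZ iZ).
  exists d; rewrite e /B big_filter [RHS]big_mkcond; apply: eq_big_seq => v vX.
  case: eqP => // lv; case: (eqVneq (d v) 0) => [->|dv]; first by rewrite scale0r.
  by case: lv; apply: (incone_eq0 lX d0 lz vX); rewrite lt_def dv d0.
(* [z s] lies in the span of the common face [B], which genericity forbids if that span has
   codimension at least 2; so [B] is a ridge. *)
have lineB : on_line B.
  apply: contrapT => nB.
  have BB : B \in Bs.
    rewrite mem_filter; apply/andP; split; first exact/asboolPn.
    by rewrite /B (fan_sub fanF XF) filter_nested filter_subs.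
  have [_ oW _] := hB B BB.
  by have := zW B s BB s0; rewrite (orth_inspan oW sB) eqxx.
have l0 : l != 0.
  apply/eqP => l0; apply: XZ; apply: fan_eq => // l' lX' lZ'.
  apply: (fan_spans fanF XF) => v vX; apply/eqP; rewrite eq_le lX' // andbT.
  by apply: lZ'; apply: XlZ => //; rewrite l0 dot0l.
apply: (connS X) => //; apply: (share_ridgeI XF ZF fX fZ (u := l)); split=> //.
have [u hu] := lineB; have [k lk] := hu l lB.
have k0 : k != 0 by apply: contraNneq l0 => k0; rewrite lk k0 scale0r.
move=> b /hu[k' ->]; exists (k' / k); by rewrite lk scalerA divfK.
Qed.

Lemma fan_facet F : P F -> convex_polytope F /\ has_dim F (n - 1).
Proof.
move=> [X XF <-]; split; first by exists [set` X]; split=> //; exact: finite_seq.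
have [m m1] := fan_plane fanF XF; have uX := fan_uniqX XF.
apply/(has_dim_hull _ uX m1); have /(spansE uX) -> := fan_spans fanF XF; lia.
Qed.

Lemma fan_center F : P F -> ~ aff_hull F 0.
Proof.
move=> [X XF <-]; have [m m1] := fan_plane fanF XF.
move=> /(aff_hull_hull _ (fan_uniqX XF) m1)[_].
by rewrite dot0r => /eqP; rewrite eq_sym oner_eq0.
Qed.

Lemma fan_noncoplanar_facets F F' : P F -> P F' -> F <> F' -> share_ridge P F F' ->
  aff_hull F <> aff_hull F'.
Proof.
move=> [X XF <-] [Z ZF <-] FF [G [rG fX fZ]] aff.
have XZ : X <> Z by move=> e; apply: FF; rewrite e.
have [m m1] := fan_plane fanF XF; have [m' m1'] := fan_plane fanF ZF.
apply: (fan_noncoplanar fanF XF ZF XZ m1).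
  move=> v vZ; have : aff_hull (hull Z) v.
    apply/(aff_hull_hull _ (fan_uniqX ZF) m1'); split; last exact: m1'.
    by apply: inspan_mem => //; exact: fan_uniqX.
  by rewrite -aff => /(aff_hull_hull _ (fan_uniqX XF) m1)[].
move: fX => /(is_face_fan _ XF)[Y [fY eG]].
have fY' : face Z Y by apply/(is_face_face XF ZF fY); rewrite -eG.
move: rG; rewrite eG => /(ridge_codim1 XF fY)[u [u0 ou hu]].
exists u => y oy; apply: hu => v vY; apply: oy.
by rewrite mem_filter (face_sub fY) // (face_sub fY').
Qed.

End Fan.

(** * Planar sectors *)

Section Trig.
Context {R : realType}.
Implicit Types (x y t a b w : R).

Lemma cos_sin_sq t : cos t * cos t + sin t * sin t = 1.
Proof. by rewrite -!expr2 cos2Dsin2. Qed.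

Lemma sin_eq0_pi t : - pi < t -> t < pi -> sin t = 0 -> t = 0.
Proof.
move=> t1 t2 s0; case: (ltgtP t 0) => // t0.
  have : 0 < sin (- t) by apply: sin_gt0_pi; apply/andP; split; lra.
  by rewrite sinN s0 oppr0 ltxx.
have : 0 < sin t by apply: sin_gt0_pi; apply/andP; split; lra.
by rewrite s0 ltxx.
Qed.

Lemma cos_eq1 t : - (2 * pi) < t -> t < 2 * pi -> cos t = 1 -> t = 0.
Proof.
move=> t1 t2 c1.
have : cos ((t / 2) *+ 2) = 1 by rewrite -mulr_natr divfK.
rewrite cos_mulr2n => c2; have := cos_sin_sq (t / 2) => cs.
have s0 : sin (t / 2) = 0.
  apply/eqP; rewrite -[_ == 0]orbb -mulf_eq0; apply/eqP; lra.
have := @sin_eq0_pi (t / 2); lra.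
Qed.

Lemma angle_eq a b : cos a = cos b -> sin a = sin b ->
  - (2 * pi) < a - b -> a - b < 2 * pi -> a = b.
Proof.
move=> ec es h1 h2; have := @cos_eq1 (a - b) h1 h2.
rewrite cosB ec es cos_sin_sq => /(_ erefl) h; lra.
Qed.

Lemma sin_lt0 t : pi < t -> t < 2 * pi -> sin t < 0.
Proof.
move=> t1 t2; have : 0 < sin (t - pi) by apply: sin_gt0_pi; apply/andP; split; lra.
by rewrite sinB cospi sinpi mulr0 subr0 mulrN1 oppr_gt0.
Qed.

Lemma polar x y a : x * x + y * y = 1 ->
  exists t, [/\ a <= t, t < a + 2 * pi, cos t = x & sin t = y].
Proof.
have base u v : u * u + v * v = 1 ->
    exists t, [/\ 0 <= t, t < 2 * pi, cos t = u & sin t = v].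
  move=> uv; have u1 : -1 <= u <= 1 by apply/andP; split; nra.
  have cu : cos (acos u) = u by apply: acosK; rewrite in_itv.
  have h0 := acos_ge0 u1; have h1 := acos_lepi u1; have hpi := @pi_gt0 R.
  have s0 : 0 <= sin (acos u) by apply: sin_ge0_pi; rewrite h0.
  have := cos_sin_sq (acos u); rewrite cu => s2.
  have [v0|v0] := leP 0 v.
    exists (acos u); split=> //; first lra.
    have : (sin (acos u) - v) * (sin (acos u) + v) = 0 by lra.
    by move/eqP; rewrite mulf_eq0 => /orP[/eqP|/eqP]; lra.
  have sv : sin (acos u) = - v.
    have : (sin (acos u) - v) * (sin (acos u) + v) = 0 by lra.
    by move/eqP; rewrite mulf_eq0 => /orP[/eqP|/eqP]; lra.
  have a0 : acos u != 0 by apply: contraTneq v0 => e; rewrite -leNgt; move: sv; rewrite e sin0; lra.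
  have {}a0 : 0 < acos u by rewrite lt_def a0.
  have e2 : 2 * pi = pi *+ 2 :> R by rewrite mulr_natl.
  exists (2 * pi - acos u); split; [lra|lra| |].
    by rewrite cosB e2 cos2pi sin2pi mul0r addr0 mul1r.
  by rewrite sinB e2 cos2pi sin2pi mul0r sub0r mul1r sv opprK.
move=> xy; have [|t [t0 t1 ct st]] := base (x * cos a + y * sin a) (y * cos a - x * sin a).
  by have := cos_sin_sq a; nra.
have cs := cos_sin_sq a.
exists (t + a); split; [lra|lra| |].
  by rewrite cosD ct st -[RHS]mulr1 -cs; ring.
by rewrite sinD ct st -[RHS]mulr1 -cs; ring.
Qed.

(** The polar angle [t] is taken in the turn starting at [a]. The coefficient [B] fixes the sign of
    [sin (t - a)], which gives [t <= a + pi]; then [A] fixes the sign of [sin (t - (a + w))], which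
    gives [t <= a + w]. *)
Lemma sector_cone a w x y (A B : R) : 0 < w -> w < pi -> 0 <= A -> 0 <= B ->
  x = A * cos a + B * cos (a + w) -> y = A * sin a + B * sin (a + w) ->
  exists r t, [/\ 0 <= r, a <= t <= a + w, x = r * cos t & y = r * sin t].
Proof.
move=> w0 wpi A0 B0 ex ey.
have ca := cos_sin_sq a; have sw : 0 < sin w by apply: sin_gt0_pi; rewrite w0.
set r := Num.sqrt (x * x + y * y).
have r2 : r * r = x * x + y * y by rewrite -expr2 sqr_sqrtr // addr_ge0 // -expr2 sqr_ge0.
have r0 : 0 <= r by exact: sqrtr_ge0.
case: (eqVneq r 0) => [rz|rnz].
  exists 0, a; rewrite !mul0r lexx lerDl (ltW w0); move: r2; rewrite rz => r2.
  by split=> //; nra.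
have rp : 0 < r by rewrite lt_def rnz.
have [|t [t1 t2 ct st]] := @polar (x / r) (y / r) a.
  by apply: (mulIf (mulf_neq0 rnz rnz)); rewrite mul1r {2}r2; field.
have xr : x = r * cos t by rewrite ct mulrC divfK.
have yr : y = r * sin t by rewrite st mulrC divfK.
have s1 : r * sin (t - a) = B * sin w.
  have -> : r * sin (t - a) = (r * sin t) * cos a - (r * cos t) * sin a.
    by rewrite sinB; ring.
  by rewrite -xr -yr ex ey cosD sinD -[B * sin w]mulr1 -ca; ring.
have s2 : r * sin (t - (a + w)) = - (A * sin w).
  have -> : r * sin (t - (a + w)) = (r * sin t) * cos (a + w) - (r * cos t) * sin (a + w).
    by rewrite sinB; ring.
  by rewrite -xr -yr ex ey cosD sinD -[A * sin w]mulr1 -ca; ring.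
have ta : t - a <= pi.
  rewrite leNgt; apply/negP => h; have : sin (t - a) < 0 by apply: sin_lt0; lra.
  by nra.
exists r, t; split=> //; rewrite t1 leNgt; apply/negP => h.
have : 0 < sin (t - (a + w)) by apply: sin_gt0_pi; apply/andP; split; lra.
by nra.
Qed.

End Trig.

(** * The cycle of facets at a peak *)

Section Peak.
Context {R : realType} {n : nat} (V : seq 'rV[R]_n) (Fam : seq (seq 'rV[R]_n)).
Hypothesis fanF : fan V Fam.
Hypothesis n3 : (3 <= n)%N.
Variables (X0 Y : seq 'rV[R]_n) (p q : 'rV[R]_n).
Hypothesis XF0 : X0 \in Fam.
Hypothesis fY0 : face X0 Y.
Hypothesis cY : codim2 Y p q.
Implicit Types (x y u v m l : 'rV[R]_n) (X Z : seq 'rV[R]_n) (a w t r : R).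
Let P := fan_facets Fam.

Let pp : dot p p = 1. Proof. by have [[]] := cY. Qed.
Let qq : dot q q = 1. Proof. by have [[]] := cY. Qed.
Let pq : dot p q = 0. Proof. by have [[]] := cY. Qed.
Let oYp : orth Y p. Proof. by have [] := cY. Qed.
Let oYq : orth Y q. Proof. by have [] := cY. Qed.
Let oYE y : orth Y y -> y = dot p y *: p + dot q y *: q.
Proof. by have [_ _ _] := cY; apply. Qed.
Let uY : uniq Y := face_uniq fanF XF0 fY0.

Definition en t := cos t *: p + sin t *: q.
(** [en t] turned by a right angle: its product with a vector at radius [r] and angle [s] is
    [r * sin (s - t)], so its sign tells on which side of the ray at [t] the vector lies. *)
Definition nu t := (- sin t) *: p + cos t *: q.

Let at_angle v r t := dot p v = r * cos t /\ dot q v = r * sin t.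

Let nuE t v : dot (nu t) v = cos t * dot q v - sin t * dot p v.
Proof. by rewrite /nu dotDl !dotZl mulNr addrC. Qed.

Let nu_angle v r s t : at_angle v r s -> dot (nu t) v = r * sin (s - t).
Proof. by move=> [e1 e2]; rewrite nuE e1 e2 sinB; ring. Qed.

Let oY_nu t : orth Y (nu t).
Proof. by move=> v vY; rewrite nuE oYp // oYq // !mulr0 subrr. Qed.

Let nu_neq0 t : nu t != 0.
Proof.
apply/eqP => e; have : dot (nu t) (nu t) = 1.
  rewrite {1}/nu dotDl !dotZl !(dotC _ (nu t)) !nuE pp qq pq (dotC q p) pq.
  by rewrite !mulr0 !mulr1 subr0 sub0r mulrNN addrC cos_sin_sq.
by rewrite e dot0l => /eqP; rewrite eq_sym oner_eq0.
Qed.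

(* The wedge of X at the peak is the sector between the angles a and a + w. *)
Definition sector X a w := [/\ 0 < w, w < pi,
  exists2 v, v \in X & exists2 r, 0 < r & at_angle v r a,
  exists2 v, v \in X & exists2 r, 0 < r & at_angle v r (a + w)
  & forall v, v \in X -> exists r t, [/\ 0 <= r, a <= t <= a + w & at_angle v r t]].

Lemma sector_shift X a b w : cos a = cos b -> sin a = sin b -> sector X a w -> sector X b w.
Proof.
move=> ec es; have key t : cos (t + (b - a)) = cos t /\ sin (t + (b - a)) = sin t.
  have c1 : cos (b - a) = 1 by rewrite cosB ec es cos_sin_sq.
  have s0 : sin (b - a) = 0 by rewrite sinB ec es; ring.
  by rewrite (cosD t) (sinD t) c1 s0; split; ring.
have kw : cos (b + w) = cos (a + w) /\ sin (b + w) = sin (a + w).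
  by have := key (a + w); have -> : a + w + (b - a) = b + w by ring.
move=> [w0 wpi [v vX [r r0 [e1 e2]]] [v' vX' [r' r'0 [e1' e2']]] h]; split=> //.
- by exists v => //; exists r => //; split; rewrite -?ec -?es.
- by exists v' => //; exists r' => //; split; rewrite ?kw.1 ?kw.2.
move=> x /h[s [t [s0 /andP[t1 t2] [f1 f2]]]]; exists s, (t + (b - a)); split=> //.
  by apply/andP; split; lra.
by rewrite /at_angle (key t).1 (key t).2.
Qed.

Lemma sector_nu_ge0 X a w v : sector X a w -> v \in X -> 0 <= dot (nu a) v.
Proof.
move=> [w0 wpi _ _ h] /h[r [t [r0 /andP[t1 t2] e]]]; rewrite (nu_angle _ e).
by apply: mulr_ge0 => //; apply: sin_ge0_pi; apply/andP; split; lra.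
Qed.

Lemma sector_nu_le0 X a w v : sector X a w -> v \in X -> dot (nu (a + w)) v <= 0.
Proof.
move=> [w0 wpi _ _ h] /h[r [t [r0 /andP[t1 t2] e]]]; rewrite (nu_angle _ e).
rewrite -[_ * _]opprK -mulrN -sinN oppr_le0.
by apply: mulr_ge0 => //; apply: sin_ge0_pi; apply/andP; split; lra.
Qed.

Let codim1_nu X t r v : {subset Y <= X} -> v \in X -> 0 < r -> at_angle v r t ->
  (forall v, v \in X -> dot (nu t) v = 0) -> codim1 X (nu t).
Proof.
move=> YX vX r0 [e1 e2] h; split=> // y oy.
have oYy : orth Y y by move=> z /YX/oy.
have := oy v vX; rewrite {1}(oYE oYy) dotDl !dotZl e1 e2 => e.
have {}e : dot p y * cos t + dot q y * sin t = 0.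
  apply: (mulfI (lt0r_neq0 r0)); rewrite mulr0 -[RHS]e; ring.
have cs := cos_sin_sq t.
exists (cos t * dot q y - sin t * dot p y).
rewrite {1}(oYE oYy) /nu scalerDr !scalerA; congr (_ *: _ + _ *: _).
  rewrite -[LHS]mulr1 -cs -[RHS]addr0 -(mulr0 (cos t)) -e; ring.
rewrite -[LHS]mulr1 -cs -[RHS]addr0 -(mulr0 (sin t)) -e; ring.
Qed.

(** For a sector of start [a] and width [w], the values [a] and [a + w] of [t] give the two ridges
    of [X] through the peak. *)
Definition low_ridge X t := [seq v <- X | dot (nu t) v == 0].

Let sub_low X t : {subset Y <= X} -> {subset Y <= low_ridge X t}.
Proof. by move=> YX v vY; rewrite mem_filter oY_nu // eqxx YX. Qed.

Lemma ridge_start X a w : {subset Y <= X} -> sector X a w ->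
  face X (low_ridge X a) /\ codim1 (low_ridge X a) (nu a).
Proof.
move=> YX s; split.
  exists (- nu a); split; first by move=> v vX; rewrite dotNl oppr_le0 (sector_nu_ge0 s).
  by apply: eq_filter => v; rewrite dotNl oppr_eq0.
have [_ _ [v vX [r r0 e]] _ _] := s.
apply: (codim1_nu (sub_low _ YX) _ r0 e) => [|x]; last by rewrite mem_filter => /andP[/eqP].
by rewrite mem_filter vX andbT (nu_angle _ e) subrr sin0 mulr0.
Qed.

Lemma ridge_end X a w : {subset Y <= X} -> sector X a w ->
  face X (low_ridge X (a + w)) /\ codim1 (low_ridge X (a + w)) (nu (a + w)).
Proof.
move=> YX s; split.
  by exists (nu (a + w)); split=> // v vX; rewrite (sector_nu_le0 s).
have [_ _ _ [v vX [r r0 e]] _] := s.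
apply: (codim1_nu (sub_low _ YX) _ r0 e) => [|x]; last by rewrite mem_filter => /andP[/eqP].
by rewrite mem_filter vX andbT (nu_angle _ e) subrr sin0 mulr0.
Qed.

(** The functional [a0] exposing [Y] lies in the plane of [p] and [q]. All vectors of [X] outside
    [Y] have a positive component [s] along [- a0], which points at angle [dl], so their angles
    relative to [dl] are arctangents; the least and the greatest bound the sector, and its width is
    below [pi]. *)
Lemma sector_exists X : X \in Fam -> face X Y -> exists a w, sector X a w.
Proof.
move=> XF [a0 [a0X YE]].
have oa0 : orth Y a0 by move=> v; rewrite YE mem_filter => /andP[/eqP].
have a00 : a0 != 0.
  apply/eqP => e; have YX : Y = X.
    by rewrite YE; apply/all_filterP/allP => v _; rewrite e dot0l.
  have : p = 0 by apply: (fan_spans fanF XF); rewrite -YX.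
  by move=> e'; move/eqP: pp; rewrite e' dot0l eq_sym oner_eq0.
have n0 : 0 < Num.sqrt (dot a0 a0) by rewrite sqrtr_gt0 dot_gt0.
set k := (Num.sqrt (dot a0 a0))^-1; have k0 : 0 < k by rewrite invr_gt0.
have kk : k * k * dot a0 a0 = 1.
  by rewrite -invfM -expr2 sqr_sqrtr ?mulVf ?dot_eq0 // dot_ge0.
pose x := - (k * dot p a0); pose y := - (k * dot q a0).
have [|dl [_ _ cd sd]] := @polar R x y 0.
  have aa : dot a0 a0 = dot p a0 * dot p a0 + dot q a0 * dot q a0.
    by rewrite {1}(oYE oa0) dotDl !dotZl.
  by rewrite -kk aa /x /y; ring.
have cs := cos_sin_sq dl.
pose s v := x * dot p v + y * dot q v; pose c v := dot (nu dl) v.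
have sE v : s v = - k * dot a0 v by rewrite {1}(oYE oa0) dotDl !dotZl /s /x /y; ring.
have s0 v : v \in X -> v \notin Y -> 0 < s v.
  move=> vX vY; rewrite sE mulNr oppr_gt0 pmulr_rlt0 // lt_neqAle a0X // andbT.
  by apply: contra vY => av; rewrite YE mem_filter av.
pose f v := atan (c v / s v).
have cf v : 0 < cos (f v).
  by apply: cos_gt0_pihalf; rewrite atan_gtNpi2 atan_ltpi2.
have ang v : v \in X -> v \notin Y -> at_angle v (s v / cos (f v)) (dl + f v).
  move=> vX vY; have sv := s0 v vX vY.
  have tf : s v * (sin (f v) / cos (f v)) = c v.
    have -> : sin (f v) / cos (f v) = tan (f v) by [].
    by rewrite /f atanK mulrC divfK // gt_eqF.
  have E1 : s v / cos (f v) * cos (f v) = s v by rewrite divfK // gt_eqF.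
  have E2 : s v / cos (f v) * sin (f v) = c v by rewrite -tf; ring.
  rewrite /at_angle cosD sinD !(mulrBr, mulrDr) !mulrA.
  rewrite !(mulrAC (s v / cos (f v)) (cos dl)) !(mulrAC (s v / cos (f v)) (sin dl)) E1 E2.
  rewrite /s /c nuE -cd -sd; split.
    rewrite -[LHS]mulr1 -cs; ring.
  rewrite -[LHS]mulr1 -cs; ring.
have angY v : v \in Y -> forall t, at_angle v 0 t.
  by move=> vY t; rewrite /at_angle !mul0r oYp // oYq.
have rpos v : v \in X -> v \notin Y -> 0 < s v / cos (f v).
  by move=> vX vY; rewrite divr_gt0 ?s0.
have [v0 v0X'] : exists v, v \in [seq v <- X | v \notin Y].
  have na0 : - a0 != 0 by rewrite oppr_eq0.
  have [|v vX vp] := facet_side_gt fanF XF na0.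
    by move=> v vX; rewrite dotNl oppr_ge0 a0X.
  exists v; rewrite mem_filter vX andbT; apply/negP => /oa0 e.
  by move: vp; rewrite dotNl e oppr0 ltxx.
have [v1 v1X' h1] := seq_argmin f v0X'.
have [v2 v2X' h2] := seq_argmin (fun v => - f v) v0X'.
have memX' v : v \in [seq v <- X | v \notin Y] -> v \in X /\ v \notin Y.
  by rewrite mem_filter => /andP[].
have [v1X v1Y] := memX' _ v1X'; have [v2X v2Y] := memX' _ v2X'.
have f12 : f v1 <= f v2 by exact: h1.
have bnd v : - (pi / 2) < f v < pi / 2 by rewrite atan_gtNpi2 atan_ltpi2.
have /andP[b1 b1'] := bnd v1; have /andP[b2 b2'] := bnd v2.
(* With a single angle, [nu] at that angle would be a normal of all of [X], which spans. *)
have f12' : f v1 < f v2.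
  rewrite lt_neqAle f12 andbT; apply/eqP => e.
  have : nu (dl + f v1) = 0; last by move/eqP; rewrite (negPf (nu_neq0 _)).
  apply: (fan_spans fanF XF) => v vX; have [/oY_nu //|vY] := boolP (v \in Y).
  rewrite (nu_angle _ (ang v vX vY)).
  have vX' : v \in [seq v <- X | v \notin Y] by rewrite mem_filter vY.
  have := h1 v vX'; have := h2 v vX'; rewrite -e => l1 l2.
  have -> : f v = f v1 by lra.
  by rewrite subrr sin0 mulr0.
exists (dl + f v1), (f v2 - f v1).
have wE : dl + f v1 + (f v2 - f v1) = dl + f v2 by ring.
split; [lra|lra| | |].
- by exists v1 => //; exists (s v1 / cos (f v1)); [exact: rpos|exact: ang].
- by exists v2 => //; exists (s v2 / cos (f v2)); [exact: rpos|rewrite wE; exact: ang].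
move=> v vX; rewrite wE; have [vY|vY] := boolP (v \in Y).
  exists 0, (dl + f v1); split=> //; last exact: angY.
  by rewrite lexx; lra.
exists (s v / cos (f v)), (dl + f v); split; [exact/ltW/rpos| |exact: ang].
have vX' : v \in [seq v <- X | v \notin Y] by rewrite mem_filter vY.
by have := h1 v vX'; have := h2 v vX' => l1 l2; apply/andP; split; lra.
Qed.

Let dot_en l t : dot l (en t) = cos t * dot l p + sin t * dot l q.
Proof. by rewrite /en dotDr !dotZr. Qed.

Let dot_angle l v r t : orth Y l -> at_angle v r t -> dot l v = r * dot l (en t).
Proof.
move=> ol [e1 e2]; rewrite {1}(oYE ol) dotDl !dotZl e1 e2 dot_en (dotC l p) (dotC l q); ring.
Qed.

Lemma sector_en_ge0 X a w l t : sector X a w -> orth Y l ->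
  (forall v, v \in X -> 0 <= dot l v) -> a <= t <= a + w -> 0 <= dot l (en t).
Proof.
move=> [w0 wpi [v vX [r r0 e]] [v' vX' [r' r'0 e']] _] ol lX /andP[t1 t2].
have la : 0 <= dot l (en a) by rewrite -(pmulr_rge0 _ r0) -(dot_angle ol e) lX.
have lb : 0 <= dot l (en (a + w)) by rewrite -(pmulr_rge0 _ r'0) -(dot_angle ol e') lX.
have sw : 0 < sin w by apply: sin_gt0_pi; rewrite w0.
have s1 : 0 <= sin (a + w - t) by apply: sin_ge0_pi; apply/andP; split; lra.
have s2 : 0 <= sin (t - a) by apply: sin_ge0_pi; apply/andP; split; lra.
rewrite -(pmulr_rge0 _ sw).
suff -> : sin w * dot l (en t) = sin (a + w - t) * dot l (en a) + sin (t - a) * dot l (en (a + w)).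
  by rewrite addr_ge0 // mulr_ge0.
have -> : t = a + (t - a) by ring.
have -> : a + w - (a + (t - a)) = w - (t - a) by ring.
have -> : a + (t - a) - a = t - a by ring.
by move: (t - a) => d; rewrite !dot_en !cosD !sinD sinN cosN; ring.
Qed.

(** A functional separating [X] from [Z] vanishes on [Y] and on both rays of the overlap. These rays
    are linearly independent in the plane, so it is 0 and [fan_eq] applies. *)
Lemma sector_overlap X Z a b w w' t1 t2 : X \in Fam -> Z \in Fam ->
  {subset Y <= X} -> {subset Y <= Z} -> sector X a w -> sector Z b w' ->
  t1 < t2 -> a <= t1 -> t2 <= a + w -> b <= t1 -> t2 <= b + w' -> X = Z.
Proof.
move=> XF ZF YX YZ sX sZ t12 at1 at2 bt1 bt2; apply: (fan_eq fanF) => // l lX lZ.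
have ol : orth Y l.
  by move=> v vY; apply/eqP; rewrite eq_le lX ?YX // lZ ?YZ.
have onl : orth Y (- l) by move=> v vY; rewrite dotNl ol // oppr0.
have z t : a <= t <= a + w -> b <= t <= b + w' -> dot l (en t) = 0.
  move=> ht ht'; apply/eqP; rewrite eq_le (sector_en_ge0 sX ol lX ht) andbT.
  rewrite -oppr_ge0 -dotNl; apply: (sector_en_ge0 sZ onl _ ht').
  by move=> v vZ; rewrite dotNl oppr_ge0 lZ.
have z1 : dot l (en t1) = 0 by apply: z; apply/andP; split; lra.
have z2 : dot l (en t2) = 0 by apply: z; apply/andP; split; lra.
have s12 : 0 < sin (t2 - t1).
  by have [_ wpi _ _ _] := sX; apply: sin_gt0_pi; apply/andP; split; lra.
move: z1 z2; rewrite !dot_en sinB in s12 *; rewrite (dotC l p) (dotC l q) => z1 z2.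
have lp : dot p l = 0.
  apply: (mulfI (lt0r_neq0 s12)); rewrite mulr0.
  have -> : (sin t2 * cos t1 - cos t2 * sin t1) * dot p l =
    sin t2 * (cos t1 * dot p l + sin t1 * dot q l) -
    sin t1 * (cos t2 * dot p l + sin t2 * dot q l) by ring.
  by rewrite z1 z2 !mulr0 subrr.
have lq : dot q l = 0.
  apply: (mulfI (lt0r_neq0 s12)); rewrite mulr0.
  have -> : (sin t2 * cos t1 - cos t2 * sin t1) * dot q l =
    cos t1 * (cos t2 * dot p l + sin t2 * dot q l) -
    cos t2 * (cos t1 * dot p l + sin t1 * dot q l) by ring.
  by rewrite z1 z2 !mulr0 subrr.
by rewrite (oYE ol) lp lq !scale0r addr0.
Qed.

Let polar_inj r r' s t : 0 < r -> 0 <= r' -> r * cos s = r' * cos t ->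
  r * sin s = r' * sin t -> cos s = cos t /\ sin s = sin t.
Proof.
move=> r0 r'0 e1 e2; have cs := cos_sin_sq s; have ct := cos_sin_sq t.
have : (r - r') * (r + r') = 0.
  have : (r * cos s) * (r * cos s) + (r * sin s) * (r * sin s) = r * r.
    by rewrite -[RHS]mulr1 -cs; ring.
  rewrite e1 e2; have -> : r' * cos t * (r' * cos t) + r' * sin t * (r' * sin t) = r' * r'.
    by rewrite -[RHS]mulr1 -ct; ring.
  by move=> e; nra.
move=> /eqP; rewrite mulf_eq0 (gt_eqF (ltr_pwDl r0 r'0)) orbF subr_eq0 => /eqP e.
by rewrite -e in e1 e2; split; apply: (mulfI (lt0r_neq0 r0)).
Qed.

(** The neighbor across the last ridge contains a vector at angle [a + w]; if its sector started
    earlier, it would have vectors on the side of [X]. *)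
Lemma sector_next X a w : X \in Fam -> {subset Y <= X} -> sector X a w ->
  exists Z, [/\ Z \in Fam, {subset Y <= Z}, face Z (low_ridge X (a + w))
    & forall b w', sector Z b w' -> cos b = cos (a + w) /\ sin b = sin (a + w)].
Proof.
move=> XF YX sX; have [fX cX] := ridge_end YX sX.
have [Z [ZF fZ hZ]] := facet_side_exists fanF XF fX cX.
exists Z; split=> //; first by move=> v /(sub_low (a + w) YX)/(face_sub fZ).
move=> b w' [w'0 w'pi [v vZ [r r0 e]] _ h].
have [_ _ _ [v' vX' [r' r'0 e']] _] := sX.
have v'Z : v' \in Z.
  by apply: (face_sub fZ); rewrite mem_filter vX' (nu_angle _ e') subrr sin0 mulr0 eqxx.
have [r'' [t [r''0 /andP[t1 t2] e'']]] := h v' v'Z.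
have [et es] : cos (a + w) = cos t /\ sin (a + w) = sin t.
  move: e' e'' => [f1 f2] [g1 g2].
  by apply: (polar_inj r'0 r''0); rewrite -?f1 -?f2.
have : 0 <= sin (b - t).
  have := hZ v vZ; rewrite (nu_angle _ e) pmulr_rge0 //.
  by rewrite !sinB et es.
move=> s0; have [bt|bt] := leP t b; first by have -> : b = t by lra.
have : 0 < sin (t - b) by apply: sin_gt0_pi; apply/andP; split; lra.
by rewrite -[t - b]opprB sinN oppr_gt0 ltNge s0.
Qed.

Let orth_projP x y : orth_proj (hull Y) x y <-> y = dot p x *: p + dot q x *: q.
Proof.
rewrite /orth_proj; split=> [[/(lin_span_hull _ uY) xy oy]|->].
  have oYy : orth Y y by move=> v vY; apply: oy; exact: hull_mem.
  rewrite [LHS](oYE oYy); congr (_ *: _ + _ *: _); apply/eqP; rewrite -subr_eq0 -oppr_eq0 opprB.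
    by rewrite -dotBr (orth_inspan oYp xy).
  by rewrite -dotBr (orth_inspan oYq xy).
split.
  apply/(lin_span_hull _ uY); apply: inspan_orthP => // z oz.
  rewrite dotBr dotDr !dotZr {1}(oYE oz) dotDl !dotZl (dotC z p) (dotC z q); ring.
by move=> z zY; rewrite dotDl !dotZl (hull_dot uY oYp zY) (hull_dot uY oYq zY) !mulr0 addr0.
Qed.

(** Both inclusions rest on the law of sines: [sin w] times the unit vector at [t] is
    [sin (a + w - t)] times the one at [a] plus [sin (t - a)] times the one at [a + w]. For the
    second inclusion the point of the hull is sought on the segment from [v] to [v'], with weights
    proportional to [A] and [B]. *)
Lemma wedge_sector X a w : X \in Fam -> {subset Y <= X} -> sector X a w ->
  wedge (hull X) (hull Y) = [set z | exists r t : R,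
    [/\ 0 <= r, a <= t <= a + w & z = r *: (cos t *: p + sin t *: q)]].
Proof.
move=> XF YX sX; have uX := fan_uniqX fanF XF.
have [w0 wpi [v vX [s s0 e]] [v' vX' [s' s'0 e']] _] := sX.
have sw : 0 < sin w by apply: sin_gt0_pi; rewrite w0.
have ca := cos_sin_sq a; have cw := cos_sin_sq w.
apply/seteqP; split=> z /=.
  move=> [r [x [y [r0 xX /orth_projP -> ->]]]].
  have A0 : 0 <= dot (- nu (a + w)) x.
    rewrite dotNl oppr_ge0; apply: hull_le xX => // u uX'; exact: sector_nu_le0 sX uX'.
  have B0 : 0 <= dot (nu a) x.
    rewrite -oppr_le0 -dotNl; apply: hull_le xX => // u uX'.
    by rewrite dotNl oppr_le0; exact: sector_nu_ge0 sX uX'.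
  have [||||t [b [t0 bb e1 e2]]] := @sector_cone R a w (dot p x) (dot q x)
    (dot (- nu (a + w)) x / sin w) (dot (nu a) x / sin w) w0 wpi.
  - by rewrite divr_ge0 // ltW.
  - by rewrite divr_ge0 // ltW.
  - apply: (mulIf (lt0r_neq0 sw)).
    transitivity (dot (- nu (a + w)) x * cos a + dot (nu a) x * cos (a + w)); last first.
      by field; exact: lt0r_neq0.
    by rewrite dotNl !nuE cosD sinD -[LHS]mulr1 -ca; ring.
  - apply: (mulIf (lt0r_neq0 sw)).
    transitivity (dot (- nu (a + w)) x * sin a + dot (nu a) x * sin (a + w)); last first.
      by field; exact: lt0r_neq0.
    by rewrite dotNl !nuE cosD sinD -[LHS]mulr1 -ca; ring.
  exists (r * t), b; split=> //; first by rewrite mulr_ge0.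
  by rewrite e1 e2 -[RHS]scalerA; congr (_ *: _); rewrite scalerDr !scalerA.
move=> [r [t [r0 /andP[t1 t2] ->]]].
have s1 : 0 <= sin (a + w - t) by apply: sin_ge0_pi; apply/andP; split; lra.
have s2 : 0 <= sin (t - a) by apply: sin_ge0_pi; apply/andP; split; lra.
pose A := sin (a + w - t) / (s * sin w); pose B := sin (t - a) / (s' * sin w).
have A0 : 0 <= A by rewrite divr_ge0 // ltW // mulr_gt0.
have B0 : 0 <= B by rewrite divr_ge0 // ltW // mulr_gt0.
have AB : 0 < A + B.
  rewrite lt_def addr_ge0 // andbT; apply/eqP => AB.
  have A00 : sin (a + w - t) = 0.
    have A1 : A = 0 by lra.
    have : A * (s * sin w) = 0 by rewrite A1 mul0r.
    by rewrite /A divfK // gt_eqF // mulr_gt0.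
  have B00 : sin (t - a) = 0.
    have B1 : B = 0 by lra.
    have : B * (s' * sin w) = 0 by rewrite B1 mul0r.
    by rewrite /B divfK // gt_eqF // mulr_gt0.
  have : a + w - t = 0 by apply: sin_eq0_pi A00; lra.
  have : t - a = 0 by apply: sin_eq0_pi B00; lra.
  lra.
have AB0 : A + B != 0 by rewrite gt_eqF.
pose k := A / (A + B); pose x := k *: v + (1 - k) *: v'.
have k01 : 0 <= k <= 1.
  by rewrite divr_ge0 ?(ltW AB) //= ler_pdivrMr // mul1r lerDl.
have As : A * s = sin (a + w - t) / sin w.
  by rewrite /A; field; rewrite !lt0r_neq0.
have Bs : B * s' = sin (t - a) / sin w.
  by rewrite /B; field; rewrite !lt0r_neq0.
have kA : (A + B) * k = A by rewrite mulrC divfK.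
have kB : (A + B) * (1 - k) = B by rewrite mulrBr kA mulr1 addrC addKr.
have mixE (f g : R) : (A + B) * (k * f + (1 - k) * g) = A * f + B * g.
  have mix (c d : R) : c * (d * f + (1 - d) * g) = c * d * f + c * (1 - d) * g by ring.
  by rewrite mix kA kB.
have [e1 e2] := e; have [e1' e2'] := e'.
have px : (A + B) * dot p x = cos t.
  rewrite /x dotDr !dotZr mixE e1 e1' !mulrA As Bs.
  apply: (mulIf (lt0r_neq0 sw)).
  transitivity (sin (a + w - t) * cos a + sin (t - a) * cos (a + w)).
    by field; exact: lt0r_neq0.
  have -> : t = a + (t - a) by ring.
  have -> : a + w - (a + (t - a)) = w - (t - a) by ring.
  have -> : a + (t - a) - a = t - a by ring.
  by move: (t - a) => d; rewrite !cosD !sinD sinN cosN; ring.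
have qx : (A + B) * dot q x = sin t.
  rewrite /x dotDr !dotZr mixE e2 e2' !mulrA As Bs.
  apply: (mulIf (lt0r_neq0 sw)).
  transitivity (sin (a + w - t) * sin a + sin (t - a) * sin (a + w)).
    by field; exact: lt0r_neq0.
  have -> : t = a + (t - a) by ring.
  have -> : a + w - (a + (t - a)) = w - (t - a) by ring.
  have -> : a + (t - a) - a = t - a by ring.
  by move: (t - a) => d; rewrite !sinD sinN cosN; ring.
exists (r * (A + B)), x, (dot p x *: p + dot q x *: q); split.
- by rewrite mulr_ge0 // ltW.
- by apply: hull_convex => //; apply: hull_mem.
- exact/orth_projP.
- by rewrite -px -qx -[RHS]scalerA; congr (_ *: _); rewrite scalerDr !scalerA.
Qed.

Lemma sector_spherical_angle X a w : X \in Fam -> face X Y -> sector X a w ->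
  spherical_angle (hull X) (hull Y) w.
Proof.
move=> XF fY sX; have YX := face_sub fY; have uX := fan_uniqX fanF XF.
have [fa ca] := ridge_start YX sX; have [fb cb] := ridge_end YX sX.
have [w0 wpi [v vX [s s0 e]] [v' vX' [s' s'0 e']] _] := sX.
have [e1 e2] := e; have [e1' e2'] := e'.
have sw : 0 < sin w by apply: sin_gt0_pi; rewrite w0.
have uL t : uniq (low_ridge X t) by exact: filter_uniq.
have n0 : (0 < n)%N by apply: ltn_trans n3.
have dimr t : face X (low_ridge X t) -> codim1 (low_ridge X t) (nu t) ->
    has_dim (hull (low_ridge X t)) (n - 2).
  move=> ft ct; apply/(has_dim_face fanF _ XF ft).
  have -> : (n - 2).+1 = (n - 1)%N by rewrite -subSn // ltnW.
  by apply/(codim1P n0 (uL t)); exists (nu t).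
have [l [l0 YE]] := fY.
have fYr t : is_face (hull (low_ridge X t)) (hull Y).
  have [m m1] := fan_plane fanF XF.
  apply/(@is_faceP _ _ _ m) => //.
    by move=> u; rewrite mem_filter => /andP[_ /m1].
  exists l; split; first by move=> u; rewrite mem_filter => /andP[_ /l0].
  rewrite {1}YE; congr hull; rewrite filter_nested; apply: eq_in_filter => u uX'.
  case: eqP => // lu; have uY' : u \in Y by rewrite YE mem_filter lu eqxx.
  by rewrite oY_nu // eqxx.
have facet t : face X (low_ridge X t) -> is_face (hull X) (hull (low_ridge X t)).
  by move=> ft; apply/(is_face_fan fanF _ XF); exists (low_ridge X t).
have notK u r t : u \in X -> 0 < r -> at_angle u r t -> ~ hull Y u.
  move=> uX' r0 [f1 f2] uK.
  have := hull_dot uY oYp uK; have := hull_dot uY oYq uK; rewrite f1 f2 => g2 g1.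
  have cs := cos_sin_sq t.
  have : r * r * (cos t * cos t + sin t * sin t) = 0.
    have -> : r * r * (cos t * cos t + sin t * sin t) =
      (r * cos t) * (r * cos t) + (r * sin t) * (r * sin t) by ring.
    by rewrite g1 g2 mul0r addr0.
  by rewrite cs mulr1 => /eqP; rewrite mulf_eq0 orbb gt_eqF.
have memr u r t : u \in X -> at_angle u r t -> hull (low_ridge X t) u.
  move=> uX' f; apply: hull_mem => //; rewrite mem_filter uX' andbT.
  by rewrite (nu_angle _ f) subrr sin0 mulr0.
exists (hull (low_ridge X a)), (hull (low_ridge X (a + w))), v, v',
  (dot p v *: p + dot q v *: q), (dot p v' *: p + dot q v' *: q); split.
- move=> eG; have : dot (nu (a + w)) v = 0.
    have : hull (low_ridge X (a + w)) v by rewrite -eG; exact: memr vX e.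
    by apply: hull_dot => // u; rewrite mem_filter => /andP[/eqP].
  rewrite (nu_angle _ e); have -> : a - (a + w) = - w by ring.
  rewrite sinN mulrN => /eqP; rewrite oppr_eq0 mulf_eq0 !gt_eqF //.
- split; [split; [exact: facet|exact: dimr|exact: fYr]|exact: memr vX e
    |exact: notK e|exact/orth_projP].
- split; [split; [exact: facet|exact: dimr|exact: fYr]|exact: memr vX' e'
    |exact: notK e'|exact/orth_projP].
have dd (x y x' y' : R) : dot (x *: p + y *: q) (x' *: p + y' *: q) = x * x' + y * y'.
  by rewrite !dotDl !dotDr !dotZl !dotZr pp qq pq (dotC q p) pq; ring.
have en1 : enorm (dot p v *: p + dot q v *: q) = s.
  rewrite /enorm dd e1 e2.
  have -> : s * cos a * (s * cos a) + s * sin a * (s * sin a) = s ^+ 2.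
    by rewrite expr2 -[RHS]mulr1 -(cos_sin_sq a); ring.
  by rewrite sqrtr_sqr gtr0_norm.
have en2 : enorm (dot p v' *: p + dot q v' *: q) = s'.
  rewrite /enorm dd e1' e2'; move: (a + w) => b.
  have -> : s' * cos b * (s' * cos b) + s' * sin b * (s' * sin b) = s' ^+ 2.
    by rewrite expr2 -[RHS]mulr1 -(cos_sin_sq b); ring.
  by rewrite sqrtr_sqr gtr0_norm.
rewrite /angle en1 en2 dd e1 e2 e1' e2'.
have -> : (s * cos a * (s' * cos (a + w)) + s * sin a * (s' * sin (a + w))) / (s * s') =
    cos w.
  apply: (mulIf (mulf_neq0 (lt0r_neq0 s0) (lt0r_neq0 s'0))); rewrite divfK ?mulf_neq0 ?gt_eqF //.
  by rewrite cosD sinD -[RHS]mul1r -(cos_sin_sq a); ring.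
by rewrite cosK // in_itv /= (ltW w0) ltW.
Qed.

(** Iterating the passage to the next facet from [X0] gives a sequence [X_], whose start angles are
    lifted to an increasing real sequence [th]. It closes up after exactly one turn, which yields
    the cycle, the angle sum and the winding number together. *)
Lemma fan_peak_cycle : exists (k : nat) (F : 'I_k -> set 'rV[R]_n),
  [/\ peak_cycle P (hull Y) F, angles_sum_to_2pi (hull Y) F & winds_once (hull Y) F].
Proof.
pose good X := X \in Fam /\ face X Y.
have /choice[AW hAW] : forall X, exists aw : R * R, good X -> sector X aw.1 aw.2.
  move=> X; have [[XF fX]|ng] := pselect (good X); last by exists (0, 0).
  by have [a [w s]] := sector_exists XF fX; exists (a, w).
pose A X := (AW X).1; pose W X := (AW X).2.
pose YB X := low_ridge X (A X + W X).
have /choice[N hN] : forall X, exists Z, good X ->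
    [/\ good Z, face Z (YB X), cos (A Z) = cos (A X + W X) & sin (A Z) = sin (A X + W X)].
  move=> X; have [[XF fX]|ng] := pselect (good X); last by exists [::].
  have [Z [ZF YZ fZ hZ]] := sector_next XF (face_sub fX) (hAW X (conj XF fX)).
  have gZ : good Z by split=> //; exact: (face_containing_sub fanF XF0 ZF fY0).
  by have [c s] := hZ _ _ (hAW Z gZ); exists Z.
pose X_ i := iter i N X0.
have gX i : good (X_ i) by elim: i => //= i /hN[].
have [th thE] : exists th : nat -> R, forall i, th i = A X0 + \sum_(j < i) W (X_ j).
  by eexists.
have thS i : th i.+1 = th i + W (X_ i) by rewrite !thE big_ord_recr addrA.
have th0 : th 0%N = A X0 by rewrite thE big_ord0 addr0.
have ang i : cos (th i) = cos (A (X_ i)) /\ sin (th i) = sin (A (X_ i)).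
  elim: i => [|i [IHc IHs]]; first by rewrite th0.
  have [_ _ c s] := hN _ (gX i).
  by rewrite thS [X_ i.+1]/= c s !cosD !sinD IHc IHs.
have sec i : sector (X_ i) (th i) (W (X_ i)).
  by have [c s] := ang i; apply: (sector_shift (esym c) (esym s)); apply: hAW.
have W0 i : 0 < W (X_ i) by have [] := sec i.
have Wpi i : W (X_ i) < pi by have [] := sec i.
have th_lt : {homo th : i j / (i < j)%N >-> i < j}.
  by apply: (homo_ltn lt_trans) => l; rewrite thS ltrDl.
have th_inj i j : th i = th j -> i = j.
  by move=> e; case: (ltngtP i j) => // /th_lt; rewrite e ltxx.
have pi0 := @pi_gt0 R.
have per t : cos (t + 2 * pi) = cos t /\ sin (t + 2 * pi) = sin t.
  have -> : 2 * pi = pi *+ 2 :> R by rewrite mulr_natl.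
  by split; [exact: cosD2pi|exact: sinD2pi].
(* There are finitely many facets, so the widths have a positive lower bound and the angles exceed a
   full turn. *)
have [d d0 hd] : exists2 d, 0 < d & forall i, d <= W (X_ i).
  have [|d d0 hd] := @small_pos R _ Fam (fun X => if `[< face X Y >] then W X else 1).
    by move=> X XF; case: asboolP => // fX; have [] := hAW X (conj XF fX).
  exists d => // i; have [XF fX] := gX i.
  by have := hd _ XF; case: asboolP.
have th_ge i : th 0%N + i%:R * d <= th i.
  elim: i => [|i IH]; first by rewrite mul0r addr0.
  by rewrite thS -natr1 mulrDl mul1r; have := hd i; lra.
have find a j : th 0%N <= a -> a < th j -> exists i, [/\ (i < j)%N, th i <= a & a < th i.+1].
  move=> a0; elim: j => [|j IH] aj; first by move: aj; rewrite ltNge a0.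
  have [ja|/IH[i [ij i1 i2]]] := leP (th j) a; first by exists j.
  by exists i; split=> //; exact: ltnW.
have [k [k1 k2]] : exists k, th k <= th 0%N + 2 * pi /\ th 0%N + 2 * pi < th k.+1.
  have p0 : 0 <= 2 * pi / d by rewrite divr_ge0 ?mulr_ge0 // ltW.
  have := archi_boundP p0; set b := Num.bound _ => hb.
  have [||i [_ i1 i2]] := find (th 0%N + 2 * pi) b; last by exists i.
    lra.
  apply: lt_le_trans (th_ge b); rewrite ltrD2l.
  by move: hb; rewrite ltr_pdivrMr.
have sec' : sector X0 (th 0%N + 2 * pi) (W X0).
  have [c s] := per (th 0%N); exact: (sector_shift (esym c) (esym s) (sec 0%N)).
have YX i : {subset Y <= X_ i} by exact: face_sub (gX i).2.
(* The sector of [X_ k] and that of [X0] one turn later both contain the angles just beyond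
   [th 0 + 2 * pi]. *)
have Xk : X_ k = X0.
  have h1 : th 0%N + 2 * pi < Num.min (th k.+1) (th 0%N + 2 * pi + W X0).
    by rewrite lt_min k2 ltrDl; exact: (W0 0%N).
  apply: (sector_overlap (gX k).1 XF0 (YX k) (YX 0%N) (sec k) sec' h1) => //.
    by rewrite -thS ge_min lexx.
  by rewrite ge_min lexx orbT.
(* Both are start angles of [X0], hence congruent modulo a turn, and they differ by less than one
   width. *)
have thk : th k = th 0%N + 2 * pi.
  have [c s] := ang k; have [c0 s0] := ang 0%N; have [cp sp] := per (th 0%N).
  apply: angle_eq.
  - by rewrite c Xk cp c0.
  - by rewrite s Xk sp s0.
  - by have := thS k; have := Wpi k; lra.
  - lra.
have k0 : (0 < k)%N.
  by rewrite lt0n; apply/eqP => e; move: thk; rewrite e; lra.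
have th_bnd i : (i < k)%N -> th 0%N <= th i /\ th i < th 0%N + 2 * pi.
  move=> ik; split; last by rewrite -thk; exact: th_lt.
  by case: i {ik} => [|i] //; apply/ltW/th_lt.
have nextE (i : 'I_k) : X_ (ordS i) = N (X_ i).
  rewrite /=; have := ltn_ord i; rewrite leq_eqVlt => /orP[/eqP e|ik].
    by rewrite e modnn /= -[RHS]/(X_ (val i).+1) e Xk.
  by rewrite modn_small.
have fYB i : face (X_ i) (YB (X_ i)) /\ codim1 (YB (X_ i)) (nu (A (X_ i) + W (X_ i))).
  exact: (ridge_end (YX i) (hAW _ (gX i))).
exists k, (fun i => hull (X_ i)); split.
- split.
  + move=> i j /(fan_hull_inj fanF (gX i).1 (gX j).1) e; apply: val_inj; apply: th_inj.
    have [b1 b2] := th_bnd _ (ltn_ord i); have [b3 b4] := th_bnd _ (ltn_ord j).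
    have [c s] := ang i; have [c' s'] := ang j.
    by apply: angle_eq; [rewrite c c' e|rewrite s s' e|lra|lra].
  + apply/seteqP; split=> F /=.
      move=> [i _ <-]; split; first by exists (X_ i); [exact: (gX i).1|].
      exact/(is_face_face fanF XF0 (gX i).1 fY0)/(gX i).2.
    move=> [[Z ZF <-] /(is_face_face fanF XF0 ZF fY0) fZ].
    have sZ := hAW Z (conj ZF fZ).
    (* Any facet at the peak starts at some angle of the turn; the listed sector containing this
       angle overlaps it, so the two facets coincide. *)
    have [|t [t1 t2 ct st]] := @polar R (cos (A Z)) (sin (A Z)) (th 0%N).
      exact: cos_sin_sq.
    have [||i [ik i1 i2]] := find t k => //; first by rewrite thk.
    have sZ' := sector_shift (esym ct) (esym st) sZ.
    have h1 : t < Num.min (th i.+1) (t + W Z).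
      by rewrite lt_min i2 ltrDl; have [] := sZ.
    exists (Ordinal ik) => //=; congr hull.
    apply: (sector_overlap (gX i).1 ZF (YX i) (face_sub fZ) (sec i) sZ' h1) => //.
      by rewrite -thS ge_min lexx.
    by rewrite ge_min lexx orbT.
  + exists (fun i => hull (YB (X_ i))); split.
      (* A ridge determines its angle modulo a turn. The end angles [th i.+1] lie in a half-open
         turn closed at [th k], so successors are compared instead of indices. *)
      move=> i j e; apply: val_inj; apply/eqP; rewrite -eqSS; apply/eqP; apply: th_inj.
      have {}e : YB (X_ i) = YB (X_ j).
        exact: (face_eq fanF (gX i).1 (gX j).1 (fYB i).1 (fYB j).1 e).
      have [b1 b2] := th_bnd _ (ltn_ord i); have [b3 b4] := th_bnd _ (ltn_ord j).
      have [w0 wpi _ [v vX [r r0 av]] _] := hAW _ (gX i).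
      have : v \in YB (X_ i) by rewrite mem_filter vX (nu_angle _ av) subrr sin0 mulr0 eqxx.
      rewrite e mem_filter => /andP[/eqP nv vX'].
      have [w0' wpi' _ _ /(_ v vX')[r' [t [r'0 /andP[t1 t2] av']]]] := hAW _ (gX j).
      have [ec es] : cos (A (X_ i) + W (X_ i)) = cos t /\ sin (A (X_ i) + W (X_ i)) = sin t.
        move: av av' => [f1 f2] [g1 g2].
        by apply: (polar_inj r0 r'0); rewrite -?f1 -?f2.
      have r'p : 0 < r'.
        rewrite lt_def r'0 andbT; apply/eqP => r'z; have cs := cos_sin_sq t.
        move: av av' => [f1 f2] [g1 g2]; move: g1 g2; rewrite r'z !mul0r f1 f2 ec es.
        by move=> /eqP; rewrite mulf_eq0 gt_eqF //= => /eqP ct /eqP;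
          rewrite mulf_eq0 gt_eqF //= => /eqP st; move: cs; rewrite ct st; lra.
      have tE : t = A (X_ j) + W (X_ j).
        move: nv; rewrite (nu_angle _ av') => /eqP; rewrite mulf_eq0 gt_eqF //= => /eqP.
        move=> /sin_eq0_pi h; have : t - (A (X_ j) + W (X_ j)) = 0; last by lra.
        by apply: h; move: w0' wpi' t1 t2; rewrite -/(W _) -/(A _); lra.
      have lastc (l : nat) : cos (th l.+1) = cos (A (X_ l) + W (X_ l)) /\
          sin (th l.+1) = sin (A (X_ l) + W (X_ l)).
        by have [c s] := ang l; rewrite thS !cosD !sinD c s.
      have [ci si] := lastc i; have [cj sj] := lastc j.
      have u1 : th i.+1 <= th 0%N + 2 * pi.
        rewrite -thk; have := ltn_ord i; rewrite leq_eqVlt => /orP[/eqP -> //|].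
        by move=> /th_lt/ltW.
      have u2 : th j.+1 <= th 0%N + 2 * pi.
        rewrite -thk; have := ltn_ord j; rewrite leq_eqVlt => /orP[/eqP -> //|].
        by move=> /th_lt/ltW.
      have l1 : th i < th i.+1 by exact: th_lt.
      have l2 : th j < th j.+1 by exact: th_lt.
      by apply: angle_eq; [rewrite ci cj ec tE|rewrite si sj es tE|lra|lra].
    move=> i; have [f c] := fYB i; split.
    * by apply/(ridge_codim1 fanF n3 (gX i).1 f); eexists; exact: c.
    * have [m m1] := fan_plane fanF (gX i).1; have [l [l0 YE]] := (gX i).2.
      have uB : uniq (YB (X_ i)) by exact: (face_uniq fanF (gX i).1 f).
      apply/(@is_faceP _ _ _ m) => //; first by move=> u /(face_sub f)/m1.
      exists l; split; first by move=> u /(face_sub f)/l0.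
      rewrite {1}YE; congr hull; rewrite filter_nested; apply: eq_in_filter => u uX.
      case: eqP => //= lu; have uY' : u \in Y by rewrite YE mem_filter lu eqxx.
      by rewrite oY_nu // eqxx.
    * exact/(is_face_face fanF (gX i).1 (gX i).1 f).
    * have [[ZF _] fZ _ _] := hN _ (gX i); rewrite nextE.
      exact/(is_face_face fanF (gX i).1 ZF f).
- exists (fun i => W (X_ i)); split.
    by move=> i; apply: sector_spherical_angle (gX i).1 (gX i).2 (sec i).
  by move: thk; rewrite th0 thE; lra.
- exists p, q, th; split=> //.
  + move=> z zY; rewrite (hull_dot uY oYp zY) (hull_dot uY oYq zY) //.
  + move=> i; split; first exact: th_lt.
    by rewrite thS; exact: wedge_sector (gX i).1 (YX i) (sec i).
Qed.

End Peak.

Theorem fan_polytope {R : realType} {n : nat} (V : seq 'rV[R]_n) (Fam : seq (seq 'rV[R]_n)) :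
  (3 <= n)%N -> fan V Fam -> is_polytope (fan_facets Fam).
Proof.
move=> n3 fanF; split.
- exact/finite_image/finite_seq.
- exact: (fan_facet fanF n3).
- exact: (fan_ridge fanF n3).
- move=> K /(poly_faceP fanF)[X [Y [XF fY -> dY]]].
  have [|p [q cY]] := codim2_exists (face_uniq fanF XF fY); first by rewrite dY; lia.
  exact: (fan_peak_cycle fanF n3 XF fY cY).
- exact: (fan_connected fanF n3).
- exact: (fan_center fanF).
- exact: (fan_noncoplanar_facets fanF n3).
Qed.

(** * Regions *)

Section Regions.
Context {R : realType} {n : nat}.
Implicit Types (x y u v w m a l : 'rV[R]_n) (X Y Z T V : seq 'rV[R]_n).

Definition reducible_pair X x y := [\/ x + y = 0, x + y \in X,
  exists u u', [/\ u \in X, u' \in X, u <> x, u <> y & x + y = u + u']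
  | exists u1 u2 u3, [/\ u1 \in X, u2 \in X, u3 \in X & 2 *: (x + y) = u1 + u2 + u3]].

(* The star-shaped body whose facets are the outer facets of the hulls of the
   regions; a region is the part of V in one of the cones of a complete fan. *)
Record regions V (Rg : seq (seq 'rV[R]_n)) : Prop := IsRegions {
  rg_uniq : uniq V;
  rg_norm : forall v, v \in V -> dot v v = 1;
  rg_sub : forall X, X \in Rg -> X = [seq v <- V | v \in X];
  rg_spans : forall X, X \in Rg -> spans X;
  rg_cover : forall x, exists2 X, X \in Rg & incone X x;
  rg_sep : forall X Z, X \in Rg -> Z \in Rg -> X <> Z -> sep X Z;
  rg_noncoplanar : forall X Z m, X \in Rg -> Z \in Rg -> X <> Z ->
    (forall v, v \in X -> dot m v <= 1) -> (forall v, v \in Z -> dot m v <= 1) ->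
    on_line [seq v <- X | (v \in Z) && (dot m v == 1)] ->
    (exists v, [/\ v \in X, v \notin Z & dot m v = 1]) ->
    (exists v, [/\ v \in Z, v \notin X & dot m v = 1]) -> False;
  rg_all : forall v, v \in V -> exists2 X, X \in Rg & v \in X;
  rg_edge : forall X x y, X \in Rg -> x \in X -> y \in X -> x <> y ->
    dot x y = 1 / 2 \/ reducible_pair X x y
}.

(** Finite as a list of sublists of [V] selected by a classical test, so no facet has to be
    computed. *)
Definition region_fam V (Rg : seq (seq 'rV[R]_n)) : seq (seq 'rV[R]_n) :=
  [seq T <- subs V | `[< exists2 X, X \in Rg & exists m, outer_facet X m T >]].

End Regions.

Section RegionPolytope.
Context {R : realType} {n : nat} (V : seq 'rV[R]_n) (Rg : seq (seq 'rV[R]_n)).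
Hypothesis rgV : regions V Rg.
Hypothesis n3 : (3 <= n)%N.
Implicit Types (x y u v w m a l : 'rV[R]_n) (X Y Z T : seq 'rV[R]_n).
Let Fam := region_fam V Rg.
Let P := fan_facets Fam.

Lemma region_famP T : T \in Fam <-> exists2 X, X \in Rg & exists m, outer_facet X m T.
Proof.
rewrite mem_filter; split=> [/andP[/asboolP]//|h]; rewrite asboolT //=.
by have [X XR [m [_ -> _]]] := h; rewrite (rg_sub rgV XR) filter_nested filter_subs.
Qed.

Lemma region_uniq X : X \in Rg -> uniq X.
Proof. by move=> /(rg_sub rgV) ->; rewrite filter_uniq // (rg_uniq rgV). Qed.

Lemma region_eq X Z : X \in Rg -> Z \in Rg -> {subset X <= Z} -> {subset Z <= X} -> X = Z.
Proof.
move=> XR ZR XZ ZX; rewrite (rg_sub rgV XR) (rg_sub rgV ZR); apply: eq_filter => v.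
by apply/idP/idP => [/XZ|/ZX].
Qed.

Lemma outer_facet_normal X T m m' : outer_facet X m T ->
  (forall v, v \in T -> dot m' v = 1) -> m' = m.
Proof.
move=> [_ TE sT] m1; apply/eqP; rewrite -subr_eq0; apply/eqP; apply: sT => v vT.
by rewrite dotBl m1 //; move: vT; rewrite TE mem_filter => /andP[/eqP -> _]; rewrite subrr.
Qed.

(** Outer facets of one region are separated by the difference of their normals. For different
    regions this difference, scaled down by [d], is added to the functional of the wall, where it
    only decides on the vectors of the wall. *)
Lemma region_fan : fan V Fam.
Proof.
split.
- exact: rg_uniq rgV.
- by move=> T; rewrite mem_filter => /andP[_]; exact: subsP (rg_uniq rgV).
- move=> T /region_famP[X XR [m [_ -> _]]]; exists m => v.
  by rewrite mem_filter => /andP[/eqP].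
- by move=> T /region_famP[X XR [m []]].
- move=> x; have [X XR cX] := rg_cover rgV x.
  have [m [T [h cT]]] := outer_facet_cover (region_uniq XR) (rg_spans rgV XR) cX.
  by exists T => //; apply/region_famP; exists X => //; exists m.
- move=> T T' /region_famP[X XR [m [mX TE _]]] /region_famP[X' XR' [m' [mX' TE' _]]] TT.
  have [XX|XX] := pselect (X = X').
    exists (m - m'); rewrite TE TE' -XX; split=> v; rewrite mem_filter => /andP[/eqP mv vX].
    + by rewrite dotBl mv subr_ge0 mX' // -XX.
    + by rewrite dotBl mv subr_le0 mX.
    + by rewrite dotBl mv => /eqP; rewrite subr_eq0 eq_sym mem_filter vX andbT.
    + by rewrite dotBl mv => /eqP; rewrite subr_eq0 mem_filter vX andbT.
  have [l [lX lX' XlX XlX']] := rg_sep rgV XR XR' XX.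
  have [|d d0 hd] := @small_pos R _ (X ++ X') (fun v =>
      if dot l v == 0 then 1 else `|dot l v| / (`|dot (m - m') v| + 1)).
    by move=> v _; case: ifP => // /negbT lv; rewrite divr_gt0 ?normr_gt0 // ltr_wpDl.
  have small v : v \in X ++ X' -> dot l v != 0 -> d * `|dot (m - m') v| < `|dot l v|.
    move=> vX lv; have := hd v vX; rewrite (negPf lv) ler_pdivlMr ?ltr_wpDl // => h.
    by nra.
  have pos v : v \in X -> dot l v != 0 -> 0 < dot (l + d *: (m - m')) v.
    move=> vX lv; have := small v _ lv; rewrite mem_cat vX => /(_ isT).
    rewrite (ger0_norm (lX _ vX)) (dotDl l) (dotZl d).
    have : - (d * `|dot (m - m') v|) <= d * dot (m - m') v.
      by rewrite -mulrN ler_pM2l // lerNl -normrN ler_norm.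
    lra.
  have neg v : v \in X' -> dot l v != 0 -> dot (l + d *: (m - m')) v < 0.
    move=> vX lv; have := small v _ lv; rewrite mem_cat vX orbT => /(_ isT).
    rewrite (ler0_norm (lX' _ vX)) (dotDl l) (dotZl d).
    have : d * dot (m - m') v <= d * `|dot (m - m') v| by rewrite ler_pM2l // ler_norm.
    lra.
  exists (l + d *: (m - m')); rewrite TE TE'; split=> v; rewrite !mem_filter => /andP[/eqP mv vX].
  + case: (eqVneq (dot l v) 0) => [lv|/(pos v vX)/ltW //].
    by rewrite dotDl lv add0r dotZl dotBl mv mulr_ge0 ?(ltW d0) // subr_ge0 mX' // XlX.
  + case: (eqVneq (dot l v) 0) => [lv|/(neg v vX)/ltW //].
    by rewrite dotDl lv add0r dotZl dotBl mv pmulr_rle0 // subr_le0 mX // XlX'.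
  + case: (eqVneq (dot l v) 0) => [lv|/(pos v vX) h e]; last by rewrite e ltxx in h.
    rewrite dotDl lv add0r dotZl dotBl mv => /eqP; rewrite mulf_eq0 gt_eqF //= subr_eq0.
    by rewrite eq_sym => ->; rewrite XlX.
  + case: (eqVneq (dot l v) 0) => [lv|/(neg v vX) h e]; last by rewrite e ltxx in h.
    rewrite dotDl lv add0r dotZl dotBl mv => /eqP; rewrite mulf_eq0 gt_eqF //= subr_eq0.
    by move=> ->; rewrite XlX'.
- move=> T T' m /region_famP[X XR [m1 h1]] /region_famP[Z ZR [m2 h2]] TT mT mT' line.
  have e1 := outer_facet_normal h1 mT; have e2 := outer_facet_normal h2 mT'.
  rewrite -e1 in h1; rewrite -e2 in h2.
  have [mX TE sT] := h1; have [mZ TE' sT'] := h2.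
  have XZ : X <> Z by move=> e; apply: TT; rewrite TE TE' e.
  (* Coplanar facets of two regions each have a tight vector outside the other region: otherwise the
     functional of the wall would vanish on a spanning set. *)
  have far A B S : A \in Rg -> B \in Rg -> A <> B -> S = [seq v <- A | dot m v == 1] ->
      spans S -> exists v, [/\ v \in A, v \notin B & dot m v = 1].
    move=> AR BR AB SE sS; apply: contrapT => /forallNP h.
    have SB : {subset S <= B}.
      move=> v; rewrite SE mem_filter => /andP[/eqP mv vA].
      by apply/negP => /negP vB; apply: (h v).
    have [l [lA lB AlB BlA]] := rg_sep rgV AR BR AB.
    have l0 : l = 0.
      apply: sS => v vS; apply/eqP; rewrite eq_le lB ?SB //= lA //.
      by move: vS; rewrite SE mem_filter => /andP[].
    by apply: AB; apply: region_eq => // v vA; [apply: AlB|apply: BlA]; rewrite // l0 dot0l.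
  apply: (rg_noncoplanar rgV XR ZR XZ mX mZ) => //.
  + have [u hu] := line; exists u => y oy; apply: hu => v.
    rewrite mem_filter TE TE' !mem_filter => /andP[/andP[mv vZ] /andP[_ vX]].
    by apply: oy; rewrite mem_filter vX vZ mv.
  + exact: far TE sT.
  + by apply: far TE' sT' => // e; apply: XZ.
Qed.

Lemma region_polytope : is_polytope P.
Proof. exact: fan_polytope n3 region_fan. Qed.

Lemma fam_region T : T \in Fam -> exists X, [/\ X \in Rg, {subset T <= X} &
  exists m, outer_facet X m T].
Proof.
move=> /region_famP[X XR [m h]]; exists X; split=> //; last by exists m.
by have [_ -> _] := h; move=> v; rewrite mem_filter => /andP[].
Qed.

Lemma region_mem X v : X \in Rg -> v \in X -> v \in V.
Proof. by move=> XR; rewrite (rg_sub rgV XR) mem_filter => /andP[]. Qed.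

Lemma unit_dot_le1 u v : dot u u = 1 -> dot v v = 1 -> dot u v <= 1.
Proof.
move=> uu vv; have := dot_ge0 (u - v).
rewrite !dotBl !dotBr uu vv (dotC v u); lra.
Qed.

Lemma unit_dot_eq1 u v : dot u u = 1 -> dot v v = 1 -> dot u v = 1 -> u = v.
Proof.
move=> uu vv uv; apply/eqP; rewrite -subr_eq0 -dot_eq0; apply/eqP.
rewrite !dotBl !dotBr uu vv (dotC v u) uv; lra.
Qed.

Lemma hull1 v : hull [:: v] = [set v].
Proof.
apply/seteqP; split=> x /=; last by move=> ->; apply: hull_mem; rewrite ?mem_seq1.
move=> /(hullP _ (erefl : uniq [:: v]))[c [_]]; rewrite !big_seq1 => -> ->.
by rewrite scale1r.
Qed.

(** Unit norms make every [v] a vertex. If [v] is a conic combination of [T], then [1 = dot v v] is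
    at most the sum of the coefficients, which is [dot m v <= 1]; equality forces every vector used
    to be [v]. The functional [v - m] then exposes [v]. *)
Lemma region_vertex_set : vertex_set P = [set` V].
Proof.
apply/seteqP; split=> v /=.
  move=> /(poly_faceP region_fan)[T [Y [TF fY e dY]]].
  have [u uYv] : exists u, u \in Y.
    case: (Y) dY => [|u Y' _]; first by rewrite span_nil dimv0.
    by exists u; rewrite mem_head.
  have : hull Y u by apply: hull_mem uYv; exact: (face_uniq region_fan TF fY).
  rewrite -e /= => <-; have [X [XR TX _]] := fam_region TF.
  by apply: (region_mem XR); apply/TX/(face_sub fY).
move=> vV; have [X XR vX] := rg_all rgV vV.
have [m [T [h cT]]] := outer_facet_cover (region_uniq XR) (rg_spans rgV XR)
  (incone_mem (region_uniq XR) vX).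
have TF : T \in Fam by apply/region_famP; exists X => //; exists m.
have [mX TE sT] := h.
have vv := rg_norm rgV vV.
have TV u : u \in T -> u \in V.
  by rewrite TE mem_filter => /andP[_]; exact: region_mem.
have mT u : u \in T -> dot m u = 1 by rewrite TE mem_filter => /andP[/eqP].
have vT : v \in T.
  apply/negP => /negP vnT; have [c [c0 vE]] := cT.
  have z : \sum_(u <- T) c u * (1 - dot v u) <= 0.
    have -> : \sum_(u <- T) c u * (1 - dot v u) = dot m v - dot v v.
      rewrite {2}vE {3}vE !dot_sumr -sumrB; apply: eq_big_seq => u uT.
      by rewrite !dotZr mT // mulrBr.
    by rewrite vv subr_le0 mX.
  have zz u : u \in T -> c u = 0.
    move=> uT; have uu := rg_norm rgV (TV u uT).
    have h1 w : w \in T -> 0 <= c w * (1 - dot v w).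
      by move=> wT; rewrite mulr_ge0 // subr_ge0 unit_dot_le1 // (rg_norm rgV (TV w wT)).
    have : \sum_(w <- T) c w * (1 - dot v w) == 0.
      by rewrite eq_le z big_seq sumr_ge0.
    rewrite big_seq psumr_eq0 // => /allP/(_ u uT); rewrite uT /= mulf_eq0 => /orP[/eqP //|].
    rewrite subr_eq0 eq_sym => /eqP vu.
    by move: vnT; rewrite (unit_dot_eq1 vv uu vu) uT.
  move: vv; rewrite vE big_seq big1 ?dot0l => [/eqP|u /zz ->]; last by rewrite scale0r.
  by rewrite eq_sym oner_eq0.
apply/(poly_faceP region_fan); exists T, [:: v]; split=> //.
- exists (v - m); split.
    move=> u uT; rewrite dotBl mT // subr_le0 unit_dot_le1 //; exact/(rg_norm rgV)/TV.
  rewrite -(filter_pred1_uniq (fan_uniqX region_fan TF) vT); apply: eq_in_filter => u uT.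
  rewrite dotBl mT // subr_eq0 /=; apply/eqP/eqP => [->|vu]; first exact: vv.
  by apply/esym/unit_dot_eq1 => //; exact/(rg_norm rgV)/TV.
- by rewrite hull1.
- rewrite span_seq1 dim_vline; case: eqP => // v0.
  by move: vv; rewrite v0 dot0l => /eqP; rewrite eq_sym oner_eq0.
Qed.

Lemma hull2 x y : hull [:: x; y] = conv_hull [set x; y].
Proof.
congr conv_hull; apply/seteqP; split=> z /=; rewrite !inE.
  by move=> /orP[/eqP|/eqP]; [left|right].
by case=> ->; rewrite eqxx ?orbT.
Qed.

(** [Y] lies on the line through [x] and [y], which meets the unit sphere only twice. *)
Lemma two_points Y m x y z : (forall v, v \in Y -> dot v v = 1) ->
  (forall v, v \in Y -> dot m v = 1) -> \dim <<Y>> = 2 ->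
  x \in Y -> y \in Y -> x <> y -> z \in Y -> z = x \/ z = y.
Proof.
move=> nY mY dY xY yY xy zY.
have x0 : x != 0.
  by apply/eqP => x0; have := nY x xY; rewrite x0 dot0l => /eqP; rewrite eq_sym oner_eq0.
have yx : y \notin <<[:: x]>>%VS.
  rewrite span_seq1; apply/negP => /vlineP[k yk].
  by apply: xy; have := mY y yY; rewrite yk dotZr mY // mulr1 => ->; rewrite scale1r.
have E : <<[:: y; x]>>%VS = <<Y>>%VS.
  apply/eqP; rewrite eqEdim dY dim_cons // span_seq1 dim_vline x0 andbT.
  by apply/span_subvP => v; rewrite !inE => /orP[/eqP ->|/eqP ->]; exact: memv_span.
have : z \in <<[:: y; x]>>%VS by rewrite E memv_span.
move=> /inspanE[c]; rewrite big_cons big_seq1 => zE.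
have := mY z zY; rewrite {1}zE dotDr !dotZr !mY // !mulr1 => c1.
have := nY z zY; rewrite {1 2}zE !dotDl !dotDr !dotZl !dotZr !nY // (dotC y x) => n1.
have xx := nY x xY; have yy := nY y yY.
have sq : (c y + c x) * (c y + c x) = 1 by rewrite c1 mulr1.
have : (c y * c x) * (1 - dot x y) = 0 by nra.
move=> /eqP; rewrite mulf_eq0 subr_eq0 (eq_sym 1) mulf_eq0 => /orP[/orP[/eqP cy|/eqP cx]|/eqP e].
- have cx : c x = 1 by lra.
  by left; rewrite zE cy scale0r add0r cx scale1r.
- have cy : c y = 1 by lra.
  by right; rewrite zE cx scale0r addr0 cy scale1r.
- by case: xy; exact: unit_dot_eq1.
Qed.

(** On an edge with endpoints [x] and [y] the facet normal has [m = 1], and [m <= 1] on [X]. So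
    [m (x + y) = 2] excludes the sums 0 and a single vector, and [2 (x + y)] has value 4, too much
    for three vectors. In a sum of two vectors both must be tight, and then both lie on the edge,
    which consists of [x] and [y] alone. *)
Lemma region_unit_edge : unit_edge P.
Proof.
move=> E /(poly_faceP region_fan)[T [Y [TF fY -> dY]]].
have [X [XR TX [m [mX TE sT]]]] := fam_region TF.
have YX : {subset Y <= X} by move=> v /(face_sub fY)/TX.
have nY v : v \in Y -> dot v v = 1 by move=> /YX/(region_mem XR)/(rg_norm rgV).
have mT v : v \in T -> dot m v = 1 by rewrite TE mem_filter => /andP[/eqP].
have mY v : v \in Y -> dot m v = 1 by move=> /(face_sub fY)/mT.
have uY := face_uniq region_fan TF fY.
have [x [y [Y' YE]]] : exists x y Y', Y = [:: x, y & Y'].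
  case: (Y) dY => [|x [|y Y' _]]; first by rewrite span_nil dimv0.
    by rewrite span_seq1 dim_vline; case: eqP.
  by exists x, y, Y'.
have xY : x \in Y by rewrite YE !inE eqxx.
have yY : y \in Y by rewrite YE !inE eqxx orbT.
have xy : x <> y by move=> e; move: uY; rewrite YE e /= inE eqxx.
have only z : z \in Y -> z = x \/ z = y by exact: (two_points nY mY dY xY yY xy).
have Y2 : Y = [:: x; y].
  rewrite YE; congr [:: _, _ & _]; case: (Y') YE => // z s YE.
  have zY : z \in Y by rewrite YE !inE eqxx !orbT.
  move: uY; rewrite YE /= !inE !negb_or => /and3P[/andP[_ /andP[xz _]] /andP[yz _] _].
  by case: (only z zY) => e; [rewrite e eqxx in xz|rewrite e eqxx in yz].
exists x, y; split; first by rewrite Y2 hull2.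
have xx := nY x xY; have yy := nY y yY.
suff e : dot x y = 1 / 2.
  rewrite /enorm !dotBl !dotBr xx yy (dotC y x) e.
  have -> : 1 - 1 / 2 - (1 / 2 - 1) = 1 :> R by lra.
  exact: sqrtr1.
have mx := mY x xY; have my := mY y yY.
have [//|] := rg_edge rgV XR (YX x xY) (YX y yY) xy.
have [a [a0 YEa]] := fY.
have ax v : v \in Y -> dot a v = 0 by rewrite YEa mem_filter => /andP[/eqP].
case=> [e|e|[u [u' [uX u'X ux uy' e]]]|[u1 [u2 [u3 [uX1 uX2 uX3 e]]]]].
- have := congr1 (dot m) e; rewrite dotDr mx my dot0r; lra.
- have := mX _ e; rewrite dotDr mx my; lra.
- have := congr1 (dot m) e; rewrite !dotDr mx my => e1.
  have := mX u uX; have := mX u' u'X => h' h.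
  have uT : u \in T by rewrite TE mem_filter uX andbT; apply/eqP; lra.
  have u'T : u' \in T by rewrite TE mem_filter u'X andbT; apply/eqP; lra.
  have := congr1 (dot a) e; rewrite !dotDr (ax x xY) (ax y yY) => e2.
  have := a0 u uT; have := a0 u' u'T => g' g.
  have : u \in Y by rewrite YEa mem_filter uT andbT; apply/eqP; lra.
  by case/only.
- have := congr1 (dot m) e; rewrite dotZr !dotDr mx my => e1.
  by have := mX u1 uX1; have := mX u2 uX2; have := mX u3 uX3; lra.
Qed.

End RegionPolytope.

(** * Facets of the convex hull: the convex case and long edges *)

(** A single region generates the whole space as a cone. So the origin is interior to the hull, and
    every facet hyperplane can be scaled to [m = 1]. *)
Lemma region_conv_facets {R : realType} {n : nat} (V : seq 'rV[R]_n) :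
  (3 <= n)%N -> regions V [:: V] -> fan_facets (region_fam V [:: V]) = conv_facets [set` V].
Proof.
move=> n3 rgV; have VR : V \in [:: V] by rewrite mem_head.
have uV := rg_uniq rgV.
have sV : spans V by apply: (rg_spans rgV); rewrite mem_head.
have bnd (a : 'rV[R]_n) : (forall v, v \in V -> dot a v <= 0) -> a = 0.
  move=> h; have [X] := rg_cover rgV a; rewrite inE => /eqP -> /(incone_le0 h).
  by rewrite leNgt dot_gt0 negbK => /eqP.
apply/seteqP; split=> F.
  move=> [T TF <-]; have /(region_famP rgV)[X] := TF.
  rewrite inE => /eqP -> [m [mV TE sT]]; split.
    exists m, 1; split; first by move=> x; exact: hull_le.
    by rewrite (hull_face uV mV) TE.
  have [m' m1] := fan_plane (region_fan rgV) TF.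
  have uT := fan_uniqX (region_fan rgV) TF.
  by apply/(has_dim_hull _ uT m1); rewrite (spansE uT).1 //; lia.
move=> [[a [b [hab ->]]] hd].
have haV v : v \in V -> dot a v <= b by move=> vV; apply: hab; exact: hull_mem.
rewrite [X in has_dim X _](hull_face uV haV) in hd; rewrite (hull_face uV haV).
set T := [seq v <- V | dot a v == b] in hd *.
have uT : uniq T by exact: filter_uniq.
(* A nonpositive offset forces [a = 0]; the face is then the whole hull, which contains 0 and has
   full dimension instead of n - 1. *)
have [b0|b0] := leP b 0.
  have a0 : a = 0 by apply: bnd => v /haV h; exact: le_trans h b0.
  have [[v vV]|nV] := pselect (exists v, v \in V); last first.
    have [c] := spans_inspan (const_mx 1) uV sV.
    rewrite big_seq big1 => [|v vV]; last by case: nV; exists v.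
    have i0 : 'I_n by case: (n) n3 => // k _; exact: ord0.
    by move=> /rowP/(_ i0); rewrite !mxE => /eqP; rewrite oner_eq0.
  have bb : b = 0 by have := haV v vV; rewrite a0 dot0l; lra.
  have TV : T = V by apply/all_filterP/allP => w _; rewrite a0 dot0l bb.
  move: hd; rewrite TV => -[x [U [dU hU]]].
  have all0 : conv_hull [set` V] 0.
    have [X] := rg_cover rgV (- \sum_(v <- V) v); rewrite inE => /eqP -> [c [c0 e]].
    have s0 : 0 < \sum_(v <- V) (c v + 1).
      rewrite big_seq (big_rem v vV) /= vV; apply: ltr_pwDl; first by rewrite ltr_wpDl.
      by apply: sumr_ge0 => w _; rewrite addr_ge0.
    apply/(hullP _ uV); exists (fun v => (c v + 1) / \sum_(v <- V) (c v + 1)); split.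
    + by move=> w; rewrite divr_ge0 ?addr_ge0 // ltW.
    + by rewrite -mulr_suml divff // gt_eqF.
    + have E : \sum_(v <- V) (c v + 1) *: v = 0.
        by under eq_bigr => w _ do rewrite scalerDl scale1r;
          rewrite big_split /= -e addNr.
      under eq_bigr => w _ do rewrite mulrC -scalerA.
      by rewrite -scaler_sumr E scaler0.
  have allx y : aff_hull (conv_hull [set` V]) y.
    have [c yE] := spans_inspan y uV sV.
    exists (size V).+1, (fun i => if unlift ord0 i is Some j then tnth (in_tuple V) j else 0),
      (fun i => if unlift ord0 i is Some j then c (tnth (in_tuple V) j)
                else 1 - \sum_(v <- V) c v); split.
    + by move=> i; case: unlift => [j|//]; apply: (hull_mem uV); rewrite mem_tnth.
    + rewrite big_ord_recl unlift_none.
      rewrite (eq_bigr (fun i => c (tnth (in_tuple V) i))) => [|i _]; last by rewrite liftK.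
      by rewrite [X in _ - X]big_tnth subrK.
    + rewrite big_ord_recl unlift_none scaler0 add0r.
      rewrite (eq_bigr (fun i => c (tnth (in_tuple V) i) *: tnth (in_tuple V) i)).
        by rewrite yE [LHS]big_tnth.
      by move=> i _; rewrite liftK.
  have : U = fullv.
    apply/vspaceP => y; rewrite memvf.
    have : aff_hull (conv_hull [set` V]) (y + x) by exact: allx.
    by rewrite -/(hull V) in hU *; rewrite hU /= addrK.
  by move=> e; move: dU; rewrite e dim_rV; lia.
exists T => //; apply/(region_famP rgV); exists V => //; exists (b^-1 *: a); split.
- by move=> v /haV h; rewrite dotZl mulrC ler_pdivrMr // mul1r.
- apply: eq_filter => v; rewrite dotZl; apply/eqP/eqP => [->|h]; first by rewrite mulVf ?gt_eqF.
  by rewrite -[LHS](mulVKf (lt0r_neq0 b0)) h mulr1.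
apply/(spansE uT); have := hd.
have m1 v : v \in T -> dot (b^-1 *: a) v = 1.
  by rewrite mem_filter dotZl => /andP[/eqP -> _]; rewrite mulVf // gt_eqF.
by move=> /(has_dim_hull _ uT m1) ->; lia.
Qed.

(** [unit_edge] provides endpoints [x'] and [y'] of its own; [x] and [y] lie on that segment of
    length 1, so their distance is at most 1. *)
Lemma long_edge_not_unit {R : realType} {n : nat} (V : seq 'rV[R]_n) (m a x y : 'rV[R]_n) :
  (3 <= n)%N -> uniq V -> (forall v, v \in V -> dot m v <= 1) ->
  spans [seq v <- V | dot m v == 1] ->
  (forall v, v \in V -> dot m v = 1 -> dot a v <= 0) ->
  (forall v, v \in V -> dot m v = 1 -> dot a v = 0 -> v = x \/ v = y) ->
  x \in V -> y \in V -> dot m x = 1 -> dot m y = 1 -> dot a x = 0 -> dot a y = 0 ->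
  x <> y -> 1 < dot (x - y) (x - y) -> ~ unit_edge (conv_facets [set` V]).
Proof.
move=> n3 uV mV sT aT onlyxy xV yV mx my ax ay xy xy1 ue.
set T := [seq v <- V | dot m v == 1] in sT.
have uT : uniq T by exact: filter_uniq.
have mT v : v \in T -> dot m v = 1 by rewrite mem_filter => /andP[/eqP].
have uxy : uniq [:: x; y] by rewrite /= inE andbT; exact/eqP.
have mxy v : v \in [:: x; y] -> dot m v = 1 by rewrite !inE => /orP[/eqP ->|/eqP ->].
have TE : hull [:: x; y] = hull [seq v <- T | dot a v == 0].
  congr conv_hull; apply/seteqP; split=> v /=; rewrite !inE !mem_filter.
    by move=> /orP[/eqP ->|/eqP ->]; rewrite ?ax ?ay ?mx ?my ?xV ?yV !eqxx.
  move=> /andP[/eqP av /andP[/eqP mv vV]].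
  by case: (onlyxy v vV mv av) => ->; rewrite eqxx ?orbT.
have : is_edge (conv_facets [set` V]) (hull [:: x; y]).
  split.
    apply/(has_dim_hull _ uxy mxy); rewrite dim_cons span_seq1.
      by rewrite dim_vline; case: eqP => // y0; move: my; rewrite y0 dot0r => /eqP;
        rewrite eq_sym oner_eq0.
    apply/negP => /vlineP[k xk]; apply: xy.
    by move: mx; rewrite xk dotZr my mulr1 => ->; rewrite scale1r.
  exists (hull T).
    split; first by exists m, 1; split; [move=> z; exact: hull_le|rewrite (hull_face uV mV)].
    by apply/(has_dim_hull _ uT mT); rewrite (spansE uT).1 //; lia.
  apply/(is_faceP _ uT mT); exists a; split=> //.
  by move=> v; rewrite mem_filter => /andP[/eqP mv vV]; exact: aT.
move=> /ue[x' [y' [e n1]]].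
have seg z : hull [:: x; y] z -> exists2 k, 0 <= k <= 1 & z = y' + k *: (x' - y').
  rewrite e -hull2 => -[i [f [c [fS c0 c1 ->]]]].
  exists (\sum_(j | f j == x') c j).
    rewrite sumr_ge0 // -c1 [leRHS](bigID (fun j => f j == x')) /= lerDl sumr_ge0 //.
  rewrite -{1}[y']scale1r -c1 scaler_suml scaler_suml [X in _ + X]big_mkcond -big_split.
  apply: eq_bigr => j _ /=; have := fS j; rewrite /= !inE => /orP[/eqP ->|/eqP ->].
    by rewrite eqxx scalerBr addrC subrK.
  by case: eqP => [->|_]; rewrite ?subrr ?scaler0 addr0.
have [k /andP[k0 k1] xE] := seg x (hull_mem uxy (mem_head _ _)).
have [|k' /andP[k0' k1'] yE] := seg y; first by apply: hull_mem; rewrite // !inE eqxx orbT.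
have d1 : dot (x' - y') (x' - y') = 1.
  have : enorm (x' - y') ^+ 2 = 1 by rewrite n1 expr1n.
  by rewrite /enorm sqr_sqrtr // dot_ge0.
have : x - y = (k - k') *: (x' - y') by rewrite xE yE opprD addrACA subrr add0r scalerBl.
move=> E; move: xy1; rewrite E dotZl dotZr d1 mulr1; nra.
Qed.

(** * Dominant functionals *)

Section Dominant.
Context {R : realType} {n : nat}.
Implicit Types (x y u v w m a l d : 'rV[R]_n) (X Y Z : seq 'rV[R]_n).

Lemma dot_reflection a x y : dot (reflection a x) y = dot x (reflection a y).
Proof.
by rewrite /reflection dotBl dotBr dotZl dotZr (dotC a y) (dotC x a); ring.
Qed.

Lemma reflectionK a : a != 0 -> involutive (@reflection R n a).
Proof.
move=> a0 x; rewrite /reflection dotBl dotZl.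
have aa : dot a a != 0 by rewrite dot_eq0.
rewrite -addrA -opprD -scalerDl.
have -> : 2 * dot x a / dot a a + 2 * (dot x a - 2 * dot x a / dot a a * dot a a) / dot a a = 0.
  by field.
by rewrite scale0r subr0.
Qed.

Definition dominant (Al : seq 'rV[R]_n) v := all (fun a => 0 <= dot a v) Al.

(* A supporting functional of two adjacent regions can be moved by the
   reflections in Al, which preserve both regions, until it is nonnegative on
   Al; its tight vectors are then spanned by few explicit ones. *)
Lemma dominant_functional X Z (Al : seq 'rV[R]_n) d :
  uniq X -> uniq Z -> sep X Z ->
  (forall a, a \in Al -> a != 0 /\ 0 < dot d a) ->
  (forall a v, a \in Al -> v \in X -> reflection a v \in X) ->
  (forall a v, a \in Al -> v \in Z -> reflection a v \in Z) ->
  forall m0, (forall v, v \in X -> dot m0 v <= 1) -> (forall v, v \in Z -> dot m0 v <= 1) ->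
    on_line [seq v <- X | (v \in Z) && (dot m0 v == 1)] ->
    (exists v, [/\ v \in X, v \notin Z & dot m0 v = 1]) ->
    (exists v, [/\ v \in Z, v \notin X & dot m0 v = 1]) ->
  exists m, [/\ forall v, v \in X -> dot m v <= 1, forall v, v \in Z -> dot m v <= 1,
    on_line [seq v <- X | (v \in Z) && (dot m v == 1)],
    on_line ([seq a <- Al | dot m a == 0] ++
             [seq v <- [seq v <- X | (v \in Z) && dominant Al v] | dot m v == 1]) &
    (exists v, [/\ v \in X, v \notin Z, dominant Al v & dot m v = 1]) /\
    (exists v, [/\ v \in Z, v \notin X & dot m v = 1])].
Proof.
move=> uX uZ sXZ hAl rX rZ m0 mX0 mZ0 line0 far0 far0'.
pose adm m := [/\ forall v, v \in X -> dot m v <= 1, forall v, v \in Z -> dot m v <= 1,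
  on_line [seq v <- X | (v \in Z) && (dot m v == 1)],
  (exists v, [/\ v \in X, v \notin Z & dot m v = 1]) &
  (exists v, [/\ v \in Z, v \notin X & dot m v = 1])].
have [l [lX lZ XlZ ZlX]] := sXZ.
have rnot a v W : a \in Al -> (forall b u, b \in Al -> u \in W -> reflection b u \in W) ->
    v \notin W -> reflection a v \notin W.
  move=> aA rW; apply: contra => /(rW a _ aA); rewrite reflectionK //; exact: (hAl a aA).1.
pose Q T (k : R) := exists m, [/\ adm m, T = [seq v <- X | dot m v == 1] & k = - dot d m].
(* The tight set determines [m]. The difference of two candidates and [l] are both normals of the
   common tight vectors, hence multiples of one [u0]; but the difference kills the tight vector [u]
   outside [Z], which [l] does not. So [dot d m] takes finitely many values and has a maximum. *)
have Qf T k k' : Q T k -> Q T k' -> k = k'.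
  move=> [m [[_ _ lm [u [uX' uZ' mu]] _] TE ->]] [m' [_ TE' ->]].
  congr (- dot d _); apply/eqP; rewrite -subr_eq0; apply/eqP.
  have oT v : v \in T -> dot (m - m') v = 0.
    rewrite dotBl => vT; move: (vT) (vT); rewrite {1}TE TE' !mem_filter.
    by move=> /andP[/eqP -> _] /andP[/eqP -> _]; rewrite subrr.
  have [u0 hu0] := lm.
  have [k1 e1] : exists k1, m - m' = k1 *: u0.
    apply: hu0 => v; rewrite mem_filter => /andP[/andP[_ mv] vX].
    by apply: oT; rewrite TE mem_filter mv.
  have [k2 e2] : exists k2, l = k2 *: u0.
    apply: hu0 => v; rewrite mem_filter => /andP[/andP[vZ _] vX].
    by apply/eqP; rewrite eq_le lX // lZ.
  case: (eqVneq k1 0) => [k10|k10]; first by rewrite e1 k10 scale0r.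
  case/negP: uZ'; apply: XlZ => //.
  have : dot (m - m') u = 0 by apply: oT; rewrite TE mem_filter mu eqxx.
  rewrite e1 e2 !dotZl => /eqP; rewrite mulf_eq0 (negPf k10) => /eqP ->.
  by rewrite mulr0.
have [|T [k [TX [m [am TE kE]] kmin]]] := seq_argmin_rel (s := subs X) Qf.
  exists [seq v <- X | dot m0 v == 1], (- dot d m0); split; first exact: filter_subs.
  by exists m0; split.
have [mX mZ lm farX farZ] := am.
(* If [dot m a] were negative, the reflected functional would again be admissible and have a larger
   product with [d]. *)
have mA a : a \in Al -> 0 <= dot m a.
  move=> aA; have [a0 da] := hAl a aA; rewrite leNgt; apply/negP => ma.
  have : Q [seq v <- X | dot (reflection a m) v == 1] (- dot d (reflection a m)).
    exists (reflection a m); split=> //; split.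
    - by move=> v vX; rewrite dot_reflection mX // rX.
    - by move=> v vZ; rewrite dot_reflection mZ // rZ.
    - have [u0 hu0] := lm; exists (reflection a u0) => y oy.
      have [|k' e] := hu0 (reflection a y).
        move=> v; rewrite mem_filter => /andP[/andP[vZ mv] vX].
        rewrite dot_reflection; apply: oy; rewrite mem_filter rX // rZ //=.
        by rewrite dot_reflection reflectionK // mv.
      exists k'; rewrite -[y](reflectionK a0) e /reflection scalerBr; congr (_ - _).
      by rewrite scalerA dotZl; congr (_ *: _); ring.
    - have [v [vX vZ mv]] := farX; exists (reflection a v); split; first exact: rX.
        exact: rnot.
      by rewrite dot_reflection reflectionK.
    - have [v [vZ vX mv]] := farZ; exists (reflection a v); split; first exact: rZ.
        exact: rnot.
      by rewrite dot_reflection reflectionK.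
  move=> /(kmin _ _ (filter_subs _ _)); rewrite kE lerN2 leNgt => /negP; apply.
  have c0 : 2 * dot m a / dot a a < 0.
    by rewrite pmulr_llt0 ?invr_gt0 ?dot_gt0 // pmulr_rlt0.
  by rewrite /reflection dotBr dotZr ltrBrDl gtrDr nmulr_rlt0.
(* A tight vector negative on [a] can be reflected: [m <= 1] at its image forces [dot m a = 0], so
   the image is still tight, with a larger product with [d]. *)
have climb v a : a \in Al -> dot m v = 1 -> dot m (reflection a v) <= 1 -> dot a v < 0 ->
    dot m a = 0 /\ dot d v < dot d (reflection a v).
  move=> aA mv mr av; have [a0 da] := hAl a aA; have aa : 0 < dot a a by rewrite dot_gt0.
  have c0 : 2 * dot v a / dot a a < 0.
    by rewrite pmulr_llt0 ?invr_gt0 // pmulr_rlt0 // dotC.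
  split; last by rewrite /reflection dotBr dotZr ltrBrDl gtrDr nmulr_rlt0.
  move: mr; rewrite /reflection dotBr dotZr mv => mr.
  have := mA a aA; rewrite le_eqVlt => /orP[/eqP -> //|ma].
  by move: mr; rewrite gerDl oppr_le0 nmulr_rge0 // leNgt ma.
have ndom v : ~~ dominant Al v -> exists2 a, a \in Al & dot a v < 0.
  by move=> /allPn[a aA]; rewrite -ltNge; exists a.
exists m; split=> //.
- have [u0 hu0] := lm; exists u0 => y oy; apply: hu0 => v0 v0G; apply: contrapT => /eqP yv0.
  (* Among the common tight vectors not orthogonal to [y], one with maximal product with [d] must be
     dominant, since climbing stays among them; but [y] is orthogonal to the dominant ones. *)
  pose Bad := [seq v <- X | [&& v \in Z, dot m v == 1 & dot y v != 0]].
  have v0B : v0 \in Bad.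
    by move: v0G; rewrite !mem_filter => /andP[/andP[-> ->] ->]; rewrite yv0.
  have [v] := seq_argmin (fun v => - dot d v) v0B.
  rewrite mem_filter => /andP[/and3P[vZ /eqP mv yv] vX] vmax.
  have [dv|/ndom[a aA av]] := boolP (dominant Al v).
    case/eqP: yv; apply: oy; rewrite mem_cat !mem_filter; apply/orP; right.
    by rewrite mv eqxx vZ dv.
  have [ma dlt] := climb v a aA mv (mX _ (rX a v aA vX)) av.
  have : reflection a v \in Bad.
    rewrite mem_filter rX // rZ // andbT /= /reflection !dotBr !dotZr ma mulr0 subr0 mv eqxx.
    by rewrite (oy a) ?mulr0 ?subr0 // mem_cat mem_filter ma eqxx aA.
  by move=> /vmax; rewrite lerN2 leNgt dlt.
- split=> //; have [v0 [v0X v0Z mv0]] := farX.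
  pose Far := [seq v <- X | (v \notin Z) && (dot m v == 1)].
  have v0F : v0 \in Far by rewrite mem_filter v0Z mv0 eqxx.
  have [v] := seq_argmin (fun v => - dot d v) v0F.
  rewrite mem_filter => /andP[/andP[vZ /eqP mv] vX] vmax.
  exists v; split=> //; apply: contrapT => /negP /ndom[a aA av].
  have [ma dlt] := climb v a aA mv (mX _ (rX a v aA vX)) av.
  have : reflection a v \in Far.
    rewrite mem_filter rX // rnot //= /reflection !dotBr !dotZr ma mulr0 subr0 mv eqxx //.
  by move=> /vmax; rewrite lerN2 leNgt dlt.
Qed.

End Dominant.

(** * Integer data of the configurations *)

Section IntegerVectors.
Local Open Scope Z_scope.

(* Vectors with coordinates z_i sqrt(w_i) / (D sqrt 2) are represented by
   integer lists z; their inner product is (sum_i w_i x_i y_i) / (2 D^2). *)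
Fixpoint zdot (w x y : seq Z) : Z :=
  match w, x, y with
  | a :: w', b :: x', c :: y' => Z.add (Z.mul a (Z.mul b c)) (zdot w' x' y')
  | _, _, _ => Z0
  end.

Definition zcomb (a : Z) (x : seq Z) (b : Z) (y : seq Z) : seq Z :=
  [seq Z.add (Z.mul a p.1) (Z.mul b p.2) | p <- zip x y].

Definition zneg (x : seq Z) : seq Z := map Z.opp x.
Definition zadd (x y : seq Z) : seq Z := [seq Z.add p.1 p.2 | p <- zip x y].
Definition zsub (x y : seq Z) : seq Z := [seq Z.sub p.1 p.2 | p <- zip x y].
(* Unlike has and ||, these stop at the first witness under call by value. *)
Fixpoint zhas (T : Type) (p : T -> bool) (s : seq T) : bool :=
  if s is x :: s' then if p x then true else zhas p s' else false.

Fixpoint zall (T : Type) (p : T -> bool) (s : seq T) : bool :=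
  if s is x :: s' then if p x then zall p s' else false else true.

Definition znull (x : seq Z) : bool := zall (Z.eqb 0) x.

Fixpoint zeqv (x y : seq Z) : bool :=
  match x, y with
  | a :: x', b :: y' => if Z.eqb a b then zeqv x' y' else false
  | [::], [::] => true
  | _, _ => false
  end.

Definition zmem (x : seq Z) (X : seq (seq Z)) : bool := zhas (zeqv x) X.
Definition zsubset (X Y : seq (seq Z)) : bool := all (fun x => zmem x Y) X.

Fixpoint zuniq (X : seq (seq Z)) : bool :=
  if X is x :: X' then ~~ zmem x X' && zuniq X' else true.

(** Fraction-free elimination: every other vector is made orthogonal to [r] with the pivot [k0], and
    the pivot itself becomes null and is dropped. *)
Definition kstep (w : seq Z) (K : seq (seq Z)) (r : seq Z) : seq (seq Z) :=
  if [seq k <- K | ~~ Z.eqb 0 (zdot w r k)] is k0 :: _ then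
    let c0 := zdot w r k0 in
    [seq k <- [seq (let c := zdot w r k in
                    if Z.eqb 0 c then k else zcomb c0 k (Z.opp c) k0) | k <- K]
      | ~~ znull k]
  else K.

Definition zunits (n : nat) : seq (seq Z) :=
  [seq [seq (if i == j then 1 else 0) | j <- iota 0 n] | i <- iota 0 n].

(* A spanning family of the rational kernel of the given rows. *)
Definition zkernel (n : nat) (w : seq Z) (rows : seq (seq Z)) : seq (seq Z) :=
  foldl (kstep w) (zunits n) rows.

Definition zfull (n : nat) (w : seq Z) (X : seq (seq Z)) : bool :=
  nilp (zkernel n w X).

(** Equality in the Cauchy-Schwarz inequality. *)
Definition parallel (w x y : seq Z) : bool :=
  Z.eqb (Z.mul (zdot w x x) (zdot w y y)) (Z.mul (zdot w x y) (zdot w x y)).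

Definition zpart (w : seq Z) (V fs : seq (seq Z)) : seq (seq Z) :=
  [seq v <- V | all (fun f => Z.leb 0 (zdot w f v)) fs].

(** A certificate that cones cover space: a node splits by the sign of a functional, nonnegative
    first, and a leaf lists some of the inequalities decided on the way to it. *)
Inductive tree := Leaf of seq (seq Z) | Node of seq Z & tree & tree.

Fixpoint leaves (t : tree) : seq (seq (seq Z)) :=
  match t with Leaf fs => [:: fs] | Node _ a b => leaves a ++ leaves b end.

Fixpoint tree_ok (path : seq (seq Z)) (t : tree) : bool :=
  match t with
  | Leaf fs => all (fun f => zmem f path) fs
  | Node f a b => tree_ok (f :: path) a && tree_ok (zneg f :: path) b
  end.

(** Sufficient for [X] to generate the whole cone [fs >= 0]: [X0] consists of antipodal pairs lying
    on all walls and serves as the lineality space, while each [f] has a vector [g] of [X] strictly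
    inside it and on the other walls. *)
Definition leaf_ok (n : nat) (w : seq Z) (V fs : seq (seq Z)) : bool :=
  let X := zpart w V fs in
  let X0 := [seq v <- X | all (fun f => Z.eqb 0 (zdot w f v)) fs && zmem (zneg v) X] in
  zfull n w (X0 ++ fs) &&
  all (fun f => has (fun g => Z.ltb 0 (zdot w f g) &&
    all (fun f' => zeqv f f' || Z.eqb 0 (zdot w f' g)) fs) X) fs.

Definition sep_ok (w : seq Z) (X Y : seq (seq Z)) (l : seq Z) : bool :=
  let side (U W : seq (seq Z)) (l : seq Z) := zall (fun v => let c := zdot w l v in
    if Z.ltb 0 c then true else if Z.eqb 0 c then zmem v W else false) U in
  side X Y l && side Y X (zneg l).

(** The alternatives of [reducible_pair], with the search pruned: if [s - u] has the same norm as
    [u], then [s.s = 2 u.s], and triples are sought only among vectors with large product with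
    [s]. *)
Definition reducible_ok (w : seq Z) (nn : Z) (X : seq (seq Z)) (x y : seq Z) : bool :=
  let s := zadd x y in
  if Z.eqb (2 * zdot w x y) nn then true else if znull s then true else
  if zmem s X then true else
  if zhas (fun u => if Z.eqb (zdot w s s) (2 * zdot w u s) then
      [&& ~~ zeqv u x, ~~ zeqv u y & zmem (zsub s u) X] else false) X then true else
  let C := [seq u <- X | Z.leb nn (zdot w u s)] in
  zhas (fun u => zhas (fun u' => zmem (zsub (zsub (zadd s s) u) u') X) C) C.

Fixpoint edges_ok (w : seq Z) (nn : Z) (X Y : seq (seq Z)) : bool :=
  if Y is y :: Y' then zall (reducible_ok w nn X y) Y' && edges_ok w nn X Y' else true.

(** Integer division stands for the true quotient; [reflect_ok] checks that it is exact. *)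
Definition zreflect (w a v : seq Z) : seq Z :=
  zcomb 1 v (Z.opp (Z.div (2 * zdot w v a) (zdot w a a))) a.

Definition reflect_ok (w : seq Z) (Al X : seq (seq Z)) : bool :=
  all (fun a => all (fun v =>
    Z.eqb (Z.mul (Z.div (2 * zdot w v a) (zdot w a a)) (zdot w a a)) (2 * zdot w v a) &&
    zmem (zreflect w a v) X) X) Al.

Definition zdominant (w : seq Z) (Al : seq (seq Z)) (v : seq Z) : bool :=
  all (fun a => Z.leb 0 (zdot w a v)) Al.

Definition spread (w : seq Z) (K : seq (seq Z)) : bool :=
  has (fun x => has (fun y => ~~ parallel w x y) K) K.

(* k = (m, c) represents the functional m / c. *)
Definition bad_functional (n : nat) (w : seq Z) (nn : Z) (X Y : seq (seq Z)) (k : seq Z) : bool :=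
  let m := take n k in let c := nth Z0 k n in
  let tight v := Z.eqb (zdot w m v) (c * nn) in
  if Z.eqb 0 c then true else
  if zhas (fun v => Z.ltb (c * c * nn) (c * zdot w m v)) (X ++ Y) then true else
  if ~~ zhas (fun v => if tight v then ~~ zmem v X else false) Y then true else
  spread w (zkernel n w [seq v <- X | if tight v then zmem v Y else false]).

(** A candidate [S] is refuted if it spans too little, or if for each tight [u] in [U] the system
    leaves at most one functional and that one is bad. The flag in [S] tells whether the value is 1
    or 0; values are made homogeneous by an extra unknown with coefficient [- nn]. *)
Definition refute_ok (n : nat) (w : seq Z) (nn : Z) (X Y : seq (seq Z))
    (U : seq (seq Z)) (S : seq (seq Z * bool)) : bool :=
  if spread w (zkernel n w (map fst S)) then true else
  all (fun u =>
    match zkernel n.+1 (rcons w 1)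
      (rcons u (Z.opp nn) :: [seq rcons s.1 (if s.2 then Z.opp nn else 0) | s <- S]) with
    | [::] => true
    | [:: k] => bad_functional n w nn X Y k
    | _ => false
    end) U.

(** Only dominant common vectors and simple roots enter, so all sublists can be tried. *)
Definition coplanar_ok (n : nat) (w : seq Z) (nn : Z) (Al X Y : seq (seq Z)) : bool :=
  let V0 := [seq v <- X | zmem v Y && zdominant w Al v] in
  let U := [seq v <- X | ~~ zmem v Y && zdominant w Al v] in
  all (refute_ok n w nn X Y U)
    (subs ([seq (a, false) | a <- Al] ++ [seq (v, true) | v <- V0])).

(** [cf_tree], [cf_parts] and [cf_seps] certify covering and separation of the regions; [cf_simple]
    holds the reflections preserving them, and [cf_weight] is the vector [d] of
    [dominant_functional]. *)
Record config := Config {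
  cf_w : seq Z;
  cf_D : Z;
  cf_V : seq (seq Z);
  cf_tree : tree;
  cf_parts : seq (seq (seq Z));
  cf_seps : seq (seq Z);
  cf_simple : seq (seq Z);
  cf_weight : seq Z }.

Definition cf_nn (c : config) : Z := 2 * (cf_D c * cf_D c).

Definition cf_regions (c : config) : seq (seq (seq Z)) :=
  [seq zpart (cf_w c) (cf_V c) fs | fs <- cf_parts c].

Fixpoint pairs_ok (T : Type) (r : T -> T -> bool) (s : seq T) : bool :=
  if s is x :: s' then zall (r x) s' && pairs_ok r s' else true.

(** The tree may be finer than the regions: in [R5] each region is filled by two leaves, because the
    wall lacks antipodal pairs to span it. *)
Definition config_ok (n : nat) (c : config) : bool :=
  let w := cf_w c in let V := cf_V c in let nn := cf_nn c in
  let Rg := cf_regions c in let Al := cf_simple c in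
  [&& (size w == n) && all (Z.ltb 0) w && Z.ltb 0 (cf_D c),
      all (fun v => (size v == n) && Z.eqb (zdot w v v) nn) V, zuniq V,
      tree_ok [::] (cf_tree c),
      all (fun fs => [&& all (fun f => size f == n) fs, leaf_ok n w V fs &
        has (zsubset (zpart w V fs)) Rg]) (leaves (cf_tree c)),
      all (zfull n w) Rg,
      all (fun v => zhas (zmem v) Rg) V,
      all (fun X => edges_ok w nn X X && reflect_ok w Al X) Rg,
      all (fun a => (size a == n) && Z.ltb 0 (zdot w (cf_weight c) a)) Al,
      (size (cf_weight c) == n) && all (fun l => size l == n) (cf_seps c) &
      pairs_ok (fun X Y => zhas (sep_ok w X Y) (cf_seps c) && coplanar_ok n w nn Al X Y) Rg].

(** At scale [D = 2] the integer 2 encodes the coordinate 1, so that halves are integral. *)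
Definition zsigns : seq Z := [:: 2; -2].

Definition zphiD (m : nat) : seq (seq Z) :=
  [seq [seq (if k == ij.1 then st.1 else if k == ij.2 then st.2 else 0) | k <- iota 0 m]
    | ij <- [seq (i, j) | i <- iota 0 m, j <- [seq j <- iota 0 m | (i < j)%N]],
      st <- [seq (s, t) | s <- zsigns, t <- zsigns]].

Fixpoint zhalf (m : nat) (odd_minus : bool) : seq (seq Z) :=
  if m is m'.+1 then
    [seq 1 :: v | v <- zhalf m' odd_minus] ++ [seq -1 :: v | v <- zhalf m' (~~ odd_minus)]
  else if odd_minus then [::] else [:: [::]].

Definition zA : seq (seq Z) :=
  [seq [seq (if k == i then s else 0) | k <- iota 0 4] | i <- iota 0 4, s <- zsigns].

Definition zlayer (X : seq (seq Z)) (t : Z) : seq (seq Z) := [seq rcons x t | x <- X].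

(** The factor [aa] clears the denominator of the reflection and multiplies the scale [D]; it is 5
    for [zones] and 6 for [zmirror], whence the scales 10 and 12. *)
Definition zfold (w : seq Z) (V : seq (seq Z)) (a : seq Z) : seq (seq Z) :=
  let aa := zdot w a a in
  [seq map (Z.mul aa) v | v <- V & Z.leb 0 (zdot w v a)] ++
  [seq zcomb aa v (Z.opp (2 * zdot w v a)) a | v <- V & Z.ltb 0 (zdot w v a)].

Definition w5 : seq Z := nseq 5 1.
(** The weight 3 absorbs the root in the sines of the hexagon, and the weight 2 of [w7] the square
    root of 2 in the last coordinate. *)
Definition w6 : seq Z := [:: 1; 1; 1; 1; 1; 3].
Definition w7 : seq Z := [:: 1; 1; 1; 1; 1; 1; 2].
Definition zL5 := zlayer (zphiD 4) 0 ++ zlayer zA 2 ++ zlayer (zhalf 4 true) (-2).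
Definition zhex : seq (Z * Z) := [:: (2, 0); (1, 1); (-1, 1); (-2, 0); (-1, -1); (1, -1)].
Definition zX6 (c : seq (seq (seq Z))) : seq (seq Z) :=
  zlayer (zlayer (zphiD 4) 0) 0 ++
  flatten [seq zlayer (zlayer p.1 p.2.1) p.2.2 | p <- zip c zhex].
Definition zD6A1 := zlayer (zphiD 6) 0 ++ [:: rcons (nseq 6 0) 2; rcons (nseq 6 0) (-2)].
Definition zE7 := zD6A1 ++ zlayer (zhalf 6 false) 1 ++ zlayer (zhalf 6 false) (-1).
Definition zC7b := zD6A1 ++ zlayer (zhalf 6 false) 1 ++ zlayer (zhalf 6 true) (-1).
Definition zones : seq Z := nseq 5 1.
Definition ze5 : seq Z := [:: 0; 0; 0; 0; 1].
(* 5 times the reflection of ze5 in zones *)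
Definition ze5' : seq Z := [:: -2; -2; -2; -2; 3].
Definition zmirror : seq Z := [:: 2; 0; 0; 0; 0; 0; 1].
Definition ze7 : seq Z := rcons (nseq 6 0) 1.
(* 3 times the reflection of ze7 in the mirror *)
Definition ze7' : seq Z := [:: -4; 0; 0; 0; 0; 0; 1].

(** Direction [k] of the hexagon turned by a right angle; the factor 3 compensates the weight.
    Opposite walls are exact negatives, which [tree_ok] uses, and the remainder admits the index
    6. *)
Definition zwall (k : nat) : seq Z :=
  let p := nth (0, 0) zhex (k %% 6) in [:: 0; 0; 0; 0; -3 * p.2; p.1].
Definition zsector (ij : nat * nat) : seq (seq Z) := [:: zwall ij.1; zneg (zwall ij.2)].
Definition zsector_leaf (i j : nat) : tree := Leaf (zsector (i, j)).
(** Walls separate neighboring sectors; the directions of [zhex] separate sectors that share only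
    the layer of [PhiD R 4]. *)
Definition hex_seps : seq (seq Z) :=
  [seq zwall k | k <- iota 0 6] ++ [seq [:: 0; 0; 0; 0; p.1; p.2] | p <- zhex].

Definition halves (f : seq Z) : seq (seq (seq Z)) := [:: [:: f]; [:: zneg f]].
Definition half_tree (f : seq Z) : tree := Node f (Leaf [:: f]) (Leaf [:: zneg f]).

Definition zroot (n i j : nat) (e : Z) : seq Z :=
  [seq (if k == i then 1 else if k == j then e else 0) | k <- iota 0 n].
Definition simpleD (n i m : nat) : seq (seq Z) :=
  rcons [seq zroot n k k.+1 (-1) | k <- iota i m.-1] (zroot n (i + m).-2 (i + m).-1 1).
Definition simpleA (n m : nat) : seq (seq Z) := [seq zroot n k k.+1 (-1) | k <- iota 0 m].
(** Half the sum of the positive roots of [D_m]: its product with every simple root is 1. *)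
Definition zdesc (n i m : nat) : seq Z :=
  [seq (if (i <= k < i + m)%N then Z.of_nat (i + m - k).-1 else 0) | k <- iota 0 n].

Let zB := zhalf 4 false.
Let zC := zhalf 4 true.

(** The empty list of walls makes [V] the only region. The tree still cuts once, since the antipodal
    pairs of [L5] span only its equator; the weight [w] is a placeholder of the right length. *)
Definition convex_config w V f := Config w 2 V (half_tree f) [:: [::]] [::] [::] w.

Definition the_config (c : configuration) : config :=
  match c with
  | D5 => convex_config w5 (zphiD 5) ze5
  | L5 => convex_config w5 zL5 ze5
  | Q5 => Config w5 10 (zfold w5 (zphiD 5) zones) (half_tree zones) (halves zones) [:: zones]
            (simpleA 5 4) (zdesc 5 0 5)
  | R5 => Config w5 10 (zfold w5 zL5 zones)
            (Node zones (Node ze5 (Leaf [:: zones; ze5]) (Leaf [:: zones; zneg ze5]))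
              (Node ze5' (Leaf [:: zneg zones; ze5']) (Leaf [:: zneg zones; zneg ze5'])))
            (halves zones) [:: zones]
            (simpleA 5 3) (zdesc 5 0 4)
  | E6 => convex_config w6 (zX6 [:: zA; zB; zC; zA; zB; zC]) [:: 0; 0; 0; 0; 0; 1]
  | C6_72b => Config w6 2 (zX6 [:: zA; zB; zC; zA; zC; zB]) (half_tree (zwall 0)) (halves (zwall 0))
            [:: zwall 0] (simpleD 6 0 4) (zdesc 6 0 4)
  | C6_72c => Config w6 2 (zX6 [:: zA; zB; zA; zB; zA; zB])
            (Node (zwall 0)
              (Node (zwall 1) (Node (zwall 2) (zsector_leaf 2 3) (zsector_leaf 1 2)) (zsector_leaf 0 1))
              (Node (zwall 4) (Node (zwall 5) (zsector_leaf 5 6) (zsector_leaf 4 5)) (zsector_leaf 3 4)))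
            (map zsector [:: (0, 1); (1, 2); (2, 3); (3, 4); (4, 5); (5, 6)]%N)
            hex_seps (simpleD 6 0 4) (zdesc 6 0 4)
  | C6_72d => Config w6 2 (zX6 [:: zA; zB; zA; zB; zA; zC])
            (Node (zwall 2) (Node (zwall 3) (zsector_leaf 3 5) (zsector_leaf 2 3))
              (Node (zwall 1) (zsector_leaf 1 2) (zsector_leaf 5 1)))
            (map zsector [:: (1, 2); (2, 3); (3, 5); (5, 1)]%N)
            hex_seps (simpleD 6 0 4) (zdesc 6 0 4)
  | E7 => convex_config w7 zE7 ze7
  | C7_126b => Config w7 2 zC7b (half_tree ze7) (halves ze7) [:: ze7] (simpleD 7 0 6) (zdesc 7 0 6)
  | C7_126c => Config w7 12 (zfold w7 zE7 zmirror) (half_tree zmirror) (halves zmirror) [:: zmirror]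
            (simpleD 7 1 5) (zdesc 7 1 5)
  | C7_126d => Config w7 12 (zfold w7 zC7b zmirror)
            (Node zmirror
              (Node ze7 (Leaf [:: zmirror; ze7]) (Leaf [:: zmirror; zneg ze7]))
              (Node ze7' (Leaf [:: zneg zmirror; ze7']) (Leaf [:: zneg zmirror; zneg ze7'])))
            [:: [:: zmirror; ze7]; [:: zmirror; zneg ze7]; [:: zneg zmirror; ze7']; [:: zneg zmirror; zneg ze7']]
            [:: ze7; zmirror; ze7'; [:: 1; 0; 0; 0; 0; 0; 1]; [:: 1; 0; 0; 0; 0; 0; 0]]
            (simpleD 7 1 5) (zdesc 7 1 5)
  end.

End IntegerVectors.

(** * Integer linear algebra *)

Section ZtoR.
Context {R : realType}.

Definition zr (z : Z) : R := (int_of_Z z)%:~R.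

Lemma zrD a b : zr (Z.add a b) = zr a + zr b.
Proof. by rewrite /zr (_ : Z.add a b = (a + b)%R) // rmorphD /= intrD. Qed.

Lemma zrM a b : zr (Z.mul a b) = zr a * zr b.
Proof. by rewrite /zr (_ : Z.mul a b = (a * b)%R) // rmorphM /= intrM. Qed.

Lemma zrN a : zr (Z.opp a) = - zr a.
Proof. by rewrite /zr (_ : Z.opp a = (- a)%R) // rmorphN /= mulrNz. Qed.

Lemma zrB a b : zr (Z.sub a b) = zr a - zr b.
Proof. by rewrite -zrN -zrD. Qed.

Lemma zr0 : zr Z0 = 0. Proof. by []. Qed.
Lemma zr1 : zr (Zpos xH) = 1. Proof. by []. Qed.
Lemma zr2 : zr (Zpos (xO xH)) = 2. Proof. by []. Qed.

Lemma zr_le a b : (zr a <= zr b) = Z.leb a b.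
Proof. by rewrite /zr ler_int; apply/idP/idP; lia. Qed.

Lemma zr_lt a b : (zr a < zr b) = Z.ltb a b.
Proof. by rewrite /zr ltr_int; apply/idP/idP; lia. Qed.

Lemma zr_eq a b : (zr a == zr b) = Z.eqb a b.
Proof. by rewrite eq_le !zr_le; apply/idP/idP; lia. Qed.

Lemma zr_inj : injective zr.
Proof. by move=> a b /eqP; rewrite zr_eq => /Z.eqb_eq. Qed.

End ZtoR.

Lemma zhasE (T : Type) (p : T -> bool) s : zhas p s = has p s.
Proof. by elim: s => //= x s ->; case: (p x). Qed.

Lemma zallE (T : Type) (p : T -> bool) s : zall p s = all p s.
Proof. by elim: s => //= x s ->; case: (p x). Qed.

Lemma zeqvP x y : reflect (x = y) (zeqv x y).
Proof.
elim: x y => [|a x IH] [|b y] /=; try by constructor.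
case: (Z.eqb_spec a b) => [->|ab]; last by constructor; case.
by apply: (iffP (IH y)) => [->|[]].
Qed.

Lemma zmemE x X : zmem x X = (x \in X).
Proof.
rewrite /zmem zhasE; elim: X => //= y X ->; rewrite inE; congr (_ || _).
exact/zeqvP/eqP.
Qed.

Lemma zuniqP X : zuniq X -> uniq X.
Proof. by elim: X => //= x X IH /andP[]; rewrite zmemE => -> /IH. Qed.

Lemma zdotC w x y : zdot w x y = zdot w y x.
Proof. elim: w x y => [|a w IH] [|b x] [|c y] //=; rewrite IH; lia. Qed.

Lemma pairs_okP (T : eqType) (r : T -> T -> bool) s x y : pairs_ok r s ->
  x \in s -> y \in s -> x <> y -> r x y \/ r y x.
Proof.
elim: s => //= z s IH /andP[]; rewrite zallE => /allP h ok.
rewrite !inE => /orP[/eqP ->|xs] /orP[/eqP ->|ys] // xy.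
- by left; exact: h.
- by right; exact: h.
- exact: IH.
Qed.

Lemma edges_okP w nn X Y x y : edges_ok w nn X Y -> x \in Y -> y \in Y -> x <> y ->
  reducible_ok w nn X x y \/ reducible_ok w nn X y x.
Proof.
elim: Y => //= z s IH /andP[]; rewrite zallE => /allP h ok.
rewrite !inE => /orP[/eqP ->|xs] /orP[/eqP ->|ys] // xy.
- by left; exact: h.
- by right; exact: h.
- exact: IH.
Qed.

Section Kernel.
Context {R : realType} (N : nat) (w : seq Z).
Hypothesis sw : size w = N.
Implicit Types (x y r k : seq Z) (f : nat -> R).

Definition zvec x : 'rV[R]_N := \row_i zr (nth Z0 x i).

Definition rdot x f : R := \sum_(i < N) zr (nth Z0 w i) * (zr (nth Z0 x i) * f i).

Lemma zdotE x y : zr (zdot w x y) = rdot x (fun i => zr (nth Z0 y i)).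
Proof.
rewrite /rdot -sw; elim: w x y => [|a u IH] [|b x] [|c y] /=; rewrite ?big_ord0 //.
1-3: by rewrite big1 ?zr0 // => i _; rewrite ?nth_nil ?zr0 ?(mul0r, mulr0).
by rewrite big_ord_recl /= zrD !zrM IH.
Qed.

Lemma size_zcomb a x b y : size x = N -> size y = N -> size (zcomb a x b y) = N.
Proof. by move=> sx sy; rewrite size_map size_zip sx sy minnn. Qed.

Lemma nth_zcomb a x b y i : size x = size y ->
  nth Z0 (zcomb a x b y) i = Z.add (Z.mul a (nth Z0 x i)) (Z.mul b (nth Z0 y i)).
Proof.
move=> sxy; case: (ltnP i (size x)) => ix.
  by rewrite (nth_map (Z0, Z0)) ?size_zip ?sxy ?minnn -?sxy // nth_zip.
rewrite !nth_default ?size_map ?size_zip -?sxy ?minnn //; lia.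
Qed.

Lemma zvec_zcomb a x b y : size x = size y ->
  zvec (zcomb a x b y) = zr a *: zvec x + zr b *: zvec y.
Proof. by move=> sxy; apply/rowP => i; rewrite !mxE nth_zcomb // zrD !zrM. Qed.

Lemma zdot_zcomb r a x b y : size x = size y ->
  zdot w r (zcomb a x b y) = Z.add (Z.mul a (zdot w r x)) (Z.mul b (zdot w r y)).
Proof.
move=> sxy; apply: (@zr_inj R); rewrite zrD !zrM !zdotE /rdot !mulr_sumr -big_split.
by apply: eq_bigr => i _ /=; rewrite nth_zcomb // zrD !zrM; ring.
Qed.

Lemma kstep_size K r : all (fun k => size k == N) K -> all (fun k => size k == N) (kstep w K r).
Proof.
move=> /allP sK; rewrite /kstep; case E: [seq _ <- K | _] => [|k0 K']; first exact/allP.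
have k0K : k0 \in K.
  have : k0 \in [seq k <- K | ~~ Z.eqb Z0 (zdot w r k)] by rewrite E mem_head.
  by rewrite mem_filter => /andP[].
apply/allP => k; rewrite mem_filter => /andP[_ /mapP[k' k'K ->]].
case: ifP => _; first exact: sK.
by apply/eqP/size_zcomb; apply/eqP; exact: sK.
Qed.

Lemma kstep_sound K r r' : all (fun k => size k == N) K ->
  (forall k, k \in K -> zdot w r' k = Z0) \/ r' = r ->
  forall k, k \in kstep w K r -> zdot w r' k = Z0.
Proof.
move=> /allP sK h k; rewrite /kstep; case E: [seq _ <- K | _] => [|k0 K'].
  case: h => [h /h //|-> kK]; have : k \notin [seq k <- K | ~~ Z.eqb Z0 (zdot w r k)] by rewrite E.
  by rewrite mem_filter kK andbT negbK => /Z.eqb_eq.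
have k0K : k0 \in K.
  have : k0 \in [seq k <- K | ~~ Z.eqb Z0 (zdot w r k)] by rewrite E mem_head.
  by rewrite mem_filter => /andP[].
rewrite mem_filter => /andP[_ /mapP[k' k'K ->]].
case: ifP => [/Z.eqb_eq c0|_]; first by case: h => [/(_ _ k'K)|->].
rewrite zdot_zcomb; last by rewrite (eqP (sK _ k'K)) (eqP (sK _ k0K)).
case: h => [h|->]; first by rewrite !h // !Z.mul_0_r.
by rewrite Z.mul_opp_l (Z.mul_comm (zdot w r k')) Z.add_opp_diag_r.
Qed.

Lemma rdot_zvec x (K : seq (seq Z)) (c : 'rV[R]_N -> R) f :
  (forall i : 'I_N, f i = \sum_(v <- map zvec K) c v * v 0 i) ->
  rdot x f = \sum_(v <- map zvec K) c v * \sum_(i < N) zr (nth Z0 w i) * (zr (nth Z0 x i) * v 0 i).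
Proof.
move=> fE; rewrite /rdot; under eq_bigr => i _ do rewrite fE !mulr_sumr.
rewrite exchange_big; apply: eq_bigr => v _ /=; rewrite mulr_sumr.
by apply: eq_bigr => i _; ring.
Qed.

(** Every generator is corrected by a multiple of the pivot so as to satisfy the new equation; in
    the expansion of the solution [f] the corrections add up to [rdot r f], up to a factor, hence
    cancel. *)
Lemma kstep_complete K r f : all (fun k => size k == N) K -> rdot r f = 0 ->
  (\row_(i < N) f i) \in <<map zvec K>>%VS ->
  (\row_(i < N) f i) \in <<map zvec (kstep w K r)>>%VS.
Proof.
move=> /allP sK rf /inspanE[c fE]; rewrite /kstep.
case E: [seq _ <- K | _] => [|k0 K']; first by apply/inspanE; exists c.
have k0F : k0 \in [seq k <- K | ~~ Z.eqb Z0 (zdot w r k)] by rewrite E mem_head.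
have [r0 k0K] : ~~ Z.eqb Z0 (zdot w r k0) /\ k0 \in K.
  by move: k0F; rewrite mem_filter => /andP[].
set c0 := zdot w r k0 in r0 *.
have c00 : zr c0 != 0 :> R by rewrite -zr0 zr_eq Z.eqb_sym.
set K1 := [seq k <- _ | ~~ znull k].
have fE' (i : 'I_N) : f i = \sum_(v <- map zvec K) c v * v 0 i.
  have /rowP/(_ i) := fE; rewrite mxE => ->; rewrite summxE.
  by apply: eq_bigr => v _; rewrite mxE.
pose val (v : 'rV[R]_N) := \sum_(i < N) zr (nth Z0 w i) * (zr (nth Z0 r i) * v 0 i).
have valE k : val (zvec k) = zr (zdot w r k).
  by rewrite zdotE /val; apply: eq_bigr => i _; rewrite mxE.
have vs : \sum_(v <- map zvec K) c v * val v = 0 by rewrite -(rdot_zvec r fE').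
have -> : \row_i f i = \sum_(v <- map zvec K) c v *: (v - (val v / zr c0) *: zvec k0).
  rewrite fE; under [RHS]eq_bigr => v _ do rewrite scalerBr.
  rewrite sumrB (_ : \sum_(v <- _) _ *: (_ *: zvec k0) = 0) ?subr0 //.
  under eq_bigr => v _ do rewrite scalerA mulrA.
  by rewrite -scaler_suml -mulr_suml vs mul0r scale0r.
rewrite big_seq; apply: memv_suml => v /mapP[k kK ->]; apply: memvZ.
rewrite valE; set ck := zdot w r k.
have inK1 k' : k' \in [seq (if Z.eqb Z0 (zdot w r k) then k
      else zcomb c0 k (Z.opp (zdot w r k)) k0) | k <- K] -> zvec k' \in <<map zvec K1>>%VS.
  move=> k'K; have [nk|nk] := boolP (znull k'); last first.
    by apply/memv_span/map_f; rewrite mem_filter nk.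
  have -> : zvec k' = 0; last by rewrite mem0v.
  apply/rowP => i; rewrite !mxE; move: nk; rewrite /znull zallE => /allP nk.
  case: (ltnP i (size k')) => ik; last by rewrite nth_default.
  by have := nk _ (mem_nth Z0 ik) => /Z.eqb_eq <-.
have [ck0|ck0] := boolP (Z.eqb Z0 ck).
  have -> : zr ck = 0 :> R by move/Z.eqb_eq: ck0 => <-.
  rewrite mul0r scale0r subr0; apply: inK1.
  by apply/mapP; exists k; rewrite // -/ck ck0.
have -> : zvec k - (zr ck / zr c0) *: zvec k0 = (zr c0)^-1 *: zvec (zcomb c0 k (Z.opp ck) k0).
  rewrite zvec_zcomb; last by rewrite (eqP (sK _ kK)) (eqP (sK _ k0K)).
  by rewrite scalerDr !scalerA mulVf // scale1r zrN mulrN scaleNr (mulrC (zr c0)^-1).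
by apply/memvZ/inK1; apply/mapP; exists k; rewrite // -/ck (negPf ck0).
Qed.

Lemma zunits_size : all (fun k => size k == N) (zunits N).
Proof. by apply/allP => k /mapP[i _ ->]; rewrite size_map size_iota. Qed.

Lemma zunits_complete (v : 'rV[R]_N) : v \in <<map zvec (zunits N)>>%VS.
Proof.
have -> : v = \sum_i v 0 i *: zvec [seq (if i == j :> nat then Zpos xH else Z0) | j <- iota 0 N].
  apply/rowP => j; rewrite summxE (bigD1 j) //= !mxE (nth_map 0%N) ?size_iota // nth_iota //.
  rewrite eqxx mulr1 big1 ?addr0 // => i ij.
  rewrite !mxE (nth_map 0%N) ?size_iota // nth_iota // add0n ifF ?mulr0 //.
  by apply/negP => /eqP/val_inj e; rewrite e eqxx in ij.
apply: memv_suml => i _; apply/memvZ/memv_span/map_f/mapP; exists (i : nat) => //.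
by rewrite mem_iota /=.
Qed.

Lemma zkernel_complete rows f : (forall r, r \in rows -> rdot r f = 0) ->
  (\row_(i < N) f i) \in <<map zvec (zkernel N w rows)>>%VS.
Proof.
rewrite /zkernel; move: (zunits N) zunits_size (zunits_complete (\row_(i < N) f i)).
elim: rows => //= r rows IH K sK fK h; apply: IH; first exact: kstep_size.
  by apply: kstep_complete => //; apply: h; rewrite mem_head.
by move=> r' r'r; apply: h; rewrite inE r'r orbT.
Qed.

Lemma zkernel_sound rows k r : k \in zkernel N w rows -> r \in rows ->
  size k = N /\ zdot w r k = Z0.
Proof.
rewrite /zkernel; move: (zunits N) zunits_size => K sK kK rR.
have : all (fun k => size k == N) (foldl (kstep w) K rows).
  by elim: (rows) K sK {kK} => //= r' rows' IH K /kstep_size sK; exact: IH.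
move=> /allP/(_ k kK)/eqP sk; split=> //; move: rR.
suff H : forall r, r \in rows \/ (forall k, k \in K -> zdot w r k = Z0) -> zdot w r k = Z0.
  by move=> rR; apply: H; left.
elim: rows K sK kK => /= [|r' rows IH] K sK kK r1 [] //; first by apply.
  rewrite inE => /orP[/eqP ->|rr]; apply: (IH _ (kstep_size r' sK) kK); last by left.
  by right; apply: kstep_sound => //; right.
by move=> h; apply: (IH _ (kstep_size r' sK) kK); right; apply: kstep_sound => //; left.
Qed.

End Kernel.

(** * From integer conditions to regions *)

Section Vec.
Context {R : realType} (n : nat) (w : seq Z) (D : Z).
Hypothesis sw : size w = n.
Hypothesis wpos : all (Z.ltb Z0) w.
Hypothesis Dpos : Z.ltb Z0 D.
Implicit Types (x y v u : seq Z) (X Y V : seq (seq Z)).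

(** Arbitrary real coordinates in the scaling of [vec], so that a real functional can be confronted
    with integer rows through [rdot]. *)
Definition vec_of (f : nat -> R) : 'rV[R]_n :=
  \row_i (f i * Num.sqrt (zr (nth Z0 w i)) / (zr D * Num.sqrt 2)).

Definition vec x : 'rV[R]_n := vec_of (fun i => zr (nth Z0 x i)).

Let nn : Z := Z.mul (Zpos (xO xH)) (Z.mul D D).

Let D0 : 0 < zr D :> R. Proof. by rewrite -zr0 zr_lt. Qed.
Let s0 : 0 < Num.sqrt 2 :> R. Proof. by rewrite sqrtr_gt0. Qed.
Let w0 (i : 'I_n) : 0 < zr (nth Z0 w i) :> R.
Proof. by rewrite -zr0 zr_lt; move/allP: wpos; apply; rewrite mem_nth // sw. Qed.
Let sg0 (i : 'I_n) : 0 < Num.sqrt (zr (nth Z0 w i)) :> R.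
Proof. by rewrite sqrtr_gt0. Qed.
Let nn0 : 0 < zr nn :> R.
Proof. by rewrite /nn !zrM zr2 !mulr_gt0. Qed.

Lemma dot_vec_of (f : nat -> R) x : dot (vec_of f) (vec x) = rdot n w x f / zr nn.
Proof.
rewrite /dot /rdot mulr_suml; apply: eq_bigr => i _; rewrite !mxE /nn !zrM zr2.
have e2 : Num.sqrt 2 * Num.sqrt 2 = 2 :> R by rewrite -expr2 sqr_sqrtr.
have ew : Num.sqrt (zr (nth Z0 w i)) * Num.sqrt (zr (nth Z0 w i)) = zr (nth Z0 w i) :> R.
  by rewrite -expr2 sqr_sqrtr // ltW.
have -> : 2 * (zr D * zr D) = Num.sqrt 2 * Num.sqrt 2 * (zr D * zr D) :> R by rewrite e2.
rewrite -[in RHS]ew.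
by field; rewrite !lt0r_neq0.
Qed.

Lemma dot_vec x y : dot (vec x) (vec y) = zr (zdot w x y) / zr nn.
Proof. by rewrite zdotC (zdotE sw) dot_vec_of. Qed.

Lemma vec_ofP (m : 'rV[R]_n) : exists f, m = vec_of f.
Proof.
exists (fun i => if insub i is Some j then
  m 0 j * (zr D * Num.sqrt 2) / Num.sqrt (zr (nth Z0 w i)) else 0).
by apply/rowP => i; rewrite mxE valK; field; rewrite !lt0r_neq0.
Qed.

Lemma vec_inj x y : size x = n -> size y = n -> vec x = vec y -> x = y.
Proof.
move=> sx sy e; apply: (@eq_from_nth _ Z0); rewrite sx // => i ni.
have /rowP/(_ (Ordinal ni)) := e; rewrite !mxE /= => h.
have := sg0 (Ordinal ni) => /= g; apply: (@zr_inj R).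
apply: (mulIf (lt0r_neq0 g)).
by move/divIf: h; apply; rewrite mulf_neq0 // gt_eqF.
Qed.

Lemma vec_zcomb a x b y : size x = n -> size y = n ->
  vec (zcomb a x b y) = zr a *: vec x + zr b *: vec y.
Proof.
by move=> sx sy; apply/rowP => i; rewrite !mxE (nth_zcomb sw) ?sx // zrD !zrM; ring.
Qed.

Lemma nth_zip_map (op : Z -> Z -> Z) x y i : size x = n -> size y = n -> (i < n)%N ->
  nth Z0 [seq op p.1 p.2 | p <- zip x y] i = op (nth Z0 x i) (nth Z0 y i).
Proof.
move=> sx sy ni; rewrite (nth_map (Z0, Z0)) ?size_zip ?sx ?sy ?minnn //.
by rewrite nth_zip ?sx.
Qed.

Lemma vec_zadd x y : size x = n -> size y = n -> vec (zadd x y) = vec x + vec y.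
Proof. by move=> sx sy; apply/rowP => i; rewrite !mxE nth_zip_map // zrD; ring. Qed.

Lemma vec_zsub x y : size x = n -> size y = n -> vec (zsub x y) = vec x - vec y.
Proof. by move=> sx sy; apply/rowP => i; rewrite !mxE nth_zip_map // zrB; ring. Qed.

Lemma size_zip_map (op : Z -> Z -> Z) x y : size x = n -> size y = n ->
  size [seq op p.1 p.2 | p <- zip x y] = n.
Proof. by move=> sx sy; rewrite size_map size_zip sx sy minnn. Qed.

Lemma vec_zneg x : size x = n -> vec (zneg x) = - vec x.
Proof. by move=> sx; apply/rowP => i; rewrite !mxE (nth_map Z0) ?sx // zrN; ring. Qed.

Lemma vec_znull x : znull x -> vec x = 0.
Proof.
rewrite /znull zallE => /allP nx; apply/rowP => i; rewrite !mxE.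
case: (ltnP i (size x)) => ix; last by rewrite nth_default // zr0 !mul0r.
by have := nx _ (mem_nth Z0 ix) => /Z.eqb_eq <-; rewrite zr0 !mul0r.
Qed.

Definition sized X := forall x, x \in X -> size x = n.

Lemma vec_mem x X : size x = n -> sized X -> (vec x \in map vec X) = (x \in X).
Proof.
move=> sx sX; apply/mapP/idP => [[y yX e]|xX]; last by exists x.
by rewrite (vec_inj sx (sX y yX) e).
Qed.

Lemma sizedF X (p : pred (seq Z)) : sized X -> sized [seq x <- X | p x].
Proof. by move=> sX x; rewrite mem_filter => /andP[_ /sX]. Qed.

Lemma vec_uniq X : sized X -> uniq X -> uniq (map vec X).
Proof.
move=> sX uX; rewrite map_inj_in_uniq // => x y xX yX; exact: vec_inj (sX x xX) (sX y yX).
Qed.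

Lemma dot_vec_ge0 x y : (0 <= dot (vec x) (vec y)) = Z.leb Z0 (zdot w x y).
Proof. by rewrite dot_vec pmulr_lge0 ?invr_gt0 // -zr0 zr_le. Qed.

Lemma dot_vec_gt0 x y : (0 < dot (vec x) (vec y)) = Z.ltb Z0 (zdot w x y).
Proof. by rewrite dot_vec pmulr_lgt0 ?invr_gt0 // -zr0 zr_lt. Qed.

Lemma dot_vec_eq0 x y : (dot (vec x) (vec y) == 0) = Z.eqb Z0 (zdot w x y).
Proof. by rewrite dot_vec mulf_eq0 invr_eq0 (gt_eqF nn0) orbF -zr0 zr_eq Z.eqb_sym. Qed.

Lemma dot_vec_eq1 x y : (dot (vec x) (vec y) == 1) = Z.eqb (zdot w x y) nn.
Proof.
rewrite dot_vec -(divff (lt0r_neq0 nn0)) -(@zr_eq R); apply/eqP/eqP => [/divIf|->//].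
by apply; rewrite lt0r_neq0.
Qed.

Lemma dot_vec_le1 x y : (dot (vec x) (vec y) <= 1) = Z.leb (zdot w x y) nn.
Proof. by rewrite dot_vec ler_pdivrMr // mul1r zr_le. Qed.

Lemma orth_vec X (f : nat -> R) : orth (map vec X) (vec_of f) <-> forall r, r \in X -> rdot n w r f = 0.
Proof.
split=> h.
  move=> r rX; have := h _ (map_f vec rX); rewrite dot_vec_of => /eqP.
  by rewrite mulf_eq0 invr_eq0 (gt_eqF nn0) orbF => /eqP.
by move=> v /mapP[r rX ->]; rewrite dot_vec_of h // mul0r.
Qed.

Lemma zfull_spans X : zfull n w X -> spans (map vec X).
Proof.
rewrite /zfull => /nilP K0 y; have [f ->] := vec_ofP y => /orth_vec h.
have := zkernel_complete sw h; rewrite K0 /= span_nil memv0 => /eqP/rowP f0.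
by apply/rowP => i; have := f0 i; rewrite !mxE => ->; rewrite !mul0r.
Qed.

Lemma spread_not_line X : spread w (zkernel n w X) -> ~ on_line (map vec X).
Proof.
rewrite /spread => /hasP[x xK /hasP[y yK]] npar [u hu].
have ok k : k \in zkernel n w X -> orth (map vec X) (vec k).
  move=> kK v /mapP[r rX ->]; rewrite dot_vec zdotC.
  by rewrite (zkernel_sound (R := R) sw kK rX).2 zr0 mul0r.
have [a xa] := hu _ (ok x xK); have [b yb] := hu _ (ok y yK).
case/negP: npar; rewrite /parallel -(@zr_eq R) !zrM.
have E p q : zr (zdot w p q) = dot (vec p) (vec q) * zr nn.
  by rewrite dot_vec divfK ?lt0r_neq0.
by rewrite !E xa yb !dotZl !dotZr; apply/eqP; ring.
Qed.

(** Multiples of the vectors [g] remove the values of [x] on the walls one by one. The remainder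
    vanishes on all [fs], hence lies in the span of [X0], and antipodes take care of negative
    coefficients. *)
Lemma leaf_cover V fs (x : 'rV[R]_n) : sized V -> uniq V -> sized fs -> leaf_ok n w V fs ->
  (forall f, f \in fs -> 0 <= dot (vec f) x) -> incone (map vec (zpart w V fs)) x.
Proof.
move=> sV uV sfs /andP[]; set X := zpart w V fs; set X0 := seq.filter _ X => full /allP hg hx.
have sX : sized X by exact: sizedF.
have uX : uniq (map vec X) by apply: vec_uniq => //; exact: filter_uniq.
have fX0 f v : f \in fs -> v \in X0 -> dot (vec f) (vec v) = 0.
  move=> ff; rewrite mem_filter => /andP[/andP[/allP/(_ f ff) h _] _].
  by apply/eqP; rewrite dot_vec_eq0.
have reduce : forall fs' (y : 'rV[R]_n), {subset fs' <= fs} -> uniq fs' ->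
    (forall f, f \in fs -> 0 <= dot (vec f) y) ->
    (forall f, f \in fs -> f \notin fs' -> dot (vec f) y = 0) ->
    exists2 y' : 'rV[R]_n, (forall f, f \in fs -> dot (vec f) y' = 0) & incone (map vec X) (y - y').
  elim=> [|f fs' IH] y sub uf hy zy.
    by exists y; [move=> f ff; exact: zy|rewrite subrr; exact: incone0].
  have ff : f \in fs by apply: sub; rewrite mem_head.
  have /hasP[g gX /andP[fg /allP og]] := hg f ff.
  have fg0 : 0 < dot (vec f) (vec g) by rewrite dot_vec_gt0.
  have og' f' : f' \in fs -> f' <> f -> dot (vec f') (vec g) = 0.
    move=> f'f ne; have := og f' f'f => /orP[/zeqvP e|h]; first by case: ne.
    by apply/eqP; rewrite dot_vec_eq0.
  set c := dot (vec f) y / dot (vec f) (vec g).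
  have c0 : 0 <= c by rewrite divr_ge0 ?hy // ltW.
  have zf : dot (vec f) (y - c *: vec g) = 0.
    by rewrite dotBr dotZr /c divfK ?gt_eqF // subrr.
  move: uf => /= /andP[ffs' ufs'].
  have [|||y' zy' cy'] := IH (y - c *: vec g) _ ufs'.
  - by move=> f' f'f; apply: sub; rewrite inE f'f orbT.
  - move=> f' f'f; have [->|ne] := pselect (f' = f); first by rewrite zf.
    by rewrite dotBr dotZr (og' _ f'f ne) mulr0 subr0 hy.
  - move=> f' f'f nf'; have [->|ne] := pselect (f' = f); first exact: zf.
    rewrite dotBr dotZr (og' _ f'f ne) mulr0 subr0 zy // inE negb_or nf' andbT.
    exact/eqP.
  exists y' => //; have -> : y - y' = (y - c *: vec g - y') + c *: vec g.
    by rewrite addrAC subrK.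
  by apply: inconeD => //; apply: inconeZ => //; apply: incone_mem uX _; exact: map_f.
have [y zy cy] : exists2 y : 'rV[R]_n, (forall f, f \in fs -> dot (vec f) y = 0) &
    incone (map vec X) (x - y).
  apply: (reduce (undup fs)); rewrite ?undup_uniq //.
    by move=> f; rewrite mem_undup.
  by move=> f ff; rewrite mem_undup ff.
rewrite -[x](subrK y); apply: inconeD => //.
have sX0 : sized X0 by exact: sizedF.
have uX0 : uniq (map vec X0) by apply: vec_uniq => //; exact/filter_uniq/filter_uniq.
have ufs : uniq (map vec (undup fs)).
  by apply: vec_uniq; rewrite ?undup_uniq // => f; rewrite mem_undup; exact: sfs.
have [c yE] : inspan (map vec X0) y.
  apply: inspan_orthP => // z oz.
  have [z' [z'fs oz']] := proj_exists z ufs.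
  have -> : z = z'.
    apply/eqP; rewrite -subr_eq0; apply/eqP; apply: (zfull_spans full) => v.
    rewrite map_cat mem_cat => /orP[vX0|/mapP[f ff ->]]; last first.
      by apply: oz'; apply: map_f; rewrite mem_undup.
    rewrite dotBl oz // dotC (orth_inspan _ z'fs) ?subrr // => u /mapP[f].
    rewrite mem_undup => ff ->; move: vX0 => /mapP[v' v'X0 ->].
    by rewrite dotC fX0.
  rewrite dotC; apply: orth_inspan z'fs => u /mapP[f].
  by rewrite mem_undup => ff ->; rewrite dotC zy.
rewrite yE; apply: incone_sum_seq => v /mapP[z zX0 ->].
move: (zX0); rewrite mem_filter zmemE => /andP[/andP[_ nzX] zX].
have [c0|c0] := leP 0 (c (vec z)).
  by apply: inconeZ => //; apply: incone_mem uX _; exact: map_f.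
rewrite -[_ *: _]opprK -scalerN -scaleNr -vec_zneg ?sX //.
by apply: inconeZ; [rewrite oppr_ge0 ltW|apply: incone_mem uX _; exact: map_f].
Qed.

Lemma tree_cover t path (x : 'rV[R]_n) :
  (forall f, f \in path -> size f = n -> 0 <= dot (vec f) x) -> tree_ok path t ->
  all (all (fun f => size f == n)) (leaves t) ->
  exists2 fs, fs \in leaves t & forall f, f \in fs -> 0 <= dot (vec f) x.
Proof.
elim: t path => [fs|f a IHa b IHb] path hp /=.
  rewrite andbT => /allP fp /allP sfs; exists fs; rewrite ?mem_head // => f ff.
  by apply: hp; [rewrite -zmemE; exact: fp|apply/eqP; exact: sfs].
move=> /andP[ta tb]; rewrite all_cat => /andP[sa sb].
have [fx|fx] := leP 0 (dot (vec f) x).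
  have [|fs fsa h] := IHa (f :: path) _ ta sa; last by exists fs; rewrite // mem_cat fsa.
  by move=> g; rewrite inE => /orP[/eqP -> _|/hp].
have [|fs fsb h] := IHb (zneg f :: path) _ tb sb; last by exists fs; rewrite // mem_cat fsb orbT.
move=> g; rewrite inE => /orP[/eqP -> |/hp //]; rewrite size_map => sf.
by rewrite vec_zneg // dotNl oppr_ge0 ltW.
Qed.

Lemma sep_vec X Y l : sized X -> sized Y -> size l = n -> sep_ok w X Y l ->
  sep (map vec X) (map vec Y).
Proof.
move=> sX sY sl /andP[]; rewrite !zallE => /allP hX /allP hY.
have zdot_neg v : zdot w (zneg l) v = Z.opp (zdot w l v).
  have E p : zr (zdot w p v) = dot (vec p) (vec v) * zr nn by rewrite dot_vec divfK ?lt0r_neq0.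
  by apply: (@zr_inj R); rewrite zrN !E vec_zneg // dotNl mulNr.
have sideP (c : Z) (b : bool) : (if Z.ltb Z0 c then true else if Z.eqb Z0 c then b else false) ->
    Z.leb Z0 c /\ (Z.eqb Z0 c -> b).
  case: ifP => [c0 _|_]; first by split; lia.
  by case: ifP => // c0 ->; split=> //; lia.
exists (vec l); split=> v /mapP[x xX ->].
- by rewrite dot_vec_ge0; have [] := sideP _ _ (hX x xX).
- rewrite -oppr_ge0 -dotNl -vec_zneg // dot_vec_ge0.
  by have [] := sideP _ _ (hY x xX).
- move=> /eqP; rewrite dot_vec_eq0 => e; apply: map_f; rewrite -zmemE.
  by have [_ /(_ e)] := sideP _ _ (hX x xX).
- move=> /eqP; rewrite dot_vec_eq0 => e; apply: map_f; rewrite -zmemE.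
  have [_ ->] // := sideP _ _ (hY x xX); rewrite zdot_neg.
  by move/Z.eqb_eq: e => <-.
Qed.

Lemma reducible_vec X x y : sized X -> size x = n -> size y = n -> reducible_ok w nn X x y ->
  dot (vec x) (vec y) = 1 / 2 \/ reducible_pair (map vec X) (vec x) (vec y).
Proof.
move=> sX sx sy; rewrite /reducible_ok.
case: ifP => [/Z.eqb_eq e _|_].
  left; rewrite dot_vec -e zrM zr2.
  have e0 : zr (zdot w x y) != 0 :> R.
    by apply: contraTneq nn0 => z; rewrite -e zrM z mulr0 ltxx.
  by field.
have sxy : size (zadd x y) = n by exact: size_zip_map.
case: ifP => [/vec_znull e _|_].
  by right; apply: Or41; rewrite -vec_zadd.
case: ifP => [|_].
  by rewrite zmemE => h _; right; apply: Or42; rewrite -vec_zadd //; exact: map_f.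
case: ifP => [|_].
  rewrite zhasE => /hasP[u uX]; case: ifP => // _ /and3P[ux uy]; rewrite zmemE => u'X _.
  right; apply: Or43; exists (vec u), (vec (zsub (zadd x y) u)); split; try exact: map_f.
  - by move=> /(vec_inj (sX u uX) sx) e; case/negP: ux; apply/zeqvP.
  - by move=> /(vec_inj (sX u uX) sy) e; case/negP: uy; apply/zeqvP.
  - by rewrite vec_zsub ?(sX u) // vec_zadd // [RHS]addrC subrK.
rewrite zhasE => /hasP[u]; rewrite mem_filter => /andP[_ uX].
rewrite zhasE => /hasP[u']; rewrite mem_filter => /andP[_ u'X]; rewrite zmemE => u''X.
right; apply: Or44; exists (vec u), (vec u'), (vec (zsub (zsub (zadd (zadd x y) (zadd x y)) u) u')).
split; try exact: map_f.
have s2 : size (zadd (zadd x y) (zadd x y)) = n by exact: size_zip_map.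
have s3 : size (zsub (zadd (zadd x y) (zadd x y)) u) = n by apply: size_zip_map => //; exact: sX.
rewrite vec_zsub ?(sX u') // vec_zsub ?(sX u) // !vec_zadd //.
by rewrite scaler_nat mulr2n -[in RHS](addrA _ (- vec u)) -opprD [RHS]addrC subrK.
Qed.

Lemma reflection_vec a v : size a = n -> size v = n ->
  Z.eqb (Z.mul (Z.div (Z.mul (Zpos (xO xH)) (zdot w v a)) (zdot w a a)) (zdot w a a))
    (Z.mul (Zpos (xO xH)) (zdot w v a)) -> 0 < dot (vec a) (vec a) ->
  reflection (vec a) (vec v) = vec (zreflect w a v).
Proof.
move=> sa sv /Z.eqb_eq e a0; rewrite /reflection /zreflect vec_zcomb // zr1 scale1r zrN scaleNr.
congr (_ - _ *: _); rewrite !dot_vec.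
move: a0; rewrite dot_vec_gt0 => a0.
have za : zr (zdot w a a) != 0 :> R by rewrite gt_eqF // -zr0 zr_lt.
apply: (mulIf za); rewrite -zrM e zrM zr2.
by field; rewrite lt0r_neq0 //= za.
Qed.

Lemma reflect_vec (Al X : seq (seq Z)) : sized Al -> sized X -> reflect_ok w Al X ->
  (forall a, a \in Al -> 0 < dot (vec a) (vec a)) ->
  forall a (v : 'rV[R]_n), a \in map vec Al -> v \in map vec X -> reflection a v \in map vec X.
Proof.
move=> sA sX /allP h a0 a v /mapP[a' aA ->] /mapP[v' vX ->].
have /allP/(_ v' vX)/andP[e] := h a' aA; rewrite zmemE => m.
by rewrite (reflection_vec (sA _ aA) (sX _ vX) e) ?a0 //; exact: map_f.
Qed.

Lemma dominant_vec Al v : dominant (map vec Al) (vec v) = zdominant w Al v.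
Proof.
by rewrite /dominant all_map; apply: eq_all => a /=; rewrite dot_vec_ge0.
Qed.

Lemma refute_vec X Y U S (m : 'rV[R]_n) : sized X -> sized Y -> sized U ->
  (forall s, s \in S -> size s.1 = n) ->
  refute_ok n w nn X Y U S ->
  on_line (map vec (map fst S)) ->
  (forall s : seq Z * bool, s \in S -> dot m (vec s.1) = (s.2)%:R) ->
  (exists2 u, u \in U & dot m (vec u) = 1) ->
  (forall v, v \in X ++ Y -> dot m (vec v) <= 1) ->
  (exists v, [/\ v \in Y, v \notin X & dot m (vec v) = 1]) ->
  on_line (map vec [seq v <- X | (v \in Y) && (dot m (vec v) == 1)]) -> False.
Proof.
move=> sX sY sU sS; rewrite /refute_ok; case: ifP => [sp _ line _ _ _ _ _|_].
  exact: spread_not_line sp line.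
move=> /allP h _ mS [u uU mu] mle [y [yY yX my]] line.
have [f mE] := vec_ofP m.
have rd x : dot m (vec x) = rdot n w x f / zr nn by rewrite mE dot_vec_of.
(* The appended coordinate 1 makes the functional a real solution of the homogeneous integer
   system. *)
pose g i := if (i < n)%N then f i else 1.
have rg x b : size x = n -> rdot n.+1 (rcons w (Zpos xH)) (rcons x b) g = rdot n w x f + zr b.
  move=> sx; rewrite /rdot big_ord_recr /=; congr (_ + _).
    by apply: eq_bigr => i _; rewrite !nth_rcons sw sx ltn_ord /g ltn_ord.
  by rewrite !nth_rcons sw sx ltnn eqxx zr1 /g ltnn mul1r mulr1.
have rd1 x : dot m (vec x) = 1 -> rdot n w x f + zr (Z.opp nn) = 0.
  by rewrite rd zrN => /(congr1 (fun t => t * zr nn)); rewrite divfK ?lt0r_neq0 // mul1r => ->;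
    rewrite subrr.
have sw' : size (rcons w (Zpos xH)) = n.+1 by rewrite size_rcons sw.
have /= := h u uU; set K := zkernel _ _ _.
have gK : (\row_(i < n.+1) g i) \in <<map (zvec n.+1) K>>%VS.
  apply: (zkernel_complete sw') => r; rewrite inE => /orP[/eqP ->|/mapP[s sS' ->]].
    by rewrite rg ?sU // rd1.
  rewrite rg ?sS //; have := mS s sS'; case: (s.2) => [|]; first exact: rd1.
  by rewrite rd zr0 addr0 => /eqP; rewrite mulf_eq0 invr_eq0 (gt_eqF nn0) orbF => /eqP.
case E: K => [|k [|//]].
  move: gK; rewrite E /= span_nil memv0 => /eqP/rowP/(_ ord_max).
  by rewrite !mxE /g ltnn => /eqP; rewrite oner_eq0.
move: gK; rewrite E /= span_seq1 => /vlineP[c gE] bad.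
have fE i : (i < n)%N -> f i = c * zr (nth Z0 k i).
  by move=> ni; have /rowP/(_ (widen_ord (leqnSn n) (Ordinal ni))) := gE; rewrite !mxE /g /= ni.
have c1 : 1 = c * zr (nth Z0 k n).
  by have /rowP/(_ ord_max) := gE; rewrite !mxE /g /= ltnn.
have sk : size k = n.+1.
  have kK : k \in K by rewrite E mem_head.
  exact: (zkernel_sound (R := R) sw' kK (mem_head _ _)).1.
set q := nth Z0 k n in c1 bad.
(* The kernel is the line of [k], so [m] is the functional [take n k] divided by the last entry
   [q]. *)
have q0 : zr q != 0 :> R by apply: contra_eq_neq c1 => ->; rewrite mulr0 oner_eq0.
have dm x : dot m (vec x) = zr (zdot w (take n k) x) / (zr q * zr nn).
  rewrite rd zdotC (zdotE sw) invfM mulrA; congr (_ / _).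
  have -> : (zr q)^-1 = c by apply: (mulIf q0); rewrite mulVf.
  rewrite /rdot mulr_suml; apply: eq_bigr => i _.
  by rewrite nth_take // fE // -!mulrA (mulrC c).
have tight x : Z.eqb (zdot w (take n k) x) (Z.mul q nn) = (dot m (vec x) == 1).
  have Q0 : zr q * zr nn != 0 :> R by rewrite mulf_neq0 // lt0r_neq0.
  rewrite dm -(@zr_eq R) zrM; apply/eqP/eqP => [->|e]; first by rewrite divff.
  by rewrite -[LHS](divfK Q0) e mul1r.
move: bad; rewrite /bad_functional -/q.
have -> : Z.eqb Z0 q = false by rewrite Z.eqb_sym -(@zr_eq R) zr0; apply/negbTE.
rewrite zhasE; case: ifP => [/hasP[v vXY]|_].
  rewrite -(@zr_lt R) (zrM _ nn) !(zrM q) => lt _; have := mle v vXY; rewrite dm leNgt => /negP; apply.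
  have q2 : 0 < zr q * zr q :> R by rewrite -expr2 exprn_even_gt0.
  rewrite -(ltr_pM2l (mulr_gt0 q2 nn0)) mulr1.
  have -> // : zr q * zr q * zr nn * (zr (zdot w (take n k) v) / (zr q * zr nn)) =
    zr q * zr (zdot w (take n k) v) :> R.
  by field; rewrite q0 lt0r_neq0.
rewrite zhasE; case: ifP => [/negP[]|_].
  by apply/hasP; exists y => //; rewrite tight my eqxx zmemE.
move=> /spread_not_line; apply.
have -> : [seq v <- X | if Z.eqb (zdot w (take n k) v) (Z.mul q nn) then zmem v Y else false] =
  [seq v <- X | (v \in Y) && (dot m (vec v) == 1)].
  by apply: eq_filter => v; rewrite tight zmemE; case: eqP => _; rewrite ?andbT ?andbF.
exact: line.
Qed.

Lemma coplanar_vec X Y Al d (m0 : 'rV[R]_n) : sized X -> sized Y -> sized Al -> size d = n ->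
  uniq X -> uniq Y -> sep (map vec X) (map vec Y) ->
  (forall a, a \in Al -> Z.ltb Z0 (zdot w d a)) ->
  reflect_ok w Al X -> reflect_ok w Al Y -> coplanar_ok n w nn Al X Y ->
  (forall v : 'rV[R]_n, v \in map vec X -> dot m0 v <= 1) -> (forall v : 'rV[R]_n, v \in map vec Y -> dot m0 v <= 1) ->
  on_line [seq v : 'rV[R]_n <- map vec X | (v \in map vec Y) && (dot m0 v == 1)] ->
  (exists v : 'rV[R]_n, [/\ v \in map vec X, v \notin map vec Y & dot m0 v = 1]) ->
  (exists v : 'rV[R]_n, [/\ v \in map vec Y, v \notin map vec X & dot m0 v = 1]) -> False.
Proof.
move=> sX sY sA sd uX uY sXY dA rX rY ok mX0 mY0 line0 far0 far0'.
have hA a : a \in map vec Al -> a != 0 /\ 0 < dot (vec d) a.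
  move=> /mapP[a' aA ->]; have da : 0 < dot (vec d) (vec a') by rewrite dot_vec_gt0 dA.
  by split=> //; apply: contraTneq da => ->; rewrite dot0r ltxx.
have aa a : a \in Al -> 0 < dot (vec a) (vec a).
  by move=> aA; rewrite dot_gt0; exact: (hA _ (map_f vec aA)).1.
have [m [mX mY line lineS [[u [uX' uY' ud mu]] [y [yY yX my]]]]] :=
  dominant_functional (vec_uniq sX uX) (vec_uniq sY uY) sXY hA
    (reflect_vec sA sX rX aa) (reflect_vec sA sY rY aa) mX0 mY0 line0 far0 far0'.
pose V0 := [seq v <- X | zmem v Y && zdominant w Al v].
pose U := [seq v <- X | ~~ zmem v Y && zdominant w Al v].
pose L := [seq (a, false) | a <- Al] ++ [seq (v, true) | v <- V0].
(* The conditions that really hold for the dominant [m]; this sublist is one of those tried. *)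
pose S := [seq s : seq Z * bool <- L | dot m (vec s.1) == (s.2)%:R].
have SL : S \in subs L by exact: filter_subs.
have sL s : s \in L -> size s.1 = n.
  rewrite mem_cat => /orP[/mapP[a aA ->]|/mapP[v vV ->]] /=; first exact: sA.
  by apply: sX; move: vV; rewrite mem_filter => /andP[].
have memY v : v \in X -> (vec v \in map vec Y) = (v \in Y).
  by move=> vX; apply: vec_mem => //; exact: sX.
apply: (@refute_vec X Y U S m) => //.
- exact: sizedF.
- by move=> s; rewrite mem_filter => /andP[_ /sL].
- exact: (allP ok).
- have -> // : map vec (map fst S) = [seq a <- map vec Al | dot m a == 0] ++
      [seq v <- [seq v : 'rV[R]_n <- map vec X | (v \in map vec Y) && dominant (map vec Al) v]
         | dot m v == 1].
  have -> : [seq v : 'rV[R]_n <- map vec X | (v \in map vec Y) && dominant (map vec Al) v] =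
      map vec V0.
    rewrite filter_map; congr map; apply: eq_in_filter => v vX /=.
    by rewrite memY // dominant_vec zmemE.
  rewrite /S /L filter_cat !map_cat !filter_map -!map_comp.
  by congr (_ ++ _); apply: eq_map.
- by move=> s; rewrite mem_filter => /andP[/eqP].
- move: uX' uY' ud mu => /mapP[u' u'X ->]; rewrite memY // dominant_vec => u'Y ud mu.
  by exists u' => //; rewrite mem_filter zmemE u'Y ud.
- by move=> v; rewrite mem_cat => /orP[/(map_f vec)/mX|/(map_f vec)/mY].
- move: yY yX my => /mapP[y' y'Y ->]; rewrite vec_mem ?sY // => y'X my.
  by exists y'.
- move: line; rewrite filter_map.
  have -> // : [seq x <- X | preim vec (fun z : 'rV[R]_n => (z \in map vec Y) && (dot m z == 1)) x] =
    [seq v <- X | (v \in Y) && (dot m (vec v) == 1)].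
  by apply: eq_in_filter => v vX /=; rewrite memY.
Qed.

End Vec.

Lemma reducible_pair_sym {R : realType} {n : nat} (X : seq 'rV[R]_n) x y :
  reducible_pair X x y -> reducible_pair X y x.
Proof.
rewrite /reducible_pair (addrC y).
case=> [e|e|[u [u' [uX u'X ux uy e]]]|e].
- exact: Or41.
- exact: Or42.
- by apply: Or43; exists u, u'.
- exact: Or44.
Qed.

Lemma config_regions {R : realType} (n : nat) (c : config) : config_ok n c ->
  regions (map (@vec R n (cf_w c) (cf_D c)) (cf_V c))
    (map (map (@vec R n (cf_w c) (cf_D c))) (cf_regions c)).
Proof.
rewrite /config_ok; set w := cf_w c; set V := cf_V c; set D := cf_D c; set Rg := cf_regions c.
case/andP=> /andP[/andP[/eqP sw wpos] Dpos].
case/and5P=> /allP hV /zuniqP uV tok /allP hleaves.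
case/and5P=> /allP hfull /allP hall /allP hreg /allP hAl /andP[/andP[/eqP sd /allP hseps] hpairs].
set vecR := @vec R n w D.
have sV : sized n V by move=> v /hV/andP[/eqP].
have RgV X : X \in Rg -> exists fs, X = zpart w V fs by move=> /mapP[fs _ ->]; exists fs.
have sRg X : X \in Rg -> sized n X by move=> /RgV[fs ->]; exact: sizedF.
have uRg X : X \in Rg -> uniq X by move=> /RgV[fs ->]; exact: filter_uniq.
have sAl : sized n (cf_simple c) by move=> a /hAl/andP[/eqP].
have sleaf fs : fs \in leaves (cf_tree c) -> all (fun f => size f == n) fs.
  by move=> /hleaves/and3P[].
have vinj := @vec_inj R n w D sw wpos Dpos.
have sepR X Z : X \in Rg -> Z \in Rg -> X <> Z -> sep (map vecR X) (map vecR Z).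
  move=> XR ZR XZ; have [/andP[]|/andP[]] := pairs_okP hpairs XR ZR XZ;
    rewrite zhasE => /hasP[l ls ok] _; [|apply: sep_sym];
    apply: (sep_vec sw wpos Dpos (l := l)) => //; try exact: sRg; by apply/eqP; exact: hseps.
split.
- exact: vec_uniq.
- move=> v /mapP[x xV ->]; apply/eqP; rewrite dot_vec_eq1 //.
  by have /andP[_] := hV x xV.
- move=> _ /mapP[X XR ->]; rewrite filter_map; congr map.
  have [fs E] := RgV X XR; rewrite {1}E; apply: eq_in_filter => v vV /=.
  rewrite vec_mem //; [|exact: sV|exact: sRg].
  by rewrite E mem_filter vV andbT.
- by move=> _ /mapP[X XR ->]; apply: zfull_spans => //; exact: hfull.
- move=> x; have [] := @tree_cover R n w D (cf_tree c) [::] x => //.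
    by apply/allP.
  move=> fs fsl hx; have /and3P[sfs lok /hasP[X XR /allP sub]] := hleaves fs fsl.
  exists (map vecR X); first exact: map_f.
  have sfs' : sized n fs by move=> f /(allP sfs)/eqP.
  have := leaf_cover sw wpos Dpos sV uV sfs' lok hx.
  apply: incone_sub; first by apply: vec_uniq => //; [exact: sRg|exact: uRg].
  by move=> v /mapP[z /sub]; rewrite zmemE => zX ->; exact: map_f.
- move=> _ _ /mapP[X XR ->] /mapP[Z ZR ->] XZ; apply: sepR => // e; apply: XZ; by rewrite e.
- move=> _ _ m /mapP[X XR ->] /mapP[Z ZR ->] XZ' mX mZ line farX farZ.
  have XZ : X <> Z by move=> e; apply: XZ'; rewrite e.
  have dA a : a \in cf_simple c -> Z.ltb Z0 (zdot w (cf_weight c) a) by move=> /hAl/andP[].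
  have [_ rX] := andP (hreg X XR); have [_ rZ] := andP (hreg Z ZR).
  have [/andP[_ ok]|/andP[_ ok]] := pairs_okP hpairs XR ZR XZ.
    exact: (coplanar_vec sw wpos Dpos (sRg X XR) (sRg Z ZR) sAl sd (uRg X XR) (uRg Z ZR)
      (sepR X Z XR ZR XZ) dA rX rZ ok mX mZ line farX farZ).
  have line' : on_line [seq v <- map vecR Z | (v \in map vecR X) && (dot m v == 1)].
    have [u hu] := line; exists u => y oy; apply: hu => v.
    rewrite mem_filter => /andP[/andP[vZ mv] vX]; apply: oy.
    by rewrite mem_filter vX vZ mv.
  apply: (coplanar_vec sw wpos Dpos (sRg Z ZR) (sRg X XR) sAl sd (uRg Z ZR) (uRg X XR)
      _ dA rZ rX ok mZ mX line' farZ farX).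
  by apply: sepR => // e; apply: XZ.
- move=> v /mapP[x xV ->]; have := hall x xV; rewrite zhasE => /hasP[X XR].
  by rewrite zmemE => xX; exists (map vecR X); exact: map_f.
- move=> _ _ _ /mapP[X XR ->] /mapP[x xX ->] /mapP[y yX ->] xy.
  have [eok _] := andP (hreg X XR); have sX := sRg X XR.
  have xy' : x <> y by move=> e; apply: xy; rewrite e.
  have [ok|ok] := edges_okP eok xX yX xy'.
    by apply: reducible_vec => //; exact: sX.
  rewrite dotC; have [h|/reducible_pair_sym h] :=
    @reducible_vec R n w D sw wpos Dpos X y x sX (sX y yX) (sX x xX) ok; by [left|right].
Qed.

(** * Long edges *)

Section LongEdge.
Local Open Scope Z_scope.

Definition long_ok (n : nat) (c : config) (m a x y : seq Z) : bool :=
  let w := cf_w c in let nn := cf_nn c in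
  let F := [seq v <- cf_V c | Z.eqb (zdot w m v) nn] in
  [&& all (fun v => Z.leb (zdot w m v) nn) (cf_V c), zfull n w F,
      all (fun v => if Z.eqb 0 (zdot w a v) then zeqv v x || zeqv v y else
        Z.ltb (zdot w a v) 0) F,
      all (fun v => zmem v F && Z.eqb 0 (zdot w a v)) [:: x; y], ~~ zeqv x y &
      Z.ltb (2 * zdot w x y) nn].

(* A facet of conv V with normal m has the edge [x, y], exposed by a, which is
   longer than 1. *)
Definition long_edge (c : configuration) : seq Z * seq Z * seq Z * seq Z :=
  match c with
  | D5 | L5 | E6 | E7 => ([::], [::], [::], [::])
  | Q5 => ([:: 10; 10; -10; 0; -10], [:: 0; 0; 1; -2; 1],
           [:: 10; 10; 0; 0; 0], [:: 2; 2; -8; -8; -8])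
  | R5 => ([:: 10; 10; -10; -10; 0], [:: 0; 0; 1; 1; -2],
           [:: 10; 10; 0; 0; 0], [:: 2; 2; -8; -8; -8])
  | C6_72b => ([:: 2; 2; 2; 0; 2; 0], [:: -1; -1; -1; 4; -1; 0],
           [:: 1; 1; 1; 1; 1; 1], [:: 1; 1; 1; 1; 1; -1])
  | C6_72c | C6_72d => ([:: 4; 0; 0; 0; 0; 0], [:: -1; 0; 0; 0; 1; 1],
           [:: 2; 0; 0; 0; 2; 0], [:: 2; 0; 0; 0; -1; 1])
  | C7_126b => ([:: 0; 2; 2; 2; 2; 0; 0], [:: 4; -1; -1; -1; -1; 0; 0],
           [:: 1; 1; 1; 1; 1; 1; 1], [:: 1; 1; 1; 1; 1; -1; -1])
  | C7_126c | C7_126d => ([:: 12; 12; 0; 0; 0; 0; -12], [:: -1; 1; 0; 0; 0; 0; 1],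
           [:: 12; 12; 0; 0; 0; 0; 0], [:: -4; 12; 0; 0; 0; 0; -8])
  end.

Definition longer (c : configuration) : bool :=
  match c with D5 | L5 | E6 | E7 => false | _ => true end.

Definition long_edge_ok (c : configuration) : bool :=
  let: (m, a, x, y) := long_edge c in
  if longer c then long_ok (conf_dim c) (the_config c) m a x y else true.

End LongEdge.

Lemma long_not_unit {R : realType} (n : nat) (c : config) m a x y :
  (3 <= n)%N -> config_ok n c -> long_ok n c m a x y ->
  ~ unit_edge (conv_facets [set` map (@vec R n (cf_w c) (cf_D c)) (cf_V c)]).
Proof.
move=> n3; rewrite /config_ok /long_ok.
set w := cf_w c; set V := cf_V c; set D := cf_D c; set nn := cf_nn c.
case/andP=> /andP[/andP[/eqP sw wpos] Dpos] /andP[/allP hV /andP[/zuniqP uV _]].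
set F := [seq v <- V | Z.eqb (zdot w m v) nn].
case/and5P=> /allP mle full /allP aF /and3P[xF yF _] /andP[xy lt].
set vecR := @vec R n w D.
have sV : sized n V by move=> v /hV/andP[/eqP].
have FE : [seq v <- map vecR V | dot (vecR m) v == 1] = map vecR F.
  by rewrite filter_map; congr map; apply: eq_filter => v; rewrite /= dot_vec_eq1.
have memF (v : 'rV[R]_n) : v \in map vecR V -> dot (vecR m) v = 1 -> exists2 z, z \in F & v = vecR z.
  move=> vV mv; have : v \in map vecR F by rewrite -FE mem_filter mv eqxx.
  by move=> /mapP[z]; exists z.
have F1 z : z \in F -> [/\ z \in V, size z = n & dot (vecR m) (vecR z) = 1].
  rewrite mem_filter => /andP[e zV]; split=> //; first exact: sV.
  by apply/eqP; rewrite dot_vec_eq1.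
move: xF yF; rewrite !zmemE => /andP[xF ax] /andP[yF ay].
have [xV sx mx] := F1 x xF; have [yV sy my] := F1 y yF.
have unit z : z \in V -> dot (vecR z) (vecR z) = 1.
  by move=> zV; apply/eqP; rewrite dot_vec_eq1 //; have /andP[] := hV z zV.
have xy' : vecR x <> vecR y.
  by move=> /(vec_inj sw wpos Dpos sx sy) e; case/negP: xy; apply/zeqvP.
apply: (@long_edge_not_unit R n (map vecR V) (vecR m) (vecR a) (vecR x) (vecR y)) => //.
- exact: vec_uniq.
- by move=> v /mapP[z zV ->]; rewrite dot_vec_le1 //; exact: mle.
- by rewrite FE; exact: zfull_spans.
- move=> v vV mv; have [z zF ->] := memF v vV mv.
  by have := aF z zF; rewrite leNgt dot_vec_gt0 //; clear; case: ifP => [e _|_ lt0]; lia.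
- move=> v vV mv; have [z zF ->] := memF v vV mv; move=> /eqP; rewrite dot_vec_eq0 // => a0.
  by have := aF z zF; rewrite a0 => /orP[/zeqvP ->|/zeqvP ->]; [left|right].
- exact: map_f.
- exact: map_f.
- by apply/eqP; rewrite dot_vec_eq0.
- by apply/eqP; rewrite dot_vec_eq0.
- have h : 2 * dot (vecR x) (vecR y) < 1.
    have nn0 : 0 < zr nn :> R by rewrite -zr0 zr_lt /nn /cf_nn -/D; lia.
    by rewrite dot_vec // mulrA ltr_pdivrMr // mul1r -zr2 -zrM zr_lt.
  rewrite dotBl !dotBr (dotC (vecR y) (vecR x)) !unit //; lra.
Qed.

Lemma long_edges_ok c : long_edge_ok c.
Proof. by case: c; vm_cast_no_check (erefl true). Qed.

(** * Integer coordinates of the configurations *)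

Section Represents.
Context {R : realType}.
Implicit Types (w z : seq Z) (V : seq (seq Z)) (D t : Z).

(** [vec] is scaled for unit vectors, the configurations have squared norm 2; hence the factor. *)
Definition represents (n : nat) w D V (S : set 'rV[R]_n) : Prop :=
  sized n V /\ forall x, S x <-> exists2 z, z \in V & x = Num.sqrt 2 *: vec n w D z.

Lemma represents_coord (n : nat) w D z (i : 'I_n) : (Num.sqrt 2 *: @vec R n w D z) 0 i =
  zr (nth Z0 z i) * Num.sqrt (zr (nth Z0 w i)) / zr D.
Proof.
rewrite !mxE invfM mulrC -!mulrA; do 2 congr (_ * _).
by rewrite mulVf ?mulr1 // gt_eqF // sqrtr_gt0.
Qed.

Lemma represents_cat (n : nat) w D V V' (S S' : set 'rV[R]_n) :
  represents w D V S -> represents w D V' S' -> represents w D (V ++ V') (S `|` S').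
Proof.
move=> [sV hV] [sV' hV']; split.
  by move=> z; rewrite mem_cat => /orP[/sV|/sV'].
move=> x; split=> [[/hV[z zV ->]|/hV'[z zV ->]]|[z]].
- by exists z; rewrite // mem_cat zV.
- by exists z; rewrite // mem_cat zV orbT.
- by rewrite mem_cat => /orP[zV ->|zV ->]; [left; apply/hV|right; apply/hV']; exists z.
Qed.

Lemma ext_vec (n : nat) w D z (b : Z) t (s : R) : size w = n -> size z = n ->
  s = zr t * Num.sqrt (zr b) / zr D ->
  ext (Num.sqrt 2 *: @vec R n w D z) s = Num.sqrt 2 *: @vec R (n + 1) (rcons w b) D (rcons z t).
Proof.
move=> sw sz st; apply/rowP => i; rewrite represents_coord /ext mxE !nth_rcons sw sz.
case: splitP => j /= ->; first by rewrite represents_coord.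
by rewrite (ord1 j) /= addn0 eqxx st mxE.
Qed.

Lemma represents_layer (n : nat) w D V (S : set 'rV[R]_n) (b : Z) t (s : R) : size w = n ->
  s = zr t * Num.sqrt (zr b) / zr D -> represents w D V S ->
  represents (rcons w b) D (zlayer V t) (layer S s).
Proof.
move=> sw st [sV hV]; split.
  by move=> _ /mapP[z zV ->]; rewrite size_rcons (sV z zV) addn1.
move=> x; split=> [[y /hV[z zV ->] <-]|[_ /mapP[z zV ->] ->]].
  by exists (rcons z t); [exact: map_f|exact: ext_vec (sV z zV) st].
exists (Num.sqrt 2 *: vec n w D z); first by apply/hV; exists z.
exact: ext_vec (sV z zV) st.
Qed.

(** Folding depends only on the direction of the mirror vector, so a positive multiple [k] of its
    integer form suffices. *)
Lemma represents_fold (n : nat) w D V (S : set 'rV[R]_n) (a : 'rV[R]_n) (k : R) za :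
  size w = n -> all (Z.ltb Z0) w -> Z.ltb Z0 D -> size za = n -> Z.ltb Z0 (zdot w za za) ->
  0 < k -> a = k *: vec n w D za -> represents w D V S ->
  represents w (Z.mul D (zdot w za za)) (zfold w V za) (fold_set S a).
Proof.
move=> sw wpos Dpos sza aa0 k0 aE [sV hV]; rewrite /zfold; set aa := zdot w za za.
have aaR : zr aa != 0 :> R by rewrite gt_eqF // -zr0 zr_lt.
have s2 : 0 < Num.sqrt 2 :> R by rewrite sqrtr_gt0.
have scaleD z : @vec R n w (Z.mul D aa) z = (zr aa)^-1 *: vec n w D z.
  apply/rowP => i; rewrite !mxE zrM.
  have D0 : zr D != 0 :> R by rewrite gt_eqF // -zr0 zr_lt.
  by field; rewrite D0 aaR gt_eqF.
have dotE z : dot (Num.sqrt 2 *: vec n w D z) a = (Num.sqrt 2 * k) * dot (vec n w D z) (vec n w D za).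
  by rewrite aE dotZl dotZr mulrA.
have sk : 0 < Num.sqrt 2 * k by rewrite mulr_gt0.
have ge0 z : (0 <= dot (Num.sqrt 2 *: vec n w D z) a) = Z.leb Z0 (zdot w z za).
  by rewrite dotE pmulr_rge0 // dot_vec_ge0.
have gt0 z : (0 < dot (Num.sqrt 2 *: vec n w D z) a) = Z.ltb Z0 (zdot w z za).
  by rewrite dotE pmulr_rgt0 // dot_vec_gt0.
have keep z : size z = n -> Num.sqrt 2 *: vec n w (Z.mul D aa) (map (Z.mul aa) z) =
    Num.sqrt 2 *: @vec R n w D z.
  move=> sz; rewrite scaleD; congr (_ *: _); apply/rowP => i; rewrite !mxE.
  rewrite (nth_map Z0) ?sz // zrM -!mulrA mulKf //.
have refl z : size z = n -> reflection a (Num.sqrt 2 *: vec n w D z) =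
    Num.sqrt 2 *: @vec R n w (Z.mul D aa) (zcomb aa z (Z.opp (Z.mul (Zpos (xO xH)) (zdot w z za))) za).
  move=> sz; rewrite scaleD vec_zcomb // zrN zrM zr2 scalerDr scalerA mulVf // scale1r.
  rewrite scalerDr /reflection dotE aE dotZl dotZr !scalerA; congr (_ + _).
  rewrite -scaleNr; congr (_ *: _); rewrite !dot_vec // -/aa.
  have nn0 : zr (Z.mul (Zpos (xO xH)) (Z.mul D D)) != 0 :> R by rewrite gt_eqF // -zr0 zr_lt; lia.
  move: nn0 aaR; move: (zr (Z.mul _ _)) (zr (zdot w z za)) (zr aa) => p q r p0 r0.
  by field; rewrite p0 r0 gt_eqF.
split.
  move=> z; rewrite mem_cat => /orP[] /mapP[v]; rewrite mem_filter => /andP[_ vV] ->.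
    by rewrite size_map sV.
  by apply: size_zcomb => //; exact: sV.
move=> x; split.
  case=> [[/hV[z zV ->] xa]|[_ [/hV[z zV ->] xa] <-]].
    exists (map (Z.mul aa) z); last by rewrite keep // sV.
    by rewrite mem_cat map_f // mem_filter -ge0 xa.
  eexists; last by rewrite refl // sV.
  rewrite mem_cat; apply/orP; right; apply/mapP; exists z => //.
  by rewrite mem_filter -gt0 xa.
case=> z; rewrite mem_cat => /orP[] /mapP[v]; rewrite mem_filter => /andP[va vV] -> ->.
  by left; rewrite keep ?sV //; split; [apply/hV; exists v|rewrite ge0].
right; exists (Num.sqrt 2 *: vec n w D v); last by rewrite refl ?sV.
by split; [apply/hV; exists v|rewrite gt0].
Qed.

Let two : Z := Zpos (xO xH).

Lemma coord_ones (m : nat) z (i : 'I_m) :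
  (Num.sqrt 2 *: @vec R m (nseq m (Zpos xH)) two z) 0 i = zr (nth Z0 z i) / 2.
Proof. by rewrite represents_coord nth_nseq ltn_ord zr1 sqrtr1 mulr1 zr2. Qed.

Definition zsign (s : bool) : Z := if s then Zneg (xO xH) else two.

Lemma zsignP t : t \in zsigns -> exists s, t = zsign s.
Proof. by rewrite !inE => /orP[]/eqP ->; [exists false|exists true]. Qed.

Lemma zsign_mem s : zsign s \in zsigns.
Proof. by case: s. Qed.

Lemma zr_sign s : zr (zsign s) / 2 = (-1) ^+ s :> R.
Proof.
case: s; rewrite /zsign /two; first by rewrite -[Zneg _]/(Z.opp two) zrN zr2 expr1 mulNr divff.
by rewrite zr2 expr0 divff.
Qed.

Lemma represents_phiD (m : nat) : represents (nseq m (Zpos xH)) two (zphiD m) (PhiD R m).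
Proof.
split.
  by move=> _ /allpairsP[[[i j] [s t]] [_ _ ->]]; rewrite size_map size_iota.
have E (i j : 'I_m) (s b : bool) : (i < j)%N ->
    (-1) ^+ s *: basis_vec R i + (-1) ^+ b *: basis_vec R j = Num.sqrt 2 *: vec m (nseq m (Zpos xH)) two
      [seq (if k == nat_of_ord i then zsign s else if k == nat_of_ord j then zsign b else Z0) | k <- iota 0 m].
  move=> ij; apply/rowP => k; rewrite coord_ones !mxE (nth_map 0%N) ?size_iota // nth_iota // add0n /=.
  rewrite -!(inj_eq val_inj) /=.
  have [ki|ki] := eqVneq (k : nat) i.
    by rewrite -ki in ij *; rewrite (ltn_eqF ij) mulr1 mulr0 addr0 zr_sign.
  by rewrite mulr0 add0r; case: eqP => _; rewrite ?mulr1 ?zr_sign // mulr0 zr0 mul0r.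
move=> x; split=> [[i [j [s [t [ij ->]]]]]|].
  rewrite (E _ _ _ _ ij); eexists; last by [].
  apply/allpairsP; exists ((i : nat, j : nat), (zsign s, zsign t)); split=> //=.
    apply/allpairsPdep; exists (i : nat), (j : nat); split=> //.
    - by rewrite mem_iota add0n ltn_ord.
    - by rewrite mem_filter ij mem_iota add0n ltn_ord.
  by case: (s); case: (t).
case=> _ /allpairsP[[ij st] [/allpairsPdep[i [j [im jm ijE]]] /allpairsP[[s' t'] [/= sm tm stE]] ->]] ->.
move: im jm sm tm; rewrite mem_iota mem_filter mem_iota /= => im /andP[ij' jm] /zsignP[s sE] /zsignP[t tE].
exists (Ordinal im), (Ordinal jm), s, t; split=> //; rewrite E //.
by move: ijE stE => /= -> ->; rewrite sE tE.
Qed.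

Lemma zhalfP (m : nat) b z : (z \in zhalf m b) =
  [&& size z == m, all (fun c => (c == Zpos xH) || (c == Zneg xH)) z &
      odd (count (fun c => c == Zneg xH) z) == b].
Proof.
elim: m b z => [|m IH] b [|c z] /=.
- by case: b.
- by case: b.
- by rewrite mem_cat; apply/negP => /orP[] /mapP[].
have inj (e : Z) : injective (cons e) by move=> u v [].
rewrite mem_cat eqSS.
have [->|c1] := eqVneq c (Zpos xH).
  have -> : (Zpos xH :: z \in [seq (Zneg xH) :: v | v <- zhalf m (~~ b)]) = false.
    by apply/negP => /mapP[].
  by rewrite orbF mem_map // IH.
have -> : (c :: z \in [seq (Zpos xH) :: v | v <- zhalf m b]) = false.
  by apply/negP => /mapP[v _ [e _]]; rewrite e eqxx in c1.
have [->|c2] := eqVneq c (Zneg xH).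
  by rewrite /= mem_map // IH; case: (odd _); case: b.
rewrite andbF; apply/negP => /mapP[v _ [e _]]; by rewrite e eqxx in c2.
Qed.

Lemma represents_half (m : nat) b : represents (nseq m (Zpos xH)) two (zhalf m b) (half_cube R m b).
Proof.
split; first by move=> z; rewrite zhalfP => /and3P[/eqP].
have parity z : size z = m -> #|[set i : 'I_m | nth Z0 z i == Zneg xH]%SET| =
    count (fun c => c == Zneg xH) z.
  by move=> sz; rewrite -sum1_count (big_nth Z0) big_mkord sz cardsE sum1_card.
move=> x; split=> [[s [sb ->]]|[z]].
  pose z := [seq (if s i then Zneg xH else Zpos xH) | i <- enum 'I_m].
  have sz : size z = m by rewrite size_map size_enum_ord.
  have nz (i : 'I_m) : nth Z0 z i = if s i then Zneg xH else Zpos xH.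
    by rewrite (nth_map i) ?size_enum_ord // nth_ord_enum.
  exists z.
    rewrite zhalfP sz eqxx -parity // -sb /=; apply/andP; split.
      by apply/allP => c /mapP[i _ ->]; case: (s i).
    by apply/eqP; congr (odd #|pred_of_set _|); apply/setP => i; rewrite !inE nz; case: (s i).
  apply/rowP => i; rewrite coord_ones mxE nz; congr (_ / _).
  by case: (s i); rewrite ?expr0 // expr1 -[Zneg _]/(Z.opp (Zpos xH)) zrN zr1.
rewrite zhalfP => /and3P[/eqP sz /allP pm /eqP par] ->.
exists [ffun i : 'I_m => nth Z0 z i == Zneg xH]; split.
  rewrite -par -parity //; congr (odd #|pred_of_set _|); apply/setP => i.
  by rewrite !inE ffunE.
apply/rowP => i; rewrite coord_ones mxE ffunE; congr (_ / _).
have /orP[/eqP ->|/eqP ->] := pm _ (mem_nth Z0 (n := i) (eq_ind_r (fun k => (i < k)%N) (ltn_ord i) sz)).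
  by rewrite zr1.
by rewrite eqxx expr1 -[Zneg _]/(Z.opp (Zpos xH)) zrN zr1.
Qed.

Lemma represents_A : represents (nseq 4 (Zpos xH)) two zA (colorA R).
Proof.
split; first by move=> z /allpairsP[[i s] [_ _ ->]]; rewrite size_map size_iota.
have E (i : 'I_4) (s : bool) : (-1) ^+ s *: basis_vec R i = Num.sqrt 2 *: vec 4 (nseq 4 (Zpos xH)) two
      [seq (if k == nat_of_ord i then zsign s else Z0) | k <- iota 0 4].
  apply/rowP => k; rewrite coord_ones !mxE (nth_map 0%N) ?size_iota // nth_iota // add0n /=.
  rewrite -(inj_eq val_inj) /=.
  by case: eqP => _; rewrite ?mulr1 ?zr_sign // mulr0 zr0 mul0r.
move=> x; split=> [[i [s ->]]|].
  rewrite E; eexists; last by [].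
  by apply/allpairsP; exists (i : nat, zsign s); split; rewrite ?mem_iota ?zsign_mem /= ?add0n.
case=> _ /allpairsP[[i t] [im tm ->]] ->.
move: im tm; rewrite mem_iota => im /zsignP[s /= ->].
by exists (Ordinal im), s; rewrite E.
Qed.

(** Tripling the angle gives cosine -1, that is [(c + 1) * (2 * c - 1) ^+ 2 = 0], and [c] is
    positive. *)
Lemma cos_pi_div3 : cos (pi / 3) = 1 / 2 :> R.
Proof.
have e : pi / 3 + pi / 3 + pi / 3 = pi :> R by field.
have := @cospi R; rewrite -{1}e cosD cosD sinD.
have := cos2Dsin2 (pi / 3 : R); set c := cos _; set s := sin _ => cs h.
have c0 : 0 < c.
  by apply: cos_gt0_pihalf; have := @pi_gt0 R => p; apply/andP; split; lra.
have : (c + 1) * (2 * c - 1) ^+ 2 = 0.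
  have s2 : s ^+ 2 = 1 - c ^+ 2 by rewrite -cs addrC addKr.
  have -> : (c + 1) * (2 * c - 1) ^+ 2 = ((c * c - s * s) * c - (c * s + s * c) * s + 1)
     + 3 * c * (s ^+ 2 - (1 - c ^+ 2)) by ring.
  rewrite s2 subrr mulr0 addr0.
  by move: h; rewrite (mulrC s c) => ->; rewrite addNr.
move/eqP; rewrite mulf_eq0 expf_eq0 /= => /orP[/eqP|/eqP]; lra.
Qed.

Lemma sin_pi_div3 : sin (pi / 3) = Num.sqrt 3 / 2 :> R.
Proof.
have s0 : 0 < sin (pi / 3) :> R.
  by apply: sin_gt0_pi; have := @pi_gt0 R => p; apply/andP; split; lra.
have := cos2Dsin2 (pi / 3 : R); rewrite cos_pi_div3 => h.
have -> : sin (pi / 3) = Num.sqrt (sin (pi / 3) ^+ 2) :> R by rewrite sqrtr_sqr gtr0_norm.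
have -> : sin (pi / 3) ^+ 2 = 3 / 2 ^+ 2 :> R by lra.
by rewrite sqrtrM // sqrtrV // sqrtr_sqr ger0_norm.
Qed.

Lemma hexagon (k : nat) : (k < 6)%N ->
  cos (k%:R * pi / 3) = zr (nth (Z0, Z0) zhex k).1 * Num.sqrt (zr (Zpos xH)) / zr two :> R /\
  sin (k%:R * pi / 3) = zr (nth (Z0, Z0) zhex k).2 * Num.sqrt (zr (Zpos (xI xH))) / zr two :> R.
Proof.
have z3 : zr (Zpos (xI xH)) = 3 :> R by [].
have zm1 : zr (Zneg xH) = -1 :> R by [].
have zm2 : zr (Zneg (xO xH)) = -2 :> R by [].
have r3 : Num.sqrt 3 * Num.sqrt 3 = 3 :> R by rewrite -expr2 sqr_sqrtr.
elim: k => [|k IH] k6; rewrite zr1 z3 zr2 sqrtr1.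
  by rewrite mul0r mul0r cos0 sin0 /= zr0 !mul0r mulr1 divff.
have [] := IH (ltnW k6); rewrite zr1 z3 zr2 sqrtr1 => ck sk.
have e : k.+1%:R * pi / 3 = k%:R * pi / 3 + pi / 3 :> R by rewrite -natr1; field.
rewrite e cosD sinD ck sk cos_pi_div3 sin_pi_div3.
have r3' (u : R) : u * Num.sqrt 3 / 2 * (Num.sqrt 3 / 2) = u * 3 / 4.
  by rewrite -[in RHS]r3; field.
rewrite r3'.
by move: k k6 {IH ck sk e} => [|[|[|[|[|//]]]]] _ /=; rewrite ?zr0 ?zr1 ?zr2 ?zm1 ?zm2; split; field.
Qed.

Definition w4 : seq Z := nseq 4 (Zpos xH).

Lemma represents_X6 (zc : seq (seq (seq Z))) (c : 6.-tuple (set 'rV[R]_4)) : size zc = 6 ->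
  (forall k : 'I_6, represents w4 two (nth [::] zc k) (tnth c k)) ->
  @represents 6 w6 two (zX6 zc) (vecX6 c).
Proof.
move=> szc hc; rewrite /zX6 /vecX6.
have -> : w6 = rcons (rcons w4 (Zpos xH)) (Zpos (xI xH)) by [].
have lay (V : seq (seq Z)) (S : set 'rV[R]_4) (s t : Z) (s' t' : R) : represents w4 two V S ->
    s' = zr s * Num.sqrt (zr (Zpos xH)) / zr two -> t' = zr t * Num.sqrt (zr (Zpos (xI xH))) / zr two ->
    represents (rcons (rcons w4 (Zpos xH)) (Zpos (xI xH))) two (zlayer (zlayer V s) t)
      (layer (layer S s') t').
  by move=> h hs ht; do 2 apply: represents_layer => //.
have hlay (k : 'I_6) := lay _ _ _ _ _ _ (hc k) (hexagon (ltn_ord k)).1 (hexagon (ltn_ord k)).2.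
apply: (@represents_cat 6); first by apply: lay (represents_phiD 4) _ _; rewrite zr0 !mul0r.
have sz : size (zip zc zhex) = 6 by rewrite size_zip szc.
have nthz (k : nat) : nth ([::], (Z0, Z0)) (zip zc zhex) k = (nth [::] zc k, nth (Z0, Z0) zhex k).
  by rewrite nth_zip ?szc.
split.
  move=> z /flattenP[Y /mapP[p /(nthP ([::], (Z0, Z0)))[k]]]; rewrite sz nthz => k6 <- -> /=.
  exact: (hlay (Ordinal k6)).1.
move=> x; split.
  case=> k _ /(hlay k).2[z zV ->]; exists z => //; apply/flattenP.
  eexists; last exact: zV.
  by apply/mapP; exists (nth ([::], (Z0, Z0)) (zip zc zhex) k); rewrite ?mem_nth ?sz // nthz.
case=> z /flattenP[Y /mapP[p /(nthP ([::], (Z0, Z0)))[k]]]; rewrite sz nthz => k6 <- -> /= zV ->.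
by exists (Ordinal k6) => //; apply/(hlay (Ordinal k6)).2; exists z.
Qed.

End Represents.

Section Configurations.
Context {R : realType}.
Let two : Z := Zpos (xO xH).

Lemma represents_L5 : @represents R 5 w5 two zL5 (vecL5 R).
Proof.
rewrite /zL5 /vecL5.
have -> : w5 = rcons (nseq 4 (Zpos xH)) (Zpos xH) by [].
have s1 : Num.sqrt (zr (Zpos xH)) = 1 :> R by rewrite zr1 sqrtr1.
rewrite -setUA; apply: (@represents_cat R 5); last apply: (@represents_cat R 5).
- by apply: represents_layer (represents_phiD 4) => //; rewrite zr0 !mul0r.
- by apply: represents_layer represents_A => //; rewrite s1 mulr1 /two zr2 divff.
- apply: represents_layer (represents_half 4 true) => //.
  by rewrite s1 mulr1 -[Zneg _]/(Z.opp two) zrN mulNr /two zr2 divff.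
Qed.

Lemma represents_D6A1 : @represents R 7 w7 two zD6A1 (vecD6A1 R).
Proof.
have -> : w7 = rcons (nseq 6 (Zpos xH)) two by [].
apply: (@represents_cat R 7).
  by apply: represents_layer (represents_phiD 6) => //; rewrite zr0 !mul0r.
have e0 : Num.sqrt 2 *: vec 6 (nseq 6 (Zpos xH)) two (nseq 6 Z0) = 0 :> 'rV[R]_6.
  by rewrite vec_znull ?scaler0.
have e1 : Num.sqrt 2 = zr two * Num.sqrt (zr two) / zr two :> R.
  by rewrite zr2 mulrC mulKf.
have e2 : - Num.sqrt 2 = zr (Z.opp two) * Num.sqrt (zr two) / zr two :> R.
  by rewrite zrN !mulNr -e1.
split; first by move=> z; rewrite !inE => /orP[]/eqP ->.
move=> x; rewrite -e0 (ext_vec _ _ e1) // (ext_vec _ _ e2) //; split.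
  case=> ->; eexists; try by []; by rewrite !inE eqxx ?orbT.
by case=> z; rewrite !inE => /orP[]/eqP -> ->; [left|right].
Qed.

Lemma represents_D6A1_halves b b' (zV := zD6A1 ++ zlayer (zhalf 6 b) (Zpos xH) ++ zlayer (zhalf 6 b') (Zneg xH)) :
  @represents R 7 w7 two zV (vecD6A1 R `|` layer (half_cube R 6 b) (Num.sqrt 2)^-1
    `|` layer (half_cube R 6 b') (- (Num.sqrt 2)^-1)).
Proof.
have s2 : Num.sqrt 2 * Num.sqrt 2 = 2 :> R by rewrite -expr2 sqr_sqrtr.
have s0 : Num.sqrt 2 != 0 :> R by rewrite gt_eqF // sqrtr_gt0.
have e : (Num.sqrt 2)^-1 = zr (Zpos xH) * Num.sqrt (zr two) / zr two :> R.
  by rewrite zr1 zr2 -[X in _ / X]s2; field.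
rewrite -setUA; apply: (@represents_cat R 7); first exact: represents_D6A1.
have -> : w7 = rcons (nseq 6 (Zpos xH)) two by [].
apply: (@represents_cat R 7).
  exact: represents_layer e (represents_half 6 b).
apply: represents_layer (represents_half 6 b') => //.
by rewrite e -[Zneg _]/(Z.opp (Zpos xH)) zrN !mulNr.
Qed.

Lemma represents_ones_fold V (S : set 'rV[R]_5) : represents w5 two V S ->
  represents w5 (Zpos (xO (xI (xO xH)))) (zfold w5 V zones) (fold_set S (ones5 R)).
Proof.
have k0 : 0 < 2 * Num.sqrt 2 :> R by rewrite mulr_gt0 // sqrtr_gt0.
apply: (represents_fold (k := 2 * Num.sqrt 2)) => //.
apply/rowP => i; rewrite -scalerA [RHS]mxE represents_coord !nth_nseq ltn_ord.
by rewrite zr1 sqrtr1 zr2 mxE !mul1r divff.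
Qed.

Lemma represents_mirror_fold V (S : set 'rV[R]_7) : represents w7 two V S ->
  represents w7 (Zpos (xO (xO (xI xH)))) (zfold w7 V zmirror) (fold_set S (mirror7 R)).
Proof.
have k0 : 0 < Num.sqrt 2 :> R by rewrite sqrtr_gt0.
apply: (represents_fold (k := Num.sqrt 2)) => //.
have s2 : Num.sqrt 2 * Num.sqrt 2 = 2 :> R by rewrite -expr2 sqr_sqrtr.
have e1 : basis_vec R (ord0 : 'I_6) =
    Num.sqrt 2 *: vec 6 (nseq 6 (Zpos xH)) two [:: two; Z0; Z0; Z0; Z0; Z0].
  apply/rowP => i; rewrite represents_coord nth_nseq ltn_ord zr1 sqrtr1 mulr1 zr2 mxE /=.
  rewrite -(inj_eq val_inj) /=.
  by case: i => [[|[|[|[|[|[|//]]]]]] k6] /=; rewrite ?zr0 ?mul0r // /two zr2 divff.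
rewrite /mirror7 e1; apply: (@ext_vec R 6 (nseq 6 (Zpos xH)) two _ two (Zpos xH)) => //.
by rewrite zr1 zr2 -[X in _ / X]s2; field; rewrite gt_eqF.
Qed.

Lemma conf_represents c : represents (cf_w (the_config c)) (cf_D (the_config c))
  (cf_V (the_config c)) (conf_vectors R c).
Proof.
have hB := represents_half (R := R) 4 false; have hC := represents_half (R := R) 4 true.
have hA := @represents_A R.
have D5 := represents_phiD (R := R) 5; have L5 := represents_L5.
have E7 : represents w7 two zE7 (vecE7 R) := represents_D6A1_halves false false.
have C7b : represents w7 two zC7b (vecC7b R) := represents_D6A1_halves false true.
case: c; [exact: D5|exact: L5|exact: represents_ones_fold D5|exact: represents_ones_fold L5| | | | |
  exact: E7|exact: C7b|exact: represents_mirror_fold E7|exact: represents_mirror_fold C7b];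
  by apply: represents_X6 => // k; case: k => [[|[|[|[|[|[|//]]]]]] k6]; rewrite (tnth_nth set0).
Qed.

Lemma conf_pointsE c : kissing_points R c =
  [set` map (@vec R _ (cf_w (the_config c)) (cf_D (the_config c))) (cf_V (the_config c))].
Proof.
have [_ h] := conf_represents c.
have s0 : Num.sqrt 2 != 0 :> R by rewrite gt_eqF // sqrtr_gt0.
apply/seteqP; split=> x /=.
  move=> [y /h[z zV ->] <-]; rewrite scalerA mulVf // scale1r; exact: map_f.
move=> /mapP[z zV ->]; exists (Num.sqrt 2 *: vec _ (cf_w (the_config c)) (cf_D (the_config c)) z).
  by apply/h; exists z.
by rewrite scalerA mulVf // scale1r.
Qed.

End Configurations.

Lemma the_config_ok c : config_ok (conf_dim c) (the_config c).
Proof. by case: c; vm_cast_no_check (erefl true). Qed.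

Lemma convex_regions c : longer c = false -> cf_regions (the_config c) = [:: cf_V (the_config c)].
Proof. by case: c => // _; rewrite /cf_regions /= /zpart filter_predT. Qed.

Theorem theorem1 (R : realType) (c : configuration) :
  let V : set 'rV[R]_(conf_dim c) := kissing_points R c in
  let P : set (set 'rV[R]_(conf_dim c)) := conv_facets V in
  exists Pstar : set (set 'rV[R]_(conf_dim c)),
    [/\ is_polytope Pstar,
        unit_edge Pstar,
        vertex_set Pstar = V
      & match c with
        | D5 | L5 | E6 | E7 =>
            [/\ unit_edge P, Pstar = P & is_convex Pstar]
        | Q5 | R5 | C6_72b | C6_72c | C6_72d | C7_126b | C7_126c | C7_126d =>
            [/\ ~ unit_edge P, Pstar <> P & ~ is_convex Pstar]
        end].
Proof.
have n3 : (3 <= conf_dim c)%N by case: c.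
move=> V P.
have ok := the_config_ok c; have rg := config_regions (R := R) ok.
have VE := conf_pointsE (R := R) c; rewrite -/V in VE.
pose cvec := @vec R (conf_dim c) (cf_w (the_config c)) (cf_D (the_config c)).
exists (fan_facets (region_fam (map cvec (cf_V (the_config c)))
  (map (map cvec) (cf_regions (the_config c))))).
set Pstar := fan_facets _.
have uPs : unit_edge Pstar := region_unit_edge rg.
have vPs : vertex_set Pstar = V by rewrite VE; exact: region_vertex_set rg.
(* Since the vertex set is [V], convexity of [Pstar] and equality with [P] are the same
   proposition. *)
have convexE : is_convex Pstar = (Pstar = P) by rewrite /is_convex vPs.
have summary : if longer c then [/\ ~ unit_edge P, Pstar <> P & ~ is_convex Pstar]
    else [/\ unit_edge P, Pstar = P & is_convex Pstar].
  rewrite convexE; case: ifP => [lc|/negbT/negbTE/convex_regions Rg1].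
    have nP : ~ unit_edge P.
      have := long_edges_ok c; rewrite /long_edge_ok lc; case: (long_edge c) => [[[m a] x] y].
      by rewrite /P VE; exact: long_not_unit n3 ok.
    have ne : Pstar <> P by move=> e; apply: nP; rewrite -e.
    by split.
  have PE : Pstar = P.
    by move: rg; rewrite /P VE /Pstar Rg1 => rg; exact: region_conv_facets n3 rg.
  by rewrite -PE; split.
split=> //; first exact: region_polytope rg n3.
have select (A B : Prop) d : (if longer d then A else B) -> match d with
    | D5 | L5 | E6 | E7 => B
    | Q5 | R5 | C6_72b | C6_72c | C6_72d | C7_126b | C7_126c | C7_126d => A
    end by case: d.
exact: select summary.
Qed.
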